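(* Let $p$ be a prime and let $D$ be a positive integer such that $-D$ is congruent to a square modulo $4p$. Let $f$ be a modular function for $\Gamma_0^*(p)$ (holomorphic on the upper half plane $\mathcal H$) whose Fourier expansion at $i\infty$ has the form $$f(z)=\sum_{m=1}^N a_m e(-mz)+\sum_{n\ge 1} b_n e(nz),$$ i.e. its principal part at $i\infty$ is $\sum_{m=1}^N a_m e(-mz)$ (with vanishing constant term). For positive integers $m,c$ put $$S_D(m,c)=\sum_{\substack{x \bmod c\\ x^2\equiv -D \pmod c}} e(2mx/c),$$ and for $m\ge 1$ write $p^\alpha\,\|\,m$ and put $$c_m=-24\left(\frac{-p^{\alpha+1}}{p+1}\,\sigma(m/p^\alpha)+\sigma(m)\right),$$ where $\sigma(n)$ is the sum of the positive divisors of $n$. Then $$\mathbf t_f^*(D)=\sum_{m=1}^N a_m\left[c_m H_p^*(D)+\sum_{\substack{c>0\\ c\equiv 0 \ (\mathrm{mod}\ 4p)}} S_D(m,c)\sinh\!\left(\frac{4\pi m\sqrt D}{c}\right)\right].$$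
   Context: Notation: $e(w)=e^{2\pi i w}$, $q=e(z)$ for $z\in\mathcal H$. For prime $p$, $\Gamma_0^*(p)$ is the group (acting on $\mathcal H$ by fractional linear transformations) generated by $\Gamma_0(p)$ and the Fricke involution $W_p=\frac{1}{\sqrt p}\begin{pmatrix}0&-1\\ p&0\end{pmatrix}$. For $D>0$, $\mathcal Q_D$ is the set of positive definite integral binary quadratic forms $Q=[a,b,c]=ax^2+bxy+cy^2$ with $b^2-4ac=-D$, and $z_Q=\frac{-b+i\sqrt D}{2a}\in\mathcal H$ is its CM point. $\mathcal Q_{D,p}$ is the set of $Q=[a,b,c]\in\mathcal Q_D$ with $a\equiv 0\pmod p$. The group $\Gamma_0^*(p)$ acts on $\mathcal Q_{D,p}$ compatibly with its action on CM points (elements $\gamma$ of $\Gamma_0(p)$ act in the usual way on forms so that $z_{Q\circ\gamma}=\gamma^{-1}z_Q$, and $W_p$ sends $[pa,b,c]$ to $[pc,-b,a]$, whose CM point is $W_p z_Q$); $\Gamma_0^*(p)_Q$ denotes the stabilizer of $Q$ in $\Gamma_0^*(p)$ (as a group of transformations of $\mathcal H$). Define $$H_p^*(D)=\sum_{Q\in\mathcal Q_{D,p}/\Gamma_0^*(p)}\frac{1}{|\Gamma_0^*(p)_Q|},\qquad \mathbf t_f^*(D)=\sum_{Q\in\mathcal Q_{D,p}/\Gamma_0^*(p)}\frac{1}{|\Gamma_0^*(p)_Q|}\,f(z_Q).$$ A modular function for $\Gamma_0^*(p)$ here means a $\Gamma_0^*(p)$-invariant function holomorphic on $\mathcal H$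 and meromorphic at the cusp $i\infty$. *)

(* Defs.v *)
From HB Require Import structures.
From mathcomp Require Import all_boot all_order all_algebra finmap.
From mathcomp Require Import complex ring.
From mathcomp Require Import all_classical all_reals all_analysis.

Set Implicit Arguments.
Unset Strict Implicit.
Unset Printing Implicit Defensive.

Import Order.TTheory GRing.Theory Num.Theory.
Import numFieldNormedType.Exports.

Local Open Scope classical_set_scope.
Local Open Scope complex_scope.
Local Open Scope ring_scope.

(* [R[i]] only carries its topology (and its normed module structure over
   itself) through the regular-module alias [R[i]^o]. *)

Section Functions.
Variable R : realType.

Definition cexp (z : R[i]) : R[i] :=
  (expR (complex.Re z))%:C * (cos (complex.Im z) +i* sin (complex.Im z)).

Definition e2pi (w : R[i]) : R[i] := cexp ((2 * pi)%:C * 'i * w).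

Definition sinh (x : R) : R := (expR x - expR (- x)) / 2.

Definition upper_half_plane : set R[i] := [set z | 0 < complex.Im z].

(* [derivable f z 1] is the existence of the limit of (f (h + z) - f z) / h
   as h tends to 0 in R[i], i.e. complex differentiability at z. *)
Definition holomorphic_on_uhp (f : R[i] -> R[i]) : Prop :=
  forall z, upper_half_plane z -> derivable (f : R[i]^o -> R[i]^o) z 1.

(* A Laurent expansion in q = e(z), with finite principal part, near i oo. *)
Definition meromorphic_at_ioo (f : R[i] -> R[i]) : Prop :=
  exists (k : nat) (u : nat -> R[i]) (y : R),
  forall z, upper_half_plane z -> y < complex.Im z ->
    series (fun n => u n * e2pi ((n%:R - k%:R) * z) : R[i]^o) @ \oo
      --> (f z : R[i]^o).

End Functions.

Section Groups.

Definition mx2 (T : Type) (a b c d : T) : 'M[T]_2 :=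
  \matrix_(i, j) if i == 0 then (if j == 0 then a else b)
                 else (if j == 0 then c else d).

Definition Gamma0 (p : nat) : set 'M[int]_2 :=
  [set g : 'M[int]_2 | \det g = 1 /\ (p%:Z %| g 1%R 0%R)%Z].

Variable R : realType.

Definition Fricke (p : nat) : 'M[R]_2 :=
  (Num.sqrt p%:R)^-1 *: mx2 0 (- 1) p%:R 0.

Inductive Gamma0star (p : nat) : 'M[R]_2 -> Prop :=
| Gamma0star_Gamma0 g of Gamma0 p g : Gamma0star p (map_mx intr g)
| Gamma0star_Fricke : Gamma0star p (Fricke p)
| Gamma0star_mul g h of Gamma0star p g & Gamma0star p h :
    Gamma0star p (g *m h)
| Gamma0star_inv g of Gamma0star p g : Gamma0star p (invmx g).

Definition mobius (g : 'M[R]_2) (z : R[i]) : R[i] :=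
  ((g 0 0)%:C * z + (g 0 1)%:C) / ((g 1 0)%:C * z + (g 1 1)%:C).

Definition modular_function (p : nat) (f : R[i] -> R[i]) : Prop :=
  [/\ holomorphic_on_uhp f,
      forall g z, Gamma0star p g -> upper_half_plane z -> f (mobius g z) = f z
    & meromorphic_at_ioo f].

End Groups.

(* The triple (a, b, c) stands for the form a x^2 + b x y + c y^2. *)
Definition bqf (T : Type) : Type := (T * T * T)%type.

Definition qeval (T : comNzRingType) (Q : bqf T) (x y : T) : T :=
  let: (a, b, c) := Q in a * x ^+ 2 + b * x * y + c * y ^+ 2.

Definition qcomp (T : comNzRingType) (Q : bqf T) (g : 'M[T]_2) : bqf T :=
  let: (a, b, c) := Q in
  (a * g 0 0 ^+ 2 + b * g 0 0 * g 1 0 + c * g 1 0 ^+ 2,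
   2 * a * g 0 0 * g 0 1 + b * (g 0 0 * g 1 1 + g 0 1 * g 1 0)
     + 2 * c * g 1 0 * g 1 1,
   a * g 0 1 ^+ 2 + b * g 0 1 * g 1 1 + c * g 1 1 ^+ 2).

Definition qmap (T U : Type) (h : T -> U) (Q : bqf T) : bqf U :=
  let: (a, b, c) := Q in (h a, h b, h c).

Definition pos_definite (Q : bqf int) : Prop :=
  forall x y : int, (x, y) != (0, 0) -> 0 < qeval Q x y.

Definition forms (D : nat) : set (bqf int) :=
  [set Q | pos_definite Q /\
           let: (a, b, c) := Q in b ^+ 2 - 4 * a * c = - D%:Z].

Definition forms_level (D p : nat) : set (bqf int) :=
  [set Q | forms D Q /\ (p%:Z %| Q.1.1)%Z].

Section Traces.
Variable R : realType.

(* [sends g Q Q'] says that g in SL_2(R) carries the integral form Q to the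
   integral form Q' = Q o g; on Gamma_0(p) this is the usual right action, and
   the lemma [sends_Fricke] below identifies it on W_p. *)
Definition sends (g : 'M[R]_2) (Q Q' : bqf int) : Prop :=
  qmap intr Q' = qcomp (qmap intr Q) g.

Definition orbit_of (p : nat) (Q : bqf int) : set (bqf int) :=
  [set Q' | exists2 g, Gamma0star p g & sends g Q Q'].

Definition orbits (D p : nat) : set (set (bqf int)) :=
  orbit_of p @` forms_level D p.

(* Transformations of the upper half plane, so that g and - g are not counted
   separately. *)
Definition stabilizer (p : nat) (Q : bqf int) :
    set (@upper_half_plane R -> R[i]) :=
  [set (fun z => mobius g (set_val z))
     | g in [set g | Gamma0star p g /\ sends g Q Q]].

Definition stab_card (p : nat) (Q : bqf int) : nat :=
  #|` fset_set (stabilizer p Q)|%fset.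

Definition cm_point (D : nat) (Q : bqf int) : R[i] :=
  let: (a, b, c) := Q in
  ((- b)%:~R +i* Num.sqrt D%:R) / (2 * a)%:~R.

Definition orbit_repr (O : set (bqf int)) : bqf int := xget (0, 0, 0) O.

Definition Hstar (p D : nat) : R :=
  \sum_(O \in orbits D p) ((stab_card p (orbit_repr O))%:R^-1 : R).

Definition trace_star (p : nat) (f : R[i] -> R[i]) (D : nat) : R[i] :=
  \sum_(O \in orbits D p)
     (stab_card p (orbit_repr O))%:R^-1 * f (cm_point D (orbit_repr O)).

Definition expsum (D m c : nat) : R[i] :=
  \sum_(x < c | ((x%:Z ^+ 2)%R == - D%:Z %[mod c%:Z])%Z)
     e2pi (2 * m%:R * x%:R / c%:R).

Definition sigma (n : nat) : nat := (\sum_(d <- divisors n) d)%N.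

Definition cconst (p m : nat) : R :=
  let alpha := logn p m in
  - 24 * (- (p%:R ^+ alpha.+1) / (p%:R + 1) * (sigma (m %/ p ^ alpha))%:R
          + (sigma m)%:R).

(* Partial sums, over c < n, of the (conditionally convergent) series over the
   c > 0 divisible by 4 p. *)
Definition sinh_series (p D m : nat) : nat -> R[i]^o :=
  fun n => \sum_(1 <= c < n | (4 * p %| c)%N)
    expsum D m c * (sinh (4 * pi * m%:R * Num.sqrt D%:R / c%:R))%:C.

End Traces.

Lemma qeval_qcomp (T : comNzRingType) (Q : bqf T) (g : 'M[T]_2) (x y : T) :
  qeval (qcomp Q g) x y =
  qeval Q (g 0 0 * x + g 0 1 * y) (g 1 0 * x + g 1 1 * y).
Proof. by case: Q => [[a b] c]; rewrite /qeval /qcomp /=; ring. Qed.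

Lemma sends_Fricke (R : realType) (p : nat) (a b c : int) : (0 < p)%N ->
  sends (Fricke R p) (p%:Z * a, b, c) (p%:Z * c, - b, a).
Proof.
move=> p0; rewrite /sends /qcomp /qmap /Fricke !mxE /= !(mulr0, mul0r).
have s0 : Num.sqrt (p%:R : R) != 0 by rewrite sqrtr_eq0 -ltNge ltr0n.
have sE : (p%:R : R) = Num.sqrt p%:R ^+ 2 by rewrite sqr_sqrtr.
move: s0 sE; set s := Num.sqrt _ => s0 sE.
rewrite !intrM -!pmulrn rmorphN /= sE.
by congr (_, _, _); field.
Qed.

(* Main.v *)
Require Import Defs.
From HB Require Import structures.
From mathcomp Require Import all_boot all_order all_algebra finmap.
From mathcomp Require Import complex.
From mathcomp Require Import ring lra zify.
From mathcomp Require Import all_classical all_reals all_analysis.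

Import Order.TTheory GRing.Theory Num.Theory.
Import numFieldNormedType.Exports.

Local Open Scope classical_set_scope.
Local Open Scope complex_scope.
Local Open Scope ring_scope.

(** The function [phi m z = e(- m z) - e(- m conj z)] is harmonic, periodic and has
    principal part [e(- m z)].  Averaging it over Gamma_infinity \ Gamma_0^*(p), with
    the terms of height [Im (g z) <= eps] removed, gives a function which is
    invariant for trivial reasons.  As [eps] tends to 0 it converges, only
    conditionally, to an invariant harmonic function [F_m]: the terms with a given
    lower left entry [c] carry Kloosterman sums, and the elementary fourth moment
    bound for these (of Kloosterman) followed by completion and partial summation
    majorises them by a convergent series, uniformly in [eps].  At the cusp
    [F_m z - phi m z] tends to a constant, which Ramanujan sums and
    [zeta 2 = pi ^ 2 / 6] identify as [- c_m].

    The difference of [f] and [sum_m a_m F_m] is invariant, harmonic and bounded,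
    and tends to [sum_m a_m c_m] at the cusp.  As every orbit meets
    [Im z >= 1 / (2 p)], Harnack's inequality shows that it is constant.  Hence
    [f = sum_m a_m (F_m + c_m)].

    Finally, for [eps = 2 sqrt D / n] the sum of the truncated series over the CM
    points unfolds to a sum over the forms [[a, b, c]] with [0 <= b < 2 a] and
    [4 a < n], which is exactly the partial sum of the series over [4 a = c < n];
    now let [n] tend to infinity. *)

(** In weight 0 the terms e(-m g z) tend to modulus 1, so their plain average cannot converge.
    Subtracting e(-m conj(g z)) makes the term with lower row (c, d) of size |c z + d|^-2, which
    still just fails to be absolutely summable. A classical remedy is a complex parameter and
    analytic continuation. The cut-off in height replaces it: every truncated sum is finite and
    exactly invariant, and its trace unfolds exactly, so that the values of the harmonic function
    and the sum of the series come out of one and the same limit.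

    The price is cancellation in the sum over d. Any saving of a power of c in the incomplete
    Kloosterman sums is enough: the fourth moment gives c^(3/4) up to divisors, the logarithm lost
    in completion is majorised by c^(1/8), and division by c^2 leaves d(c) c^(-9/8).

    Harmonicity is recorded as uniform approximability on discs by P + conj Q with polynomials P and
    Q. This survives uniform limits and is all that Harnack's inequality needs, so the limit
    functions are never differentiated. The factor 24 in c_m is 4 pi^2 / zeta(2). *)

Set Implicit Arguments.
Unset Strict Implicit.
Unset Printing Implicit Defensive.

(** * Complex numbers and limits *)

Section ComplexNorm.
Variable R : realType.
Implicit Types (z w : R[i]) (x y t : R).

Definition nm z : R := Normc.normc z.
Arguments nm : simpl never.

Lemma nmE z : (nm z)%:C = `|z|.
Proof. by []. Qed.

Lemma nm_ge0 z : 0 <= nm z.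
Proof. by case: z => a b; exact: sqrtr_ge0. Qed.

Lemma nm0 : nm 0 = 0. Proof. exact: Normc.normc0. Qed.
Lemma nm1 : nm 1 = 1. Proof. exact: Normc.normc1. Qed.

Lemma nmM z w : nm (z * w) = nm z * nm w. Proof. exact: Normc.normcM. Qed.
Lemma nmV z : nm z^-1 = (nm z)^-1. Proof. exact: Normc.normcV. Qed.
Lemma nmN z : nm (- z) = nm z. Proof. exact: normcN. Qed.
Lemma nmD z w : nm (z + w) <= nm z + nm w. Proof. exact: le_normcD. Qed.
Lemma nmB z w : nm (z - w) <= nm z + nm w.
Proof. by rewrite -(nmN w); exact: nmD. Qed.
Lemma nm_distC z w : nm (z - w) = nm (w - z).
Proof. by rewrite -nmN opprB. Qed.
Lemma nmX z n : nm (z ^+ n) = nm z ^+ n.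
Proof. by elim: n => [|n IH]; rewrite ?expr0 ?nm1 // !exprS nmM IH. Qed.
Lemma nm_eq0 z : nm z = 0 -> z = 0. Proof. exact: Normc.eq0_normc. Qed.
Lemma nm_gt0 z : z != 0 -> 0 < nm z.
Proof.
by move=> z0; rewrite lt_neqAle nm_ge0 eq_sym andbT; apply: contraNneq z0 => /nm_eq0 ->.
Qed.
Lemma nm_real x : nm x%:C = `|x|.
Proof. by rewrite /nm /= expr0n /= addr0 sqrtr_sqr. Qed.
Lemma nm_nat n : nm n%:R = n%:R.
Proof. by rewrite -(rmorph_nat (real_complex R)) nm_real normr_nat. Qed.
Lemma nm_conj z : nm (conjc z) = nm z.
Proof. by case: z => a b; rewrite /nm /= sqrrN. Qed.
Lemma nm_Re z : `|complex.Re z| <= nm z.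
Proof.
case: z => a b; rewrite /nm /= -sqrtr_sqr ler_sqrt ?addr_ge0 ?sqr_ge0 //.
by rewrite lerDl sqr_ge0.
Qed.
Lemma nm_Im z : `|complex.Im z| <= nm z.
Proof.
case: z => a b; rewrite /nm /= -sqrtr_sqr ler_sqrt ?addr_ge0 ?sqr_ge0 //.
by rewrite lerDr sqr_ge0.
Qed.
Lemma complex_split z : z = (complex.Re z)%:C + 'i * (complex.Im z)%:C.
Proof. exact: complexE. Qed.
Lemma nm_i : nm 'i = 1.
Proof. by rewrite /nm /= expr0n expr1n add0r sqrtr1. Qed.
Lemma nm_le z : nm z <= `|complex.Re z| + `|complex.Im z|.
Proof.
by rewrite {1}(complex_split z) (le_trans (nmD _ _)) // nmM nm_i mul1r !nm_real.
Qed.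
Lemma nm_sqr z : nm z ^+ 2 = complex.Re z ^+ 2 + complex.Im z ^+ 2.
Proof. by case: z => a b; rewrite /nm /= sqr_sqrtr // addr_ge0 ?sqr_ge0. Qed.
Lemma nm_sum (I : Type) (r : seq I) (P : pred I) (F : I -> R[i]) :
  nm (\sum_(i <- r | P i) F i) <= \sum_(i <- r | P i) nm (F i).
Proof.
elim/big_rec2: _ => [|i y2 y1 _ IH]; first by rewrite nm0.
by rewrite (le_trans (nmD _ _)) // lerD2l.
Qed.
Lemma nm_triangle z w u : nm (z - u) <= nm (z - w) + nm (w - u).
Proof. by rewrite -[z - u](subrKA w); exact: nmD. Qed.
Lemma nm_lerB z w : nm z - nm w <= nm (z - w).
Proof. by rewrite lerBlDr; have := nmD (z - w) w; rewrite subrK. Qed.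

Lemma ReD z w : complex.Re (z + w) = complex.Re z + complex.Re w.
Proof. by case: z w => [a b] [c d]. Qed.
Lemma ImD z w : complex.Im (z + w) = complex.Im z + complex.Im w.
Proof. by case: z w => [a b] [c d]. Qed.
Lemma ReN z : complex.Re (- z) = - complex.Re z. Proof. by case: z. Qed.
Lemma ImN z : complex.Im (- z) = - complex.Im z. Proof. by case: z. Qed.
Lemma ReZ x z : complex.Re (x%:C * z) = x * complex.Re z.
Proof. by case: z => a b /=; ring. Qed.
Lemma ImZ x z : complex.Im (x%:C * z) = x * complex.Im z.
Proof. by case: z => a b /=; ring. Qed.
Lemma complex_eq z w :
  complex.Re z = complex.Re w -> complex.Im z = complex.Im w -> z = w.
Proof. by case: z w => [a b] [c d] /= -> ->. Qed.

Lemma natC n : (n%:R : R[i]) = (n%:R : R)%:C.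
Proof. by rewrite rmorph_nat. Qed.
Lemma intC (n : int) : (n%:~R : R[i]) = (n%:~R : R)%:C.
Proof. by rewrite rmorph_int. Qed.

End ComplexNorm.
Arguments nm : simpl never.


Section ComplexLimits.
Variable R : realType.
Implicit Types (u v : nat -> R[i]) (l : R[i]).

Definition ccvg u l := forall e : R, 0 < e ->
  exists N, forall n, (N <= n)%N -> nm (u n - l) <= e.

Lemma ccvgP u l : (u : nat -> R[i]^o) @ \oo --> (l : R[i]^o) <-> ccvg u l.
Proof.
split=> [/cvgrPdist_le h e e0|h].
  have [|N _ hN] := h e%:C; first by rewrite ltcR.
  by exists N => n /hN /=; rewrite distrC -nmE lecR.
apply/cvgrPdist_le => e e0.
have eE : e = (complex.Re e)%:C by apply/esym/RRe_real; rewrite gtr0_real.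
have [|N hN] := h (complex.Re e); first by rewrite -ltcR -eE.
by exists N => // n /hN /= hn; rewrite distrC -nmE eE lecR.
Qed.

Lemma ccvg_lim u l : ccvg u l -> cvgn (u : nat -> R[i]^o) /\ limn (u : nat -> R[i]^o) = l.
Proof.
move=> /ccvgP h; split; first by apply/cvg_ex; exists l.
by apply/cvg_lim => //; exact: norm_hausdorff.
Qed.

Lemma ccvg_unique u l l' : ccvg u l -> ccvg u l' -> l = l'.
Proof. by move=> /ccvg_lim [_ <-] /ccvg_lim [_ <-]. Qed.

Lemma ccvg_cst l : ccvg (fun=> l) l.
Proof. by move=> e e0; exists 0%N => n _; rewrite subrr nm0 ltW. Qed.

Lemma ccvgD u v l l' : ccvg u l -> ccvg v l' -> ccvg (fun n => u n + v n) (l + l').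
Proof.
move=> hu hv e e0.
have [N hN] := hu (e / 2) ltac:(lra).
have [M hM] := hv (e / 2) ltac:(lra).
exists (maxn N M) => n; rewrite geq_max => /andP[/hN h1 /hM h2].
have -> : u n + v n - (l + l') = (u n - l) + (v n - l') by ring.
by apply: (le_trans (nmD _ _)); lra.
Qed.

Lemma ccvgZ u l z : ccvg u l -> ccvg (fun n => z * u n) (z * l).
Proof.
move=> hu e e0; have h1 : 0 < nm z + 1 by rewrite ltr_wpDl ?nm_ge0.
have [N hN] := hu (e / (nm z + 1)) ltac:(exact: divr_gt0).
exists N => n /hN h; rewrite -mulrBr nmM.
apply: (@le_trans _ _ ((nm z + 1) * (e / (nm z + 1)))).
  by apply: ler_pM; rewrite ?nm_ge0 //; lra.
by rewrite mulrCA divff ?mulr1 // gt_eqF.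
Qed.

Lemma ccvg_sum (I : Type) (r : seq I) (P : pred I) (u : I -> nat -> R[i])
    (l : I -> R[i]) : (forall i, P i -> ccvg (u i) (l i)) ->
  ccvg (fun n => \sum_(i <- r | P i) u i n) (\sum_(i <- r | P i) l i).
Proof.
move=> h; elim: r => [|i r IH].
  by rewrite big_nil; under eq_fun do rewrite big_nil; exact: ccvg_cst.
rewrite big_cons; under eq_fun do rewrite big_cons.
by case: ifP => // Pi; apply: ccvgD => //; exact: h.
Qed.

Lemma ccvg_le u l M N : ccvg u l ->
  (forall n, (N <= n)%N -> nm (u n) <= M) -> nm l <= M.
Proof.
move=> h hM; apply/ler_addgt0Pr => e e0.
have [n0 hn0] := h e e0.
have := hn0 (maxn n0 N) (leq_maxl _ _); have := hM (maxn n0 N) (leq_maxr _ _).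
set n := maxn _ _ => h1; rewrite nm_distC => h2.
by have := nm_lerB l (u n); lra.
Qed.

Lemma real_cauchy (u : nat -> R) :
  (forall e : R, 0 < e -> exists N, forall n, (N <= n)%N -> `|u n - u N| <= e) ->
  exists l : R, forall e : R, 0 < e -> exists N, forall n, (N <= n)%N -> `|u n - l| <= e.
Proof.
move=> h; have cu : cvgn u.
  apply/cauchy_cvgP/cauchyP => e e0.
  have [N hN] := h (e / 2) ltac:(rewrite divr_gt0 //).
  exists (u N); exists N => // n Nn; rewrite -ball_normE /= distrC.
  by apply: (le_lt_trans (hN n Nn)); lra.
exists (limn u) => e e0.
move/cvgrPdist_le : cu => /(_ e e0) [N _ hN].
by exists N => n /hN /=; rewrite distrC.
Qed.

Lemma ccauchy u :
  (forall e : R, 0 < e -> exists N, forall n, (N <= n)%N -> nm (u n - u N) <= e) ->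
  exists l, ccvg u l.
Proof.
move=> h.
have [l1 hl1] : exists l : R, forall e : R, 0 < e -> exists N, forall n, (N <= n)%N ->
    `|complex.Re (u n) - l| <= e.
  apply: real_cauchy => e /h [N hN]; exists N => n /hN.
  by rewrite -ReN -ReD; apply: le_trans; exact: nm_Re.
have [l2 hl2] : exists l : R, forall e : R, 0 < e -> exists N, forall n, (N <= n)%N ->
    `|complex.Im (u n) - l| <= e.
  apply: real_cauchy => e /h [N hN]; exists N => n /hN.
  by rewrite -ImN -ImD; apply: le_trans; exact: nm_Im.
exists (l1 +i* l2) => e e0.
have [N hN] := hl1 (e / 2) ltac:(lra).
have [M hM] := hl2 (e / 2) ltac:(lra).
exists (maxn N M) => n; rewrite geq_max => /andP[/hN h1 /hM h2].
apply: (le_trans (nm_le _)); rewrite ReD ImD ReN ImN /=; lra.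
Qed.

End ComplexLimits.

(** * The exponential function and the characters e(t) *)

Section ComplexExponential.
Variable R : realType.
Implicit Types (z w : R[i]) (x y t : R).

Lemma cexpD z w : cexp (z + w) = cexp z * cexp w.
Proof.
case: z w => [a b] [c d]; rewrite /cexp /= expRD cosD sinD.
by apply: complex_eq => /=; ring.
Qed.

Lemma cexp0 : cexp (0 : R[i]) = 1.
Proof. by rewrite /cexp /= expR0 cos0 sin0; apply: complex_eq => /=; ring. Qed.

Lemma cexp_conj z : conjc (cexp z) = cexp (conjc z).
Proof.
by case: z => a b; rewrite /cexp /= cosN sinN; apply: complex_eq => /=; ring.
Qed.

Lemma nm_cexp z : nm (cexp z) = expR (complex.Re z).
Proof.
rewrite /cexp nmM nm_real ger0_norm ?expR_ge0 //.
suff -> : nm (cos (complex.Im z) +i* sin (complex.Im z)) = 1 by rewrite mulr1.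
by rewrite /nm /= cos2Dsin2 sqrtr1.
Qed.

Lemma cexp_neq0 z : cexp z != 0.
Proof.
apply/eqP => /(congr1 (@nm R)); rewrite nm_cexp nm0 => /eqP.
by rewrite gt_eqF ?expR_gt0.
Qed.

Lemma cexpN z : cexp (- z) = (cexp z)^-1.
Proof.
by apply: (mulIf (cexp_neq0 z)); rewrite -cexpD addNr cexp0 mulVf ?cexp_neq0.
Qed.

Lemma cexpMn z n : cexp (n%:R * z) = cexp z ^+ n.
Proof.
elim: n => [|n IH]; first by rewrite mul0r cexp0.
by rewrite -natr1 mulrDl mul1r cexpD IH exprSr.
Qed.

Lemma nm_cexp_le z : nm (cexp z) <= expR (nm z).
Proof. by rewrite nm_cexp ler_expR (le_trans (ler_norm _)) // nm_Re. Qed.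

Lemma abs_sin_le x : `|sin x| <= `|x|.
Proof.
have H y : 0 <= y -> `|sin y| <= y.
  move=> y0; have [c _] := @MVT_segment R sin cos 0 y y0
    (fun c _ => is_derive_sin c) (continuous_subspaceT (@continuous_sin R)).
  rewrite sin0 !subr0 => ->; rewrite normrM (ger0_norm y0).
  by rewrite ler_piMl // cos_max.
have [x0|x0] := leP 0 x; first by rewrite (ger0_norm x0) H.
by rewrite -normrN -sinN (ltr0_norm x0) H // oppr_ge0 ltW.
Qed.

Lemma abs_cosB1_le x : `|cos x - 1| <= x ^+ 2.
Proof.
have H y : 0 <= y -> `|cos y - 1| <= y ^+ 2.
  move=> y0; have [c] := @MVT_segment R cos (fun z : R => - sin z) 0 y y0
    (fun c _ => is_derive_cos c) (continuous_subspaceT (@continuous_cos R)).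
  rewrite in_itv /= => /andP[c0 cy]; rewrite cos0 !subr0 => ->.
  rewrite normrM normrN (ger0_norm y0) expr2 ler_wpM2r //.
  by rewrite (le_trans (abs_sin_le _)) // ger0_norm.
have [x0|x0] := leP 0 x; first exact: H.
by rewrite -cosN -sqrrN H // oppr_ge0 ltW.
Qed.

Lemma abs_sinB_le x : `|sin x - x| <= `|x| ^+ 3.
Proof.
have H y : 0 <= y -> `|sin y - y| <= y ^+ 3.
  move=> y0; have [c] := @MVT_segment R sin cos 0 y y0
    (fun c _ => is_derive_sin c) (continuous_subspaceT (@continuous_sin R)).
  rewrite in_itv /= => /andP[c0 cy]; rewrite sin0 !subr0 => ->.
  have -> : cos c * y - y = (cos c - 1) * y by ring.
  rewrite normrM (ger0_norm y0) exprSr ler_wpM2r //.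
  by rewrite (le_trans (abs_cosB1_le _)) // lerXn2r // nnegrE.
have [x0|x0] := leP 0 x; first by rewrite (ger0_norm x0) H.
have -> : sin x - x = - (sin (- x) - (- x)) by rewrite sinN; ring.
by rewrite normrN (ltr0_norm x0) H // oppr_ge0 ltW.
Qed.

Lemma normK2 x : `|x| ^+ 2 = x ^+ 2.
Proof. by rewrite -normrX ger0_norm // sqr_ge0. Qed.

(** Inversion of exp(-x) >= 1 - x, since (1 - x)(1 + x + 2 x^2) >= 1 for x <= 1/2. *)
Lemma expR_le_quad x : `|x| <= 1 / 2 -> expR x <= 1 + x + 2 * x ^+ 2.
Proof.
rewrite ler_norml => /andP[x1 x2].
have h : 0 < 1 - x by lra.
have : expR x <= (1 - x)^-1.
  rewrite -[expR x]invrK -expRN lef_pV2 ?posrE ?expR_gt0 //.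
  exact: expR_ge1Dx.
move/le_trans; apply; rewrite -[X in X <= _]mul1r ler_pdivrMr //; nra.
Qed.

Lemma cexp_quad_small z : nm z <= 1 / 2 -> nm (cexp z - 1 - z) <= 4 * nm z ^+ 2.
Proof.
move=> hz; have := le_trans (nm_Re z) hz; have := le_trans (nm_Im z) hz.
rewrite nm_sqr; case: z hz => x y /= _ hy hx.
apply: (le_trans (nm_le _)); rewrite /= !(mul0r, mulr0, subr0, addr0, oppr0).
have e1 := expR_le_quad hx; have e2 := expR_ge1Dx x.
have c1 := abs_cosB1_le y; have s1 := abs_sin_le y; have s2 := abs_sinB_le y.
set E := expR x in e1 e2 *; set c := cos y in c1 *; set s := sin y in s1 s2 *.
have E2 : E <= 2 by move: hx; rewrite ler_norml => /andP[? ?]; nra.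
have E0 : 0 <= E by exact: expR_ge0.
have h1 : `|E * c - 1 - x| <= 2 * x ^+ 2 + 2 * y ^+ 2.
  have -> : E * c - 1 - x = (E - 1 - x) + E * (c - 1) by ring.
  apply: (le_trans (ler_normD _ _)); rewrite lerD //.
    by rewrite ger0_norm; lra.
  by rewrite normrM (ger0_norm E0); apply: ler_pM.
have h2 : `|E * s - y| <= 2 * `|x| * `|y| + y ^+ 2.
  have -> : E * s - y = (E - 1) * s + (s - y) by ring.
  apply: (le_trans (ler_normD _ _)); rewrite lerD //.
    rewrite normrM; apply: ler_pM => //.
    have hE : 0 <= E - 1 - x by lra.
    have -> : E - 1 = (E - 1 - x) + x by ring.
    apply: (le_trans (ler_normD _ _)); rewrite (ger0_norm hE).
    have := normK2 x; have := normr_ge0 x; move: hx; set X := `|x|.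
    by move=> *; nra.
  apply: (le_trans s2); rewrite -normK2 exprSr; have := normr_ge0 y.
  by move: hy; set Y := `|y| => *; rewrite ler_piMr ?sqr_ge0 //; lra.
have x2 : 2 * `|x| * `|y| <= x ^+ 2 + y ^+ 2.
  rewrite -(normK2 x) -(normK2 y).
  by have := sqr_ge0 (`|x| - `|y|); rewrite sqrrB; lra.
by have := sqr_ge0 x; have := sqr_ge0 y; lra.
Qed.

Lemma cexp_quad (r : R) z : nm z <= r ->
  nm (cexp z - 1 - z) <= 4 * (expR r + 1 + r) * nm z ^+ 2.
Proof.
move=> hz; have r0 : 0 <= r := le_trans (nm_ge0 z) hz.
have e0 := expR_ge0 r; have [hs|hs] := leP (nm z) (1 / 2).
  apply: (le_trans (cexp_quad_small hs)); 
  by rewrite -mulrA ler_pM2l // ler_peMl ?sqr_ge0 //; lra.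
have h1 : nm (cexp z - 1 - z) <= expR r + 1 + r.
  apply: (le_trans (nmB _ _)); apply: lerD => //.
  apply: (le_trans (nmB _ _)); rewrite nm1 lerD2r.
  by rewrite (le_trans (nm_cexp_le z)) // ler_expR.
(* Away from the origin the quadratic factor is at least 1, so the triangle inequality is enough. *)
have h2 : 1 <= 4 * nm z ^+ 2.
  by move: hs; set t := nm z => hs; nra.
apply: (le_trans h1); have h3 : 0 <= expR r + 1 + r by lra.
by move: h2 h3; set a := nm z ^+ 2; set b := _ + r => h2 h3; nra.
Qed.

Lemma e2piD z w : e2pi (z + w) = e2pi z * e2pi w.
Proof. by rewrite /e2pi mulrDr cexpD. Qed.
Lemma e2piN z : e2pi (- z) = (e2pi z)^-1.
Proof. by rewrite /e2pi mulrN cexpN. Qed.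
Lemma e2pi0 : e2pi (0 : R[i]) = 1.
Proof. by rewrite /e2pi mulr0 cexp0. Qed.
Lemma e2pi_neq0 z : e2pi z != 0.
Proof. exact: cexp_neq0. Qed.
Lemma e2piMn z n : e2pi (n%:R * z) = e2pi z ^+ n.
Proof. by rewrite /e2pi mulrCA cexpMn. Qed.
Lemma e2pi_conj z : conjc (e2pi z) = e2pi (- conjc z).
Proof.
rewrite /e2pi cexp_conj; congr cexp.
by case: z => a b; apply: complex_eq => /=; ring.
Qed.
Lemma nm_e2pi z : nm (e2pi z) = expR (- (2 * pi * complex.Im z)).
Proof.
by rewrite /e2pi nm_cexp; congr expR; case: z => a b /=; ring.
Qed.

Definition ee t : R[i] := e2pi t%:C.

Lemma eeD s t : ee (s + t) = ee s * ee t.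
Proof. by rewrite /ee rmorphD e2piD. Qed.
Lemma eeN t : ee (- t) = (ee t)^-1.
Proof. by rewrite /ee rmorphN e2piN. Qed.
Lemma ee0 : ee 0 = 1. Proof. exact: e2pi0. Qed.
Lemma nm_ee t : nm (ee t) = 1.
Proof. by rewrite nm_e2pi /= mulr0 oppr0 expR0. Qed.
Lemma ee_neq0 t : ee t != 0. Proof. exact: e2pi_neq0. Qed.
Lemma ee_conj t : conjc (ee t) = ee (- t).
Proof. by rewrite /ee e2pi_conj conjc_real rmorphN. Qed.
Lemma eeMn t n : ee (n%:R * t) = ee t ^+ n.
Proof. by rewrite /ee rmorphM rmorph_nat e2piMn. Qed.
Lemma eeE t : ee t = cos (2 * pi * t) +i* sin (2 * pi * t).
Proof.
rewrite /ee /e2pi /cexp /= !(mul0r, mulr0, mulr1, addr0, subr0, sub0r, add0r, oppr0) expR0.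
by apply: complex_eq => /=; ring.
Qed.
Lemma ee1 : ee 1 = 1.
Proof.
by rewrite eeE mulr1 mulr_natl cos2pi sin2pi; apply: complex_eq.
Qed.
Lemma ee_nat n : ee n%:R = 1.
Proof. by rewrite -[n%:R]mulr1 eeMn ee1 expr1n. Qed.
Lemma ee_int (n : int) : ee n%:~R = 1.
Proof.
by case: n => n; rewrite ?NegzE ?mulrNz ?eeN -pmulrn ee_nat ?invr1.
Qed.
Lemma eeDint t (n : int) : ee (t + n%:~R) = ee t.
Proof. by rewrite eeD ee_int mulr1. Qed.
Lemma e2pi_intD z (n : int) : e2pi (z + n%:~R) = e2pi z.
Proof. by rewrite e2piD intC -[e2pi _%:C]/(ee _) ee_int mulr1. Qed.
Lemma e2pi_polar z : e2pi z = (expR (- (2 * pi * complex.Im z)))%:C * ee (complex.Re z).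
Proof.
rewrite eeE /e2pi /cexp; case: z => a b /=.
by congr (_ * _); [congr (_%:C); congr expR; ring | congr (_ +i* _); [congr cos|congr sin]; ring].
Qed.

Lemma ee_neq1 t : 0 < t < 1 -> ee t != 1.
Proof.
move=> /andP[t0 t1]; apply/eqP => /(congr1 (@complex.Re R)).
rewrite eeE /= => h.
have : 0 < sin (pi * t).
  by apply: sin_gt0_pi; rewrite mulr_gt0 ?pi_gt0 //= gtr_pMr ?pi_gt0.
have : cos (2 * pi * t) = 1 - 2 * sin (pi * t) ^+ 2.
  have -> : 2 * pi * t = (pi * t) *+ 2 by rewrite -mulr_natl; ring.
  by rewrite cos_mulr2n cos2sin2; ring.
rewrite h => h2; have : sin (pi * t) ^+ 2 = 0 by lra.
by move/eqP; rewrite sqrf_eq0 => /eqP ->; rewrite ltxx.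
Qed.

Lemma ee_frac_neq1 (c : nat) (n : int) : (0 < c)%N -> ~~ (c%:Z %| n)%Z ->
  ee (n%:~R / c%:R) != 1.
Proof.
move=> c0 nd; have cn0 : (c%:R : R) != 0 by rewrite pnatr_eq0 -lt0n.
have cz : c%:Z != 0 by case: c c0 {nd cn0}.
rewrite (divz_eq n c) intrD intrM -pmulrn mulrDl mulfK // addrC eeDint.
have : 0 <= (n %% c)%Z by rewrite modz_ge0.
have : (n %% c)%Z < c%:Z by rewrite ltz_mod.
have : (n %% c)%Z != 0 by apply: contra nd => /eqP h; apply/dvdz_mod0P.
case: (n %% c)%Z => // r r0 rc _.
apply: ee_neq1; rewrite -pmulrn divr_gt0 ?ltr0n //=; last by case: r r0 {rc}.
by rewrite ltr_pdivrMr ?ltr0n // mul1r ltr_nat.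
Qed.

Lemma sum_ee_full (c : nat) (n : int) : (0 < c)%N ->
  \sum_(0 <= k < c) ee (n%:~R * k%:R / c%:R) = (if (c%:Z %| n)%Z then c%:R else 0).
Proof.
move=> c0; have cn0 : (c%:R : R) != 0 by rewrite pnatr_eq0 -lt0n.
have E k : ee (n%:~R * k%:R / c%:R) = ee (n%:~R / c%:R) ^+ k.
  by rewrite -eeMn; congr ee; field.
under eq_bigr do rewrite E.
case: ifP => [/dvdzP[q ->]|nd].
  under eq_bigr do rewrite intrM -pmulrn mulfK // ee_int expr1n.
  by rewrite big_const_nat subn0 iter_addr_0.
have wn1 := ee_frac_neq1 c0 (negbT nd).
apply: (@mulfI _ (ee (n%:~R / c%:R) - 1)); first by rewrite subr_eq0.
by rewrite mulr0 big_mkord -subrX1 -eeMn mulrCA divff // mulr1 ee_int subrr.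
Qed.

End ComplexExponential.

(** * Kloosterman sums *)

Local Close Scope classical_set_scope.
Section ResidueRing.
Variable n : nat.
Local Notation c := n.+2.
Local Notation Zc := 'I_n.+2.
Implicit Types x y e d u : Zc.

(** In Z/c this is gcd(x, c); it is used through the inequalities that follow. *)
Definition Ann x : nat := #|[set e | x * e == 0]|.

Lemma val_natZ k : val (k%:R : Zc) = (k %% c)%N.
Proof. by rewrite Zp_nat. Qed.

Lemma eqZ_nat (j k : nat) : ((j%:R : Zc) == k%:R) = (j == k %[mod c])%N.
Proof. by rewrite -val_eqE /= !val_natZ. Qed.

Lemma natZ0 (k : nat) : ((k%:R : Zc) == 0) = (c %| k)%N.
Proof. by rewrite -[0]/(0%:R) eqZ_nat mod0n. Qed.

Lemma natZ_val x : (x : nat)%:R = x.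
Proof. by rewrite Zp_nat; apply: val_inj; rewrite /= modn_small. Qed.

Lemma mulZ0 x y : (x * y == 0) = (c %| x * y)%N.
Proof. by rewrite -{1}(natZ_val x) -{1}(natZ_val y) -natrM natZ0. Qed.

(** A non-empty fibre of multiplication by y is a coset of the annihilator of y. *)
Lemma card_Ann_fiber y b : (#|[set e | (y * e == b)%R]| <= Ann y)%N.
Proof.
have [->|[e0]] := set_0Vmem [set e | y * e == b]; first by rewrite cards0.
rewrite inE => /eqP h0.
rewrite -(card_imset _ (addIr (- e0))); apply: subset_leq_card.
apply/fintype.subsetP => e /imsetP[e']; rewrite !inE => /eqP h ->.
by rewrite mulrBr h h0 subrr.
Qed.

(** Sort the solutions e of x y e = 0 by the value y e, which lies in the annihilator of x. *)
Lemma Ann_mul x y : (Ann (x * y)%R <= Ann x * Ann y)%N.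
Proof.
rewrite {1}/Ann -sum1_card.
rewrite (partition_big (fun e => y * e)%R (fun b => b \in [set b | x * b == 0])) /=; last first.
  by move=> e; rewrite !inE mulrA.
apply: (@leq_trans (\sum_(b in [set b | (x * b == 0)%R]) Ann y)%N).
  apply: leq_sum => b _; rewrite sum1_card.
  apply: leq_trans (card_Ann_fiber y b); apply: subset_leq_card.
  by apply/fintype.subsetP => e; rewrite !inE => /andP[].
by rewrite sum_nat_const.
Qed.

(** If c divides m e, the quotient m e / c is less than m and determines e. *)
Lemma Ann_nat (m : nat) : (0 < m)%N -> (Ann m%:R%R <= m)%N.
Proof.
case: m => // m _; pose f (e : Zc) : 'I_m.+1 := inord (m.+1 * e %/ c).
rewrite -[leqRHS]card_ord /Ann -(@card_in_imset _ _ f); first exact: max_card.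
move=> e e'; rewrite !inE -(natZ_val e) -(natZ_val e') -!natrM !natZ0 !natZ_val.
move=> he he' /(congr1 val) /=.
have lt (z : Zc) : (m.+1 * z %/ c < m.+1)%N.
  by rewrite ltn_divLR // ltn_mul2l ltn_ord.
rewrite !inordK ?lt // => h; apply: val_inj => /=; apply/eqP.
by rewrite -(eqn_pmul2l (ltn0Sn m)) -(divnK he) -(divnK he') h.
Qed.

Lemma Ann_opp x : Ann (- x) = Ann x.
Proof. by rewrite /Ann; congr #|pred_of_set _|; apply/setP => e; rewrite !inE mulNr oppr_eq0. Qed.

Lemma card_dvd_ord (g : nat) : (g %| c)%N -> (\sum_(x : Zc | g %| x) 1 = c %/ g)%N.
Proof.
move=> gc; have g0 : (0 < g)%N by apply: dvdn_gt0 gc.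
rewrite -(big_mkord (fun k : nat => g %| k)%N (fun=> 1%N)).
rewrite -{1}(divnK gc); elim: (c %/ g)%N => [|k IH].
  by rewrite mul0n big_geq.
rewrite mulSn addnC (big_cat_nat _ (n := k * g)) ?leq_addr //= IH.
rewrite -{1}[(k * g)%N]add0n big_addn addKn.
under eq_bigl => i do rewrite dvdn_addl ?dvdn_mull //.
rewrite big_ltn_cond // dvdn0 big_nat_cond big1 ?addn0 ?addn1 // => i.
by move=> /andP[/andP[i0 ig]] /(dvdn_leq i0); rewrite leqNgt ig.
Qed.

(** If x e = 0 modulo c and g = gcd(x, c), then g divides x and c / g divides e. Each divisor g of c
    allows (c / g) g = c such pairs. *)
Lemma sum_Ann : (\sum_x Ann x <= c * size (divisors c))%N.
Proof.
have -> : (\sum_x Ann x = \sum_(x : Zc) \sum_(e : Zc | c %| x * e) 1)%N.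
  apply: eq_bigr => x _; rewrite /Ann -sum1_card; apply: eq_bigl => e.
  by rewrite inE mulZ0.
apply: (@leq_trans (\sum_(x : Zc) \sum_(e : Zc) \sum_(g <- divisors c)
          ((g %| x) * (c %/ g %| e)))%N).
  apply: leq_sum => x _; rewrite [leqLHS]big_mkcond; apply: leq_sum => e _.
  case: ifP => // h; have gc : (gcdn x c \in divisors c) by rewrite -dvdn_divisors // dvdn_gcdr.
  rewrite (big_rem _ gc) /= dvdn_gcdl mul1n.
  suff -> : (c %/ gcdn x c %| e)%N by [].
  have g0 : (0 < gcdn x c)%N by rewrite gcdn_gt0 orbT.
  have cp : coprime (c %/ gcdn x c) (x %/ gcdn x c).
    rewrite /coprime -(eqn_pmul2r g0) mul1n muln_gcdl !divnK ?dvdn_gcdl ?dvdn_gcdr //.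
    by rewrite gcdnC.
  rewrite -(Gauss_dvdr _ cp) -(dvdn_pmul2r g0) mulnAC !divnK ?dvdn_gcdl ?dvdn_gcdr //.
under eq_bigr => x _ do rewrite exchange_big /=.
rewrite exchange_big /= big_seq.
apply: (@leq_trans (\sum_(g <- divisors c | g \in divisors c) c)%N); last first.
  by rewrite -big_seq big_const_seq count_predT iter_addn_0 mulnC.
apply: leq_sum => g; rewrite -dvdn_divisors // => gc.
have g0 : (0 < g)%N by apply: dvdn_gt0 gc.
have -> : (\sum_(x : Zc) \sum_(e : Zc) (g %| x) * (c %/ g %| e)
   = (\sum_(x : Zc) (g %| x)) * (\sum_(e : Zc) (c %/ g %| e)))%N.
  by rewrite big_distrlr.
have E h : (h %| c)%N -> (\sum_(x : Zc) (h %| x) = c %/ h)%N.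
  by move=> /card_dvd_ord <-; rewrite [RHS]big_mkcond; apply: eq_bigr => x _; case: (h %| x)%N.
rewrite !E ?dvdn_div //.
by rewrite mulnC divnK // dvdn_div.
Qed.

(** Every residue modulo c is a divisor of c times a unit, so c <= d(c) phi(c). *)
Lemma card_units_ge : (c <= size (divisors c) * #|[set u : Zc | u \is a GRing.unit]|)%N.
Proof.
rewrite -[leqLHS](card_ord c).
have sub : [set: Zc] \subset [set (((p : 'I_c.+1 * Zc).1 : nat)%:R * p.2 : Zc) |
    p in finset.setX [set g : 'I_c.+1 | (g : nat) \in divisors c] [set u : Zc | u \is a GRing.unit]].
  apply/fintype.subsetP => x _.
  have [x0|x0] := posnP x.
    apply/imsetP; exists (inord c, 1).
      by rewrite !inE /= inordK // divisors_id // unitr1.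
    rewrite [LHS](_ : _ = 0); last by apply: val_inj.
    by rewrite /= inordK // mulr1; apply/esym/eqP; rewrite natZ0.
  set g := gcdn x c; have g0 : (0 < g)%N by rewrite gcdn_gt0 orbT.
  have gx : (g %| x)%N := dvdn_gcdl _ _; have gc : (g %| c)%N := dvdn_gcdr _ _.
  set x' := (x %/ g)%N; set k := (c %/ g)%N.
  have x'0 : (0 < x')%N by rewrite divn_gt0 // dvdn_leq.
  have cp : coprime x' k.
    by rewrite /coprime -(eqn_pmul2r g0) mul1n muln_gcdl !divnK.
  (* [t] is the part of c prime to x'. A prime q dividing c divides exactly one of x' and [k * t]:
     if q divides x', then it divides neither k, which is prime to x', nor t; otherwise it divides
     t. Hence u is a unit, and g u = x modulo c. *)
  pose t := (c`_(\pi(x'))^')%N; pose u := (x' + k * t)%N.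
  have cu : coprime c u.
    rewrite coprime_has_primes // ?addn_gt0 ?x'0 //; apply/hasPn => q.
    rewrite !mem_primes => /and3P[pq _ qu]; apply/negP => /and3P[_ _ qc].
    have [qx'|qx'] := boolP (q %| x')%N.
      have : (q %| k * t)%N by rewrite -(dvdn_addr _ qx').
      rewrite Euclid_dvdM // => /orP[qk|qt].
        have : (q %| 1)%N by rewrite -(eqP cp) dvdn_gcd qx' qk.
        by rewrite dvdn1 => /eqP q1; rewrite q1 in pq.
      have : q \in primes t by rewrite mem_primes pq qt part_gt0.
      by rewrite primes_part mem_filter /= inE /= mem_primes pq x'0 qx'.
    have qt : (q %| t)%N.
      have : q \in primes t.
        by rewrite primes_part mem_filter /= inE /= !mem_primes pq x'0 (negbTE qx') qc.
      by rewrite mem_primes => /and3P[].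
    by move: qu; rewrite dvdn_addl ?(negbTE qx') // dvdn_mull.
  have gle : (g < c.+1)%N by rewrite ltnS dvdn_leq.
  have uu : (u%:R : Zc) \is a GRing.unit by have := unitZpE u (isT : (1 < c)%N); rewrite cu.
  have g'E : (inord g : 'I_c.+1) = g :> nat by rewrite inordK.
  apply/imsetP; exists (inord g, u%:R).
    rewrite finset.in_setX; apply/andP; split; last by rewrite inE.
    by rewrite inE; change (nat_of_ord (inord g : 'I_c.+1) \in divisors c); rewrite g'E -dvdn_divisors.
  change (x = (nat_of_ord (inord g : 'I_c.+1))%:R * u%:R); rewrite g'E -natrM /u mulnDr.
  have -> : (g * x' = x)%N by rewrite mulnC divnK.
  have -> : (g * (k * t) = c * t)%N by rewrite mulnA [(g * k)%N]mulnC divnK.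
  rewrite natrD.
  have -> : ((c * t)%:R : Zc) = 0 by apply/eqP; rewrite natZ0 dvdn_mulr.
  by rewrite addr0 natZ_val.
rewrite -cardsT; apply: leq_trans (subset_leq_card sub) _.
apply: (@leq_trans #|finset.setX [set g : 'I_c.+1 | (g : nat) \in divisors c]
    [set u : Zc | u \is a GRing.unit]|); first exact: leq_imset_card.
rewrite cardsX leq_mul2r; apply/orP; right.
rewrite cardE -(size_map val); apply: uniq_leq_size.
  by rewrite map_inj_uniq ?enum_uniq //; exact: val_inj.
by move=> k /mapP[g]; rewrite mem_enum inE => h ->.
Qed.

Variable l : Zc.

Definition hyperbola : {set (Zc * Zc)%type} := [set p | l * p.2 * p.1 == 1].

Lemma hyperbola_inj (p q : Zc * Zc) : l * p.2 * p.1 == 1 -> l * q.2 * q.1 == 1 ->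
  p.1 = q.1 -> p = q.
Proof.
case: p q => [d a] [d' a']; rewrite /= => /eqP h /eqP h' E; rewrite -E in h' *.
congr (_, _); rewrite -[a]mulr1 -h' -[a' in RHS]mulr1 -h; ring.
Qed.

(* [d1 + d2 = d3 + d4] and [1/d1 + 1/d2 = 1/d3 + 1/d4] force
   [(d1 + d2) (d1 - d3) (d2 - d3) = 0]. *)
Lemma hyperbola_energy (p q r s : Zc * Zc) :
  l * p.2 * p.1 == 1 -> l * q.2 * q.1 == 1 -> l * r.2 * r.1 == 1 -> l * s.2 * s.1 == 1 ->
  p.1 + q.1 = r.1 + s.1 -> p.2 + q.2 = r.2 + s.2 ->
  (p.1 - r.1) * (q.1 - r.1) * ((p.1 - r.1) + (q.1 - r.1) + r.1 *+ 2) = 0.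
Proof.
case: p q r s => [d1 a1] [d2 a2] [d3 a3] [d4 a4]; rewrite /=.
move=> /eqP h1 /eqP h2 /eqP h3 /eqP h4 E F.
have E4 : d4 = d1 + d2 - d3 by rewrite E; ring.
have F4 : a4 = a1 + a2 - a3 by rewrite F; ring.
have G1 : l * (a1 + a2) * (d1 * d2) = d1 + d2.
  transitivity ((l * a1 * d1) * d2 + (l * a2 * d2) * d1); first by ring.
  by rewrite h1 h2; ring.
have G2 : l * (a1 + a2) * (d3 * d4) = d1 + d2.
  rewrite F E.
  transitivity ((l * a3 * d3) * d4 + (l * a4 * d4) * d3); first by ring.
  by rewrite h3 h4; ring.
have U1 : (l * a1) * (l * a2) * (d1 * d2) = 1.
  transitivity ((l * a1 * d1) * (l * a2 * d2)); first by ring.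
  by rewrite h1 h2 mulr1.
have U3 : (l * a3) * (l * a4) * (d3 * d4) = 1.
  transitivity ((l * a3 * d3) * (l * a4 * d4)); first by ring.
  by rewrite h3 h4 mulr1.
have : (d1 + d2) * (d3 * d4 - d1 * d2) = 0.
  rewrite mulrBr -{1}G1 -{1}G2; ring.
by rewrite E4 => h; apply: oppr_inj; rewrite oppr0 -h; ring.
Qed.

(** The additive energy of the hyperbola. Up to the factor c^2 it is the fourth moment of the
    Kloosterman sums. *)
Definition energy : nat := #|[set v : (Zc * Zc) * (Zc * Zc) * ((Zc * Zc) * (Zc * Zc)) |
  [&& v.1.1 \in hyperbola, v.1.2 \in hyperbola, v.2.1 \in hyperbola,
      v.2.2 \in hyperbola, v.1.1.1 + v.1.2.1 == v.2.1.1 + v.2.2.1 &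
      v.1.1.2 + v.1.2.2 == v.2.1.2 + v.2.2.2]]|.

(** A quadruple is fixed by its first coordinates, hence by y = d1 - d3, w = d2 - d3 and d3, which
    satisfy y w (y + w + 2 d3) = 0. For given y and w this is linear in d3, with at most Ann(2 y w)
    <= 2 Ann(y) Ann(w) solutions; [sum_Ann] bounds the total. *)
Lemma energy_le : (energy <= 2 * (c * size (divisors c)) ^ 2)%N.
Proof.
pose f (v : (Zc * Zc) * (Zc * Zc) * ((Zc * Zc) * (Zc * Zc))) : Zc * Zc * Zc :=
  (v.1.1.1 - v.2.1.1, v.1.2.1 - v.2.1.1, v.2.1.1).
rewrite /energy -(@card_in_imset _ _ f); last first.
  move=> [[p q] [r s]] [[p' q'] [r' s']]; rewrite !inE /=.
  move=> /and5P[hp hq hr hs /andP[/eqP E _]] /and5P[hp' hq' hr' hs' /andP[/eqP E' _]].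
  move=> /eqP; rewrite /f !xpair_eqE /= => /andP[/andP[/eqP e1 /eqP e2] /eqP e3].
  rewrite e3 in e1 e2.
  have {}e1 : p.1 = p'.1 by exact: (addIr _ e1).
  have {}e2 : q.1 = q'.1 by exact: (addIr _ e2).
  have e4 : s.1 = s'.1 by apply: (addrI r.1); rewrite -E e3 -E' e1 e2.
  by rewrite (hyperbola_inj hp hp' e1) (hyperbola_inj hq hq' e2)
    (hyperbola_inj hr hr' e3) (hyperbola_inj hs hs' e4).
set A := [set f _ | _ in _].
have sub : A \subset [set t : Zc * Zc * Zc | t.1.1 * t.1.2 * (t.1.1 + t.1.2 + t.2 *+ 2) == 0].
  apply/fintype.subsetP => t /imsetP[[[p q] [r s]]]; rewrite !inE /=.
  move=> /and5P[hp hq hr hs /andP[/eqP E /eqP F]] -> /=.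
  by rewrite (hyperbola_energy hp hq hr hs).
apply: leq_trans (subset_leq_card sub) _.
rewrite -sum1_card.
rewrite (eq_bigl (fun t : Zc * Zc * Zc => true &&
   (t.1.1 * t.1.2 * (t.1.1 + t.1.2 + t.2 *+ 2) == 0))); last by move=> t; rewrite inE.
rewrite -(pair_big_dep predT (fun p d => p.1 * p.2 * (p.1 + p.2 + d *+ 2) == 0)
  (fun _ _ => 1%N)) /=.
apply: (@leq_trans (\sum_(p : Zc * Zc) 2 * (Ann p.1 * Ann p.2))%N).
  apply: leq_sum => -[y w] _ /=.
  have : (#|[set e | ((y * w * 2%:R) * e == - (y * w * (y + w)))%R]| <= 2 * (Ann y * Ann w))%N.
    apply: leq_trans (card_Ann_fiber _ _) _; rewrite mulnC.
    apply: leq_trans (Ann_mul _ _) _; apply: leq_mul; first exact: Ann_mul.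
    exact: Ann_nat.
  apply: leq_trans; rewrite -sum1_card; apply: eq_leq; apply: eq_bigl => d.
  by rewrite inE -[in RHS]subr_eq0 opprK; congr (_ == _); rewrite -mulr_natr; ring.
rewrite -big_distrr /= leq_mul2l /=.
rewrite -(pair_big predT predT (fun y w => Ann y * Ann w)%N) /= -big_distrlr /=.
by rewrite -mulnn leq_mul // sum_Ann.
Qed.

End ResidueRing.

Section KloostermanSum.
Variables (R : realType) (n : nat).
Local Notation c := n.+2.
Local Notation Zc := 'I_n.+2.
Implicit Types x y N k u : Zc.

Definition chi x : R[i] := ee ((x : nat)%:R / c%:R).

Lemma chi_nat (j : nat) : ee (j%:R / c%:R) = chi j%:R.
Proof.
rewrite /chi -[(j%:R : 'I__) : nat]/(val _) val_natZ {1}(divn_eq j c).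
by rewrite natrD natrM mulrDl mulfK // addrC eeD ee_nat mulr1.
Qed.

Lemma chiD x y : chi (x + y) = chi x * chi y.
Proof.
rewrite -{1}(natZ_val x) -{1}(natZ_val y) -natrD -chi_nat natrD mulrDl eeD.
by [].
Qed.

Lemma chi0 : chi 0 = 1. Proof. by rewrite /chi mul0r ee0. Qed.

Lemma chiN x : chi (- x) = (chi x)^-1.
Proof.
apply: (mulIf (ee_neq0 _ : chi x != 0)).
by rewrite -chiD addNr chi0 mulVf // ee_neq0.
Qed.

Lemma chi_int (j : int) : ee (j%:~R / c%:R) = chi j%:~R.
Proof.
by case: j => j; rewrite ?NegzE ?mulrNz -!pmulrn ?mulNr ?eeN ?chiN chi_nat.
Qed.

Lemma chi_conj x : conjc (chi x) = chi (- x).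
Proof. by rewrite chiN /chi ee_conj eeN. Qed.

Lemma sum_chi x : \sum_N chi (N * x) = (if x == 0 then c%:R else 0).
Proof.
rewrite -{2}(natZ_val x) natZ0.
have := @sum_ee_full R c (x : nat) isT; rewrite big_mkord => h.
rewrite (eq_bigr _ (fun N _ => _ : _ = ee ((x : nat)%:~R * (N : nat)%:R / c%:R))) ?h //.
move=> N _; rewrite -{1}(natZ_val N) -{1}(natZ_val x) -natrM -chi_nat natrM -pmulrn.
by rewrite [_ * (x : nat)%:R]mulrC.
Qed.

Variable l : Zc.
Local Notation hyp := (hyperbola l).

(** For [l = 1] this is the classical Kloosterman sum. The twist by [l] is needed for the rows that
    carry the factor sqrt p. *)
Definition Ksum N k : R[i] := \sum_(p in hyp) chi (N * p.1 + k * p.2).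

Lemma conj_sum (I : Type) (r : seq I) (P : pred I) (F : I -> R[i]) :
  conjc (\sum_(i <- r | P i) F i) = \sum_(i <- r | P i) conjc (F i).
Proof. exact: rmorph_sum. Qed.

Lemma nm_sqrC (z : R[i]) : (nm z ^+ 2)%:C = z * conjc z.
Proof. by rewrite nm_sqr; case: z => a b; apply: complex_eq => /=; ring. Qed.

(** The fourth power expands over quadruples of points; orthogonality in N and in k keeps those with
    equal sums in both coordinates. *)
Lemma Ksum_moment :
  \sum_N \sum_k nm (Ksum N k) ^+ 4 = c%:R ^+ 2 * (energy l)%:R.
Proof.
pose P := [set v : (Zc * Zc) * (Zc * Zc) | (v.1 \in hyp) && (v.2 \in hyp)].
have sqE N k : Ksum N k ^+ 2 =
    \sum_(v in P) chi (N * (v.1.1 + v.2.1) + k * (v.1.2 + v.2.2)).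
  rewrite expr2 /Ksum big_distrlr /= pair_big /=; apply: eq_big => [v|v _].
    by rewrite !inE.
  by rewrite -chiD; congr chi; ring.
have E4 N k : (nm (Ksum N k) ^+ 4)%:C = \sum_(v in P) \sum_(w in P)
    chi (N * (v.1.1 + v.2.1 - (w.1.1 + w.2.1))) *
    chi (k * (v.1.2 + v.2.2 - (w.1.2 + w.2.2))).
  rewrite -[4%N]/(2 * 2)%N exprM -nmX nm_sqrC sqE conj_sum big_distrlr.
  apply: eq_bigr => v _; apply: eq_bigr => w _.
  by rewrite chi_conj -[LHS]/(_ * _) -!chiD; congr chi; ring.
apply: (@complexI R); rewrite rmorph_sum /=.
under eq_bigr => N _ do rewrite rmorph_sum /=.
under eq_bigr => N _ do under eq_bigr => k _ do rewrite E4.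
have -> : \sum_N \sum_k \sum_(v in P) \sum_(w in P)
    chi (N * (v.1.1 + v.2.1 - (w.1.1 + w.2.1))) *
    chi (k * (v.1.2 + v.2.2 - (w.1.2 + w.2.2))) =
  \sum_(v in P) \sum_(w in P)
   (\sum_N chi (N * (v.1.1 + v.2.1 - (w.1.1 + w.2.1)))) *
    (\sum_k chi (k * (v.1.2 + v.2.2 - (w.1.2 + w.2.2)))).
  under eq_bigr => N _.
    rewrite exchange_big /=; under eq_bigr => v _ do rewrite exchange_big /=.
    over.
  rewrite exchange_big /=; apply: eq_bigr => v _.
  rewrite exchange_big /=; apply: eq_bigr => w _.
  by rewrite big_distrlr.
under eq_bigr => v _ do under eq_bigr => w _ do rewrite !sum_chi !subr_eq0.
rewrite rmorphM rmorphXn /= !rmorph_nat /energy -sum1_card natr_sum big_distrr /=.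
rewrite pair_big /= big_mkcond [RHS]big_mkcond /=; apply: eq_bigr => -[[p q] [r s]] _ /=.
rewrite !inE /= -!andbA.
do 4 (case: (_ == 1) => //=).
by case: eqP => _; case: eqP => _; rewrite /= ?(mulr0, mul0r, mulr1) ?expr2.
Qed.

(** The substitution (d, a) -> (u d, a / u) preserves the hyperbola. Thus one large value recurs for
    every unit u. *)
Lemma Ksum_unit N k u : u \is a GRing.unit -> Ksum (N * u) (k / u) = Ksum N k.
Proof.
move=> uu; rewrite /Ksum [RHS](reindex (fun p : Zc * Zc => (u * p.1, u^-1 * p.2))) /=.
  apply: eq_big => [p|p _]; last by congr chi; ring.
  by rewrite !inE /=; congr (_ == _); rewrite -[LHS]mul1r -(mulVr uu); ring.
exists (fun p : Zc * Zc => (u^-1 * p.1, u * p.2)) => -[d a] _ /=;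
  by rewrite !mulrA ?mulVr ?mulrV // !mul1r.
Qed.

(** The value at (N, k) recurs at all (N u, k / u), and a given pair (a, b) is hit by at most Ann(k)
    units, because 1 / u solves k e = b. So phi(c) times the fourth power is at most Ann(k) times
    the full moment, and c <= d(c) phi(c) yields the exponent 3/4 of c. *)
Lemma Ksum_bound N k : nm (Ksum N k) ^+ 4 <=
  (2 * Ann k * c ^ 3 * size (divisors c) ^ 3)%N%:R.
Proof.
set D := size (divisors c); set U := [set u : Zc | u \is a GRing.unit].
have h1 : #|U|%:R * nm (Ksum N k) ^+ 4 <= (Ann k)%:R * (c%:R ^+ 2 * (energy l)%:R).
  rewrite -Ksum_moment mulr_natl -sumr_const.
  pose g (p : Zc * Zc) := nm (Ksum p.1 p.2) ^+ 4.
  have -> : \sum_(u in U) nm (Ksum N k) ^+ 4 = \sum_(u in U) g (N * u, k / u).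
    by apply: eq_bigr => u; rewrite inE => uu; rewrite /g /= Ksum_unit.
  rewrite (partition_big (fun u => (N * u, k / u)) predT) //= pair_big /= mulr_sumr.
  apply: ler_sum => -[a b] _ /=.
  rewrite (eq_bigr (fun=> g (a, b))); last by move=> u /andP[_ /eqP ->].
  rewrite sumr_const -[X in X <= _]mulr_natl ler_wpM2r ?exprn_even_ge0 //.
  rewrite ler_nat; apply: leq_trans (card_Ann_fiber k b).
  rewrite -(card_imset _ (@invr_inj Zc)); apply: subset_leq_card.
  apply/fintype.subsetP => e /imsetP[u hu ->]; rewrite inE.
  have /andP[_] : (u \in U) && ((N * u, k / u) == (a, b)) := hu.
  by rewrite xpair_eqE => /andP[].
have h2 : (c <= D * #|U|)%N := card_units_ge n.
have h3 : (energy l <= 2 * (c * D) ^ 2)%N := energy_le l.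
rewrite -(@ler_pM2l _ c%:R) ?ltr0n //.
have X0 : 0 <= nm (Ksum N k) ^+ 4 by rewrite exprn_ge0 ?nm_ge0.
apply: (@le_trans _ _ (D%:R * (#|U|%:R * nm (Ksum N k) ^+ 4))).
  by rewrite mulrA ler_wpM2r // -natrM ler_nat.
apply: (@le_trans _ _ (D%:R * ((Ann k)%:R * (c%:R ^+ 2 * (2 * (c * D) ^ 2)%N%:R)))).
  rewrite ler_wpM2l ?ler0n //; apply: (le_trans h1).
  by rewrite ler_wpM2l ?ler0n // ler_wpM2l ?exprn_ge0 ?ler0n // ler_nat.
by rewrite le_eqVlt; apply/orP; left; apply/eqP; rewrite !(natrM, natrX); ring.
Qed.

End KloostermanSum.

Section kloos.
Variables (R : realType) (lam m c : nat).

(* Zero unless [d] is prime to [c]: it runs over the upper left entries modulo [c]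
   of the group elements with lower row proportional to [(c, d)]. *)
Definition kloos (d : int) : R[i] :=
  \sum_(a < c | (lam%:Z * a%:Z * d == 1 %[mod c])%Z) ee (- (m%:R * a%:R / c%:R)).

Lemma kloosD (d q : int) : kloos (d + q * c%:Z) = kloos d.
Proof.
apply: eq_bigl => a.
have -> : lam%:Z * a%:Z * (d + q * c%:Z) = lam%:Z * a%:Z * d + (lam%:Z * a%:Z * q) * c%:Z by ring.
by rewrite addrC modzMDl.
Qed.

Lemma nm_kloos d : nm (kloos d) <= c%:R.
Proof.
apply: (le_trans (nm_sum _ _ _)).
apply: (@le_trans _ _ (\sum_(a < c) 1)); last by rewrite sumr_const card_ord.
rewrite big_mkcond; apply: ler_sum => a _; case: ifP => // _.
by rewrite nm_ee.
Qed.

Definition kloos_hat (N : int) : R[i] := \sum_(0 <= d < c) kloos d%:Z * ee (N%:~R * d%:R / c%:R).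

Lemma kloos_hat_bound (N : int) : (0 < c)%N -> (0 < m)%N ->
  nm (kloos_hat N) ^+ 4 <= (2 * m * c ^ 3 * size (divisors c) ^ 3)%N%:R.
Proof.
rewrite /kloos_hat /kloos; case: c => // -[_ m0|n _ m0].
  (* Modulus 1 is treated apart, as the ring ['I_n.+2] starts at modulus 2; the sum equals 1. *)
  rewrite big_nat1 big_mkcond big_ord1 !modz1 eqxx !mulr0 !mul0r oppr0 ee0 mulr1.
  by rewrite nm1 expr1n ler1n (_ : divisors 1 = [:: 1%N]) //= !exp1n !muln1 muln_gt0.
have -> : \sum_(0 <= d < n.+2) (\sum_(a < n.+2 | (lam%:Z * a%:Z * d%:Z == 1 %[mod n.+2])%Z)
     ee (- (m%:R * a%:R / n.+2%:R))) * ee (N%:~R * d%:R / n.+2%:R) =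
     Ksum R (lam%:R : 'I_n.+2) N%:~R (- m%:R) :> R[i].
  rewrite big_mkord /Ksum.
  rewrite (eq_bigl (fun p : 'I_n.+2 * 'I_n.+2 => true && (lam%:R * p.2 * p.1 == 1)));
    last by move=> p; rewrite inE.
  rewrite -(pair_big_dep predT (fun d a : 'I_n.+2 => lam%:R * a * d == 1)
     (fun d a => chi R (N%:~R * d + - m%:R * a))) /=.
  apply: eq_bigr => d _; rewrite mulr_suml; apply: eq_big => [a|a _].
    rewrite -(natZ_val a) -(natZ_val d) -!natrM -[1]/(1%:R) eqZ_nat !natZ_val.
    by rewrite -!PoszM !modz_nat eqz_nat.
  rewrite -eeD -{2}(natZ_val a) -{2}(natZ_val d).
  have -> : N%:~R * d%:R + - m%:R * a%:R = (N * d%:Z - m%:Z * a%:Z)%:~R :> 'I_n.+2.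
    by rewrite intrB !intrM -!pmulrn mulNr.
  by rewrite -chi_int intrB !intrM -!pmulrn; congr ee; field.
apply: (le_trans (Ksum_bound _ _ _ _)); rewrite ler_nat Ann_opp.
by rewrite !leq_mul // Ann_nat.
Qed.

End kloos.
Local Open Scope classical_set_scope.

(** * Incomplete Kloosterman sums by completion *)

Section Completion.
Variable R : realType.

(** Jordan's inequality with a crude constant: beyond 1/2 one has sin x >= sin(1/2) >= 3/8, while x
    < 2. *)
Lemma sin_ge_lin (x : R) : 0 <= x <= pi / 2 -> 3 / 16 * x <= sin x.
Proof.
have small (y : R) : 0 <= y <= 1 / 2 -> 3 / 4 * y <= sin y.
  move=> /andP[y0 y1]; have [t] := @MVT_segment R sin cos 0 y y0
    (fun c _ => is_derive_sin c) (continuous_subspaceT (@continuous_sin R)).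
  rewrite in_itv /= => /andP[t0 ty]; rewrite sin0 !subr0 => ->.
  rewrite ler_wpM2r //; have := abs_cosB1_le t; rewrite ler_norml => /andP[h _].
  nra.
move=> /andP[x0 x1]; have [h|h] := leP x (1 / 2).
  by have := small x; rewrite x0 h => /(_ isT); lra.
have p2 := @pihalf_lt2 R; have p1 := @pihalf_ge1 R.
have : sin (1 / 2) <= sin x.
  by rewrite ltW // ltr_sin ?in_itv /=; apply/andP || idtac; lra.
have := small (1 / 2); rewrite lexx andbT => /(_ ltac:(lra)); lra.
Qed.

Lemma nm_1Bee (t : R) : 0 <= t <= 1 -> nm (1 - ee t) = 2 * sin (pi * t).
Proof.
move=> /andP[t0 t1]; have s0 : 0 <= sin (pi * t).
  by apply: sin_ge0_pi; rewrite mulr_ge0 ?pi_ge0 //= ler_piMr ?pi_ge0.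
apply/eqP; rewrite -(@eqrXn2 _ 2) ?nm_ge0 ?mulr_ge0 //; apply/eqP.
rewrite nm_sqr eeE /=.
have -> : 2 * pi * t = (pi * t) *+ 2 by rewrite -mulr_natl; ring.
rewrite cos_mulr2n sin_mulr2n.
have := cos2Dsin2 (pi * t); set C := cos _; set S := sin _ => h.
have -> : C ^+ 2 = 1 - S ^+ 2 by lra.
have -> : (0 - (C * S) *+ 2) ^+ 2 = 4 * C ^+ 2 * S ^+ 2 by ring.
have -> : C ^+ 2 = 1 - S ^+ 2 by lra.
by ring.
Qed.

(** The true size is the inverse distance of t to the nearest integer. The sum of both reciprocals
    is easier to add up over t = N / c. *)
Lemma nm_1Bee_ge (t : R) : 0 < t < 1 -> (nm (1 - ee t))^-1 <= 2 * (t^-1 + (1 - t)^-1).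
Proof.
move=> /andP[t0 t1]; have t1' : 0 < 1 - t by lra.
have pg := @pi_ge2 R; have it0 : 0 < t^-1 by rewrite invr_gt0.
have it1 : 0 < (1 - t)^-1 by rewrite invr_gt0.
rewrite nm_1Bee ?(ltW t0) ?(ltW t1) //.
have [h|h] := leP t (1 / 2).
  have s : t / 2 <= 2 * sin (pi * t).
    have := @sin_ge_lin (pi * t); rewrite mulr_ge0 ?(ltW t0) ?pi_ge0 //=.
    have -> : pi * t <= pi / 2 by rewrite ler_wpM2l ?pi_ge0 //; lra.
    by move=> /(_ isT) hs; nra.
  apply: (@le_trans _ _ (t / 2)^-1); last by rewrite invfM invrK; lra.
  by rewrite lef_pV2 ?posrE //; lra.
have s : (1 - t) / 2 <= 2 * sin (pi * t).
  have -> : sin (pi * t) = sin (pi * (1 - t)).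
    by rewrite mulrBr mulr1 -[RHS]opprK -sinN opprB sinB sinpi cospi; ring.
  have := @sin_ge_lin (pi * (1 - t)); rewrite mulr_ge0 ?(ltW t1') ?pi_ge0 //=.
  have -> : pi * (1 - t) <= pi / 2 by rewrite ler_wpM2l ?pi_ge0 //; lra.
  by move=> /(_ isT) hs; nra.
apply: (@le_trans _ _ ((1 - t) / 2)^-1); last by rewrite invfM invrK; lra.
by rewrite lef_pV2 ?posrE //; lra.
Qed.

Definition harmo (c : nat) : R := \sum_(1 <= N < c) N%:R^-1.

Lemma geo_ee_le (w : R[i]) (L : nat) : nm w = 1 -> w != 1 ->
  nm (\sum_(0 <= k < L) w ^+ k) <= 2 / nm (1 - w).
Proof.
move=> w1 wn1; have h : 0 < nm (1 - w) by rewrite nm_gt0 // subr_eq0 eq_sym.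
rewrite ler_pdivlMr // -nmM big_mkord.
have -> : (\sum_(i < L) w ^+ i) * (1 - w) = 1 - w ^+ L.
  by rewrite -[RHS]opprB subrX1; ring.
by rewrite (le_trans (nmB _ _)) // nm1 nmX w1 expr1n.
Qed.

Variables (lam m c : nat).
Hypotheses (c0 : (0 < c)%N) (m0 : (0 < m)%N).
Local Notation K := (kloos R lam m c).
Let cR0 : (c%:R : R) != 0. Proof. by rewrite pnatr_eq0 -lt0n. Qed.

Lemma kloos_inversion (d : int) :
  c%:R * K d = \sum_(0 <= N < c) kloos_hat R lam m c N%:Z * ee (- (N%:R * d%:~R / c%:R)).
Proof.
rewrite /kloos_hat; under eq_bigr => N _ do rewrite mulr_suml.
rewrite exchange_big /=.
pose d' : nat := `|(d %% c)%Z|%N.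
have cz : (c%:Z != 0) by case: (c) c0.
have d'E : d'%:Z = (d %% c)%Z by rewrite /d' gez0_abs // modz_ge0.
have d'c : (d' < c)%N by rewrite -ltz_nat d'E ltz_mod.
have E e : \sum_(0 <= N < c) K e%:Z * ee (N%:Z%:~R * e%:R / c%:R) * ee (- (N%:R * d%:~R / c%:R))
   = K e%:Z * (if (c%:Z %| e%:Z - d)%Z then c%:R else 0).
  rewrite -(sum_ee_full R _ c0) mulr_sumr; apply: eq_bigr => N _.
  by rewrite -mulrA -eeD; congr (_ * ee _); rewrite intrB -!pmulrn; field.
under eq_bigr => e _ do rewrite E.
have KE : K d = K d'%:Z.
  by rewrite (divz_eq d c) addrC kloosD d'E.
rewrite KE big_mkord (bigD1 (Ordinal d'c)) //= big1 ?addr0.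
  rewrite d'E -eqz_mod_dvd modz_mod eqxx mulrC; congr (_ * _).
move=> [e ec] /= ne; case: ifP; rewrite ?mulr0 // -eqz_mod_dvd => /eqP h.
case/eqP: ne; apply: val_inj => /=; apply/eqP; rewrite -eqz_nat d'E -h.
by rewrite modz_nat modn_small.
Qed.

(** Fourier inversion modulo c expresses the sum over an interval by complete sums, weighted with
    geometric sums over the interval. These are at most c at frequency 0 and at most 4 c (1/N + 1/(c
    - N)) at frequency N, and both reciprocals add up to [harmo c]. *)
Lemma kloos_interval (s : R) (A : int) (L : nat) : (L <= c)%N ->
  (forall N, nm (kloos_hat R lam m c N) <= s) ->
  nm (\sum_(0 <= k < L) K (A + k%:Z)) <= s * (1 + 8 * harmo c).
Proof.
move=> Lc hs; have s0 : 0 <= s := le_trans (nm_ge0 _) (hs 0).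
have cgt : (0 : R) < c%:R by rewrite ltr0n.
pose G N : R[i] := \sum_(0 <= k < L) ee (- (N%:R * (A + k%:Z)%:~R / c%:R)).
have E : c%:R * \sum_(0 <= k < L) K (A + k%:Z) = \sum_(0 <= N < c) kloos_hat R lam m c N%:Z * G N.
  rewrite mulr_sumr; under eq_bigr => k _ do rewrite kloos_inversion.
  by rewrite exchange_big /=; apply: eq_bigr => N _; rewrite mulr_sumr.
have G0 : nm (G 0%N) <= c%:R.
  apply: (le_trans (nm_sum _ _ _)); under eq_bigr do rewrite nm_ee.
  by rewrite big_const_nat iter_addr_0 subn0 ler_nat.
have GN N : (0 < N < c)%N -> nm (G N) <= 4 * c%:R * (N%:R^-1 + (c - N)%:R^-1).
  move=> /andP[N0 Nc].
  have N0R : (0 : R) < N%:R by rewrite ltr0n.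
  have NcR : (N%:R : R) < c%:R by rewrite ltr_nat.
  have t01 : 0 < (N%:R / c%:R : R) < 1.
    by rewrite divr_gt0 //= ltr_pdivrMr // mul1r.
  pose w := ee (- (N%:R / c%:R : R)).
  have GE : G N = ee (- (N%:R * A%:~R / c%:R)) * \sum_(0 <= k < L) w ^+ k.
    rewrite mulr_sumr; apply: eq_bigr => k _; rewrite -eeMn -eeD; congr ee.
    by rewrite intrD -pmulrn; field.
  have wn1 : w != 1.
    by rewrite /w eeN invr_eq1 ee_neq1.
  have wE : nm (1 - w) = nm (1 - ee (N%:R / c%:R)).
    have cB (z : R[i]) : conjc (1 - z) = 1 - conjc z.
      by case: z => x y; apply: complex_eq => /=; ring.
    by rewrite -[RHS]nm_conj cB ee_conj.
  rewrite GE nmM nm_ee mul1r (le_trans (geo_ee_le _ _ wn1)) ?nm_ee //.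
  rewrite wE; apply: (@le_trans _ _ (2 * (2 * ((N%:R / c%:R)^-1 + (1 - N%:R / c%:R)^-1)))).
    by rewrite ler_wpM2l // nm_1Bee_ge.
  rewrite le_eqVlt; apply/orP; left; apply/eqP.
  rewrite natrB ?(ltnW Nc) //; field.
  by rewrite cR0 /= !gt_eqF // ?subr_gt0.
rewrite -(ler_pM2l cgt) -{1}(nm_nat R c) -nmM E.
apply: (le_trans (nm_sum _ _ _)); rewrite big_ltn //.
have -> : c%:R * (s * (1 + 8 * harmo c)) = s * c%:R + s * (8 * c%:R * harmo c) by ring.
apply: lerD; first by rewrite nmM ler_pM ?nm_ge0.
apply: (@le_trans _ _ (\sum_(1 <= N < c) s * (4 * c%:R * (N%:R^-1 + (c - N)%:R^-1)))).
  rewrite big_nat [leRHS]big_nat; apply: ler_sum => N hN.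
  by rewrite nmM ler_pM ?nm_ge0 // GN.
rewrite -!mulr_sumr big_split /=.
have -> : \sum_(1 <= N < c) (c - N)%:R^-1 = harmo c :> R.
  rewrite big_nat_rev /= /harmo big_nat [RHS]big_nat; apply: eq_bigr => N /andP[N1 Nc].
  by congr (_%:R^-1); lia.
by rewrite -/(harmo c) le_eqVlt; apply/orP; left; apply/eqP; ring.
Qed.

End Completion.

(** * The powers n^(1/8) and n^(-9/8) *)

Section Root8.
Variable R : realType.

Definition root8 (n : nat) : R := Num.sqrt (Num.sqrt (Num.sqrt n%:R)).

Lemma root8_ge0 n : 0 <= root8 n. Proof. exact: sqrtr_ge0. Qed.
Lemma root8X n : root8 n ^+ 8 = n%:R.
Proof.
rewrite -[8%N]/(2 * (2 * 2))%N exprM sqr_sqrtr ?sqrtr_ge0 //.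
by rewrite exprM sqr_sqrtr ?sqrtr_ge0 // sqr_sqrtr.
Qed.
Lemma root8_1 : root8 1 = 1. Proof. by rewrite /root8 !sqrtr1. Qed.
Lemma root8_le m n : (m <= n)%N -> root8 m <= root8 n.
Proof. by move=> h; rewrite /root8 !ler_wsqrtr // ler_nat. Qed.
Lemma root8_ge1 n : (0 < n)%N -> 1 <= root8 n.
Proof. by move=> n0; rewrite -root8_1 root8_le. Qed.
Lemma root8M m n : root8 (m * n) = root8 m * root8 n.
Proof. by rewrite /root8 natrM !sqrtrM ?sqrtr_ge0. Qed.

(** Mean value inequality for x^8 between consecutive eighth roots. It makes the two sums below
    telescope. *)
Lemma root8_step n : 1 <= 8 * root8 n.+1 ^+ 7 * (root8 n.+1 - root8 n).
Proof.
have := root8X n.+1; have := root8X n; rewrite -(@natr1 R n).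
have := root8_le (leqnSn n); have := root8_ge0 n.
set a := root8 n.+1; set b := root8 n => b0 ba <- e.
apply: (@le_trans _ _ (a ^+ 8 - b ^+ 8)); first by rewrite e; lra.
rewrite subrXX [leRHS]mulrC ler_wpM2l ?subr_ge0 //.
have -> : 8 * a ^+ 7 = \sum_(i < 8) a ^+ 7 by rewrite sumr_const card_ord mulr_natl.
apply: ler_sum => -[i i8] _ /=; have a0 : 0 <= a by lra.
have -> : a ^+ 7 = a ^+ (7 - i) * a ^+ i by rewrite -exprD; congr (_ ^+ _); lia.
by rewrite ler_wpM2l ?exprn_ge0 // lerXn2r // nnegrE.
Qed.

(** Stands in for the logarithmic bound: the loss c^(1/8) turns c^(3/4) into c^(7/8), which is still
    below c. *)
Lemma harmo_le c : harmo R c <= 8 * root8 c.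
Proof.
have H k : harmo R k.+1 <= 8 * root8 k.
  elim: k => [|k IH]; first by rewrite /harmo big_geq // mulr_ge0 ?root8_ge0.
  rewrite /harmo big_nat_recr //= -/(harmo R k.+1).
  have h1 := root8_step k; have h2 := root8_ge1 (ltn0Sn k).
  have e := root8X k.+1; move: IH h1 h2 e.
  set a := root8 k.+1; set b := root8 k => IH h1 h2 e.
  have ab : b <= a by exact: root8_le.
  have e0 : (0 : R) < k.+1%:R by rewrite ltr0n.
  suff hh : k.+1%:R^-1 <= 8 * (a - b) by apply: (le_trans (lerD IH hh)); lra.
  rewrite -(ler_pM2l e0) divff ?gt_eqF // -e; apply: (le_trans h1).
  have -> : a ^+ 8 * (8 * (a - b)) = (8 * a ^+ 7 * (a - b)) * a by ring.
  by rewrite ler_peMr //; lra.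
case: c => [|c]; first by rewrite /harmo big_geq // mulr_ge0 ?root8_ge0.
by rewrite (le_trans (H c)) // ler_wpM2l // root8_le.
Qed.

Definition g9 (n : nat) : R := root8 n ^- 9.

Lemma g9_ge0 n : 0 <= g9 n. Proof. by rewrite invr_ge0 exprn_ge0 ?root8_ge0. Qed.
Lemma g9M m n : g9 (m * n) = g9 m * g9 n.
Proof. by rewrite /g9 root8M exprMn invfM. Qed.

(** Telescopes against 8 n^(-1/8): for consecutive eighth roots b < a, [root8_step] gives a^-9 <= 8
    (1/b - 1/a). *)
Lemma sum_g9 X : \sum_(1 <= c < X) g9 c <= 9.
Proof.
have H k : \sum_(1 <= c < k.+2) g9 c <= 9 - 8 * (root8 k.+1)^-1.
  elim: k => [|k IH].
    by rewrite big_nat1 /g9 root8_1 expr1n invr1; lra.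
  rewrite big_nat_recr //=; move: IH.
  have h1 := root8_step k.+1; have h2 := root8_ge1 (ltn0Sn k).
  have ab := root8_le (leqnSn k.+1); rewrite /g9; move: h1 h2 ab.
  set a := root8 k.+2; set b := root8 k.+1; set s := \sum_(_ <= _ < _) _ => h1 h2 ab IH.
  suff : a ^- 9 <= 8 * (b^-1 - a^-1) by lra.
  have a0 : 0 < a by lra.
  have b0 : 0 < b by lra.
  have -> : b^-1 - a^-1 = (a - b) / (a * b) by field; rewrite !gt_eqF.
  rewrite mulrA ler_pdivlMr ?mulr_gt0 //.
  have -> : a ^- 9 * (a * b) = a ^- 8 * b by field; rewrite gt_eqF.
  rewrite mulrC ler_pdivrMr ?exprn_gt0 //.
  have -> : 8 * (a - b) * a ^+ 8 = (8 * a ^+ 7 * (a - b)) * a by ring.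
  by apply: (le_trans ab); rewrite ler_peMl // ltW.
case: X => [|[|X]]; try by rewrite big_geq.
by rewrite (le_trans (H X)) // gerBl mulr_ge0 ?invr_ge0 ?root8_ge0.
Qed.

End Root8.

Section DirichletExchange.
Variable V : nmodType.

(** Sorts the products N = c n by c. It serves for the divisor majorant and again for the Ramanujan
    sums. *)
Lemma sum_divisors_exchange (F : nat -> nat -> V) (X : nat) :
  \sum_(1 <= N < X) \sum_(c <- divisors N) F c (N %/ c)%N =
  \sum_(1 <= c < X) \sum_(1 <= n < X | (c * n < X)%N) F c n.
Proof.
transitivity (\sum_(1 <= N < X) \sum_(1 <= c < X) \sum_(1 <= n < X | (c * n)%N == N) F c n).
  rewrite big_nat [RHS]big_nat; apply: eq_bigr => N /andP[N1 NX].
  rewrite [RHS](bigID (fun c => (c %| N)%N)) /= [X in _ + X]big1_seq ?addr0; last first.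
    move=> c /andP[cN]; rewrite mem_index_iota => /andP[c1 cX].
    rewrite big1 // => n /eqP E; case/negP: cN; rewrite -E dvdn_mulr //.
  rewrite -[RHS]big_filter.
  have pm : perm_eq (divisors N) [seq c <- index_iota 1 X | (c %| N)%N].
    apply: uniq_perm; rewrite ?divisors_uniq ?filter_uniq ?iota_uniq // => c.
    rewrite -dvdn_divisors // mem_filter mem_index_iota.
    case: (boolP (c %| N)%N) => //= cN; rewrite (dvdn_gt0 N1 cN) /=.
    by rewrite (leq_ltn_trans (dvdn_leq N1 cN) NX).
  rewrite (perm_big _ pm) /= big_filter [RHS]big_filter.
  rewrite big_seq_cond [RHS]big_seq_cond; apply: eq_bigr => c.
  rewrite mem_index_iota => /andP[/andP[c1 cX] cN].
  rewrite -[RHS]big_filter (_ : [seq _ <- _ | _] = [:: (N %/ c)%N]) ?big_seq1 //.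
  apply: perm_small_eq => //; apply: uniq_perm; rewrite ?filter_uniq ?iota_uniq // => n.
  rewrite mem_filter mem_index_iota inE; apply/idP/eqP.
    by move=> /andP[/eqP <- _]; rewrite mulKn.
  move=> ->; rewrite mulnC divnK // eqxx /= divn_gt0 // dvdn_leq //=.
  by rewrite (leq_ltn_trans (leq_div _ _)).
rewrite exchange_big /=; rewrite big_nat [RHS]big_nat; apply: eq_bigr => c /andP[c1 cX].
under eq_bigr => N _ do rewrite big_mkcond.
rewrite exchange_big /= [RHS]big_mkcond big_nat [RHS]big_nat; apply: eq_bigr => n /andP[n1 nX].
case: ifP => h.
  rewrite -big_mkcond /= -[LHS]big_filter (_ : [seq _ <- _ | _] = [:: (c * n)%N]) ?big_seq1 //.
  apply: perm_small_eq => //; apply: uniq_perm; rewrite ?filter_uniq ?iota_uniq // => N.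
  rewrite mem_filter mem_index_iota inE.
  change (((c * n)%N == N) && (0 < N < X)%N = (N == (c * n)%N)); rewrite eq_sym.
  by case: eqP => [->|//] /=; rewrite h muln_gt0 c1 n1.
rewrite big_nat big1 // => N /andP[_ NX]; case: eqP => // E.
by rewrite -E h in NX.
Qed.

End DirichletExchange.

(** As n^(-9/8) is completely multiplicative, d(N) N^(-9/8) is its Dirichlet square, so 81 is the
    square of the bound 9. *)
Lemma sum_divisors_g9 (R : realType) X :
  \sum_(1 <= c < X) (size (divisors c))%:R * g9 R c <= 81.
Proof.
have -> : \sum_(1 <= c < X) (size (divisors c))%:R * g9 R c =
    \sum_(1 <= N < X) \sum_(c <- divisors N) g9 R c * g9 R (N %/ c)%N.
  rewrite big_nat [RHS]big_nat; apply: eq_bigr => N /andP[N1 _].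
  rewrite big_seq (eq_bigr (fun=> g9 R N)); last first.
    by move=> c; rewrite -dvdn_divisors // => cN; rewrite -g9M mulnC divnK.
  by rewrite -big_seq big_const_seq count_predT iter_addr_0 mulr_natl.
rewrite (sum_divisors_exchange (fun c n => g9 R c * g9 R n)).
apply: (@le_trans _ _ (\sum_(1 <= c < X) \sum_(1 <= n < X) g9 R c * g9 R n)).
  apply: ler_sum => c _; rewrite big_mkcond; apply: ler_sum => n _.
  by case: ifP => // _; rewrite mulr_ge0 ?g9_ge0.
rewrite -big_distrlr /= (_ : 81 = 9 * 9 :> R); last by ring.
by rewrite ler_pM ?sum_g9 ?sumr_ge0 // => *; exact: g9_ge0.
Qed.

(** * Rows of the Poincare series *)

Ltac nneg := repeat first [ exact: pi_ge0 | exact: ler01 | exact: ler0n | exact: expR_ge0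
  | exact: nm_ge0 | exact: normr_ge0 | exact: g9_ge0 | exact: root8_ge0 | exact: sqr_ge0 | assumption | by apply: ltW
  | rewrite invr_ge0 | apply: mulr_ge0 | apply: addr_ge0 | apply: exprn_ge0 ].

Section UnimodalSums.
Variable R : realType.
Implicit Types (Y t s : R).

Lemma abel_bound (a : nat -> R[i]) (h : nat -> R) (B : R) (L : nat) :
  (forall j, (j <= L)%N -> nm (\sum_(0 <= k < j) a k) <= B) ->
  nm (\sum_(0 <= k < L) a k * (h k)%:C) <=
    B * (\sum_(0 <= k < L.-1) `|h k.+1 - h k| + `|h L.-1|).
Proof.
move=> hB; have B0 : 0 <= B.
  by have := hB 0%N isT; rewrite big_geq // nm0.
case: L hB => [|L] hB; first by rewrite big_geq // nm0 mulr_ge0 // addr_ge0 // sumr_ge0.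
have E : \sum_(0 <= k < L.+1) a k * (h k)%:C =
    (\sum_(0 <= k < L.+1) a k) * (h L)%:C
    - \sum_(0 <= k < L) (\sum_(0 <= i < k.+1) a i) * (h k.+1 - h k)%:C.
  elim: {hB} L => [|L IH]; first by rewrite !big_nat1 big_geq // subr0.
  rewrite big_nat_recr //= IH [\sum_(0 <= k < L.+2) _]big_nat_recr //=.
  by rewrite [\sum_(0 <= k < L.+1) _ * _]big_nat_recr //= rmorphB /=; ring.
rewrite E (le_trans (nmB _ _)) // addrC mulrDr lerD //=.
  apply: (le_trans (nm_sum _ _ _)); rewrite mulr_sumr big_nat [leRHS]big_nat.
  apply: ler_sum => k /andP[_ kL]; rewrite nmM nm_real ler_wpM2r //.
  by apply: hB; exact: ltnW.
by rewrite nmM nm_real ler_wpM2r // hB.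
Qed.

(** Equal to Im(-1 / (t + i Y)), that is, pi times the Poisson kernel. It is the shape of the linear
    part of a row term. *)
Definition bump8 Y t : R := Y / (t ^+ 2 + Y ^+ 2).
Local Notation u := bump8.
(* The variation of [bump8 Y] on the interval from [-oo] to [t]. *)
Definition bvar Y t : R := if t <= 0 then u Y t else 2 / Y - u Y t.

Lemma bump_ge0 Y t : 0 < Y -> 0 <= u Y t.
Proof. by move=> Y0; rewrite divr_ge0 ?(ltW Y0) // addr_ge0 ?sqr_ge0. Qed.

Lemma bump_le Y t : 0 < Y -> u Y t <= Y^-1.
Proof.
move=> Y0; rewrite ler_pdivrMr ?ltr_wpDl ?sqr_ge0 ?exprn_gt0 //.
by rewrite mulrDr expr2 mulKf ?gt_eqF // lerDr mulr_ge0 ?sqr_ge0 ?invr_ge0 ?ltW.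
Qed.

Lemma bump_anti Y t s : 0 < Y -> t ^+ 2 <= s ^+ 2 -> u Y s <= u Y t.
Proof.
move=> Y0 h; rewrite ler_wpM2l ?(ltW Y0) // lef_pV2 ?posrE ?lerD2r //.
all: by rewrite ltr_wpDl ?sqr_ge0 ?exprn_gt0.
Qed.

Lemma bvar_mono Y t s : 0 < Y -> t <= s -> `|u Y s - u Y t| <= bvar Y s - bvar Y t.
Proof.
move=> Y0 ts; rewrite /bvar.
have us := bump_le s Y0; have ut := bump_le t Y0.
have [s0|s0] := leP s 0; have [t0|t0] := leP t 0; try lra.
- by rewrite ger0_norm // subr_ge0 bump_anti //; nra.
- by rewrite ler_norml; apply/andP; split; lra.
- rewrite ler0_norm; first lra.
  by rewrite subr_le0 bump_anti //; nra.
Qed.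

Lemma bvar_bounds Y t : 0 < Y -> 0 <= bvar Y t <= 2 / Y.
Proof.
move=> Y0; rewrite /bvar; have := bump_le t Y0; have := bump_ge0 t Y0.
have : 0 < Y^-1 by rewrite invr_gt0.
by case: ifP => _ h1 h2 h3; apply/andP; split; lra.
Qed.

Lemma bump_variation Y t L : 0 < Y ->
  \sum_(0 <= k < L) `|u Y (t + k.+1%:R) - u Y (t + k%:R)| <= 2 / Y.
Proof.
move=> Y0; apply: (@le_trans _ _ (\sum_(0 <= k < L) (bvar Y (t + k.+1%:R) - bvar Y (t + k%:R)))).
  by apply: ler_sum => k _; rewrite bvar_mono // lerD2l ler_nat.
rewrite telescope_sumr // addr0.
by have := bvar_bounds (t + L%:R) Y0; have := bvar_bounds t Y0; lra.
Qed.

(** In the factor 3 / Y, two parts come from the total variation of the kernel and one from its last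
    value. *)
Lemma abel_bump (a : nat -> R[i]) Y t B (L : nat) : 0 < Y ->
  (forall j, (j <= L)%N -> nm (\sum_(0 <= k < j) a k) <= B) ->
  nm (\sum_(0 <= k < L) a k * (u Y (t + k%:R))%:C) <= 3 * B / Y.
Proof.
move=> Y0 hB; have B0 : 0 <= B by have := hB 0%N isT; rewrite big_geq // nm0.
apply: (le_trans (abel_bound (fun k => u Y (t + k%:R)) hB)).
have h1 := bump_variation t L.-1 Y0.
have h2 := bump_le (t + L.-1%:R) Y0; have h3 := bump_ge0 (t + L.-1%:R) Y0.
rewrite (ger0_norm h3) -mulrA mulrCA ler_wpM2l //; lra.
Qed.

(** The increment of the arctangent is the kernel at an intermediate point, and this differs from
    its value at t by at most the variation over the step. Summed up, it compares the sum of the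
    kernel with its integral. *)
Lemma atan_step Y t : 0 < Y ->
  `|u Y t - (atan ((t + 1) / Y) - atan (t / Y))| <= bvar Y (t + 1) - bvar Y t.
Proof.
move=> Y0; have t1 : t / Y <= (t + 1) / Y by rewrite ler_pM2r ?invr_gt0 //; lra.
have [x] := @MVT_segment R (@atan R) (fun x => (1 + x ^+ 2)^-1) _ _ t1
    (fun c _ => is_derive1_atan c) (continuous_subspaceT (@continuous_atan R)).
rewrite in_itv /= => /andP[x1 x2] ->.
have -> : (t + 1) / Y - t / Y = Y^-1 by field; rewrite gt_eqF.
have -> : (1 + x ^+ 2)^-1 / Y = u Y (x * Y).
  have -> : u Y (x * Y) = Y / (Y * (Y * (1 + x ^+ 2))).
    by rewrite /bump8; congr (_ / _); ring.
  by rewrite invfM mulrA divff ?gt_eqF // mul1r invfM mulrC.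
have xt : t <= x * Y by rewrite -ler_pdivrMr.
have xt1 : x * Y <= t + 1 by rewrite -ler_pdivlMr.
rewrite distrC (le_trans (bvar_mono Y0 xt)) // lerD2r.
by have := le_trans (normr_ge0 _) (bvar_mono Y0 xt1); lra.
Qed.

Lemma sum_bump Y t L : 0 < Y ->
  `|\sum_(0 <= k < L) u Y (t + k%:R) - (atan ((t + L%:R) / Y) - atan (t / Y))| <= 2 / Y.
Proof.
move=> Y0.
have -> : atan ((t + L%:R) / Y) - atan (t / Y) =
   \sum_(0 <= k < L) (atan ((t + k.+1%:R) / Y) - atan ((t + k%:R) / Y)).
  by rewrite (telescope_sumr (fun k => atan ((t + k%:R) / Y))) // addr0.
rewrite -sumrB; apply: (le_trans (ler_norm_sum _ _ _)).
apply: (@le_trans _ _ (\sum_(0 <= k < L) (bvar Y (t + k.+1%:R) - bvar Y (t + k%:R)))).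
  apply: ler_sum => k _; have := atan_step (t + k%:R) Y0.
  by rewrite -addrA natr1.
rewrite (telescope_sumr (fun k => bvar Y (t + k%:R))) // addr0.
by have := bvar_bounds (t + L%:R) Y0; have := bvar_bounds t Y0; lra.
Qed.

Lemma pi_le4 : (pi : R) <= 4.
Proof. by have := @pihalf_lt2 R; lra. Qed.

Lemma sum_bump_le Y t L : 0 < Y -> \sum_(0 <= k < L) u Y (t + k%:R) <= 4 + 2 / Y.
Proof.
move=> Y0; have := sum_bump t L Y0; rewrite ler_norml => /andP[_].
have := @atan_ltpi2 R ((t + L%:R) / Y); have := @atan_gtNpi2 R (t / Y).
have := pi_le4; lra.
Qed.

End UnimodalSums.

Section InnerSum.
Variables (R : realType) (lam m c : nat).
Hypotheses (c0 : (0 < c)%N) (m0 : (0 < m)%N) (lam0 : (0 < lam)%N).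
Implicit Types (z w : R[i]).
Local Notation K := (kloos R lam m c).

Let cR : 0 < c%:R :> R. Proof. by rewrite ltr0n. Qed.
Let cR1 : 1 <= c%:R :> R. Proof. by rewrite ler1n. Qed.
Let lR : 0 < lam%:R :> R. Proof. by rewrite ltr0n. Qed.
Let lR1 : 1 <= lam%:R :> R. Proof. by rewrite ler1n. Qed.
Let mR : 0 < m%:R :> R. Proof. by rewrite ltr0n. Qed.
Let mR1 : 1 <= m%:R :> R. Proof. by rewrite ler1n. Qed.

(* [Bc] bounds incomplete Kloosterman sums modulo [c]; [Dc = d(c) c^(-9/8)] is the
   summable majorant of the resulting terms [Bc / c^2]. *)
Definition Bc : R := 130 * m%:R * (size (divisors c))%:R * root8 R c ^+ 7.
Definition Dc : R := (size (divisors c))%:R * g9 R c.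

Let d1 : 1 <= (size (divisors c))%:R :> R.
Proof. by rewrite ler1n; have := divisors_id c0; case: (divisors c). Qed.

(** Put r = c^(1/8). The fourth root of the moment bound is at most 2 m d(c) r^6, and completion
    costs 1 + 64 r <= 65 r. *)
Lemma kloos_interval_Bc (A : int) (L : nat) : (L <= c)%N ->
  nm (\sum_(0 <= k < L) K (A + k%:Z)) <= Bc.
Proof.
move=> Lc; set d : R := (size (divisors c))%:R; pose r := root8 R c.
have r1 : 1 <= r by exact: root8_ge1.
have hs N : nm (kloos_hat R lam m c N) <= 2 * m%:R * r ^+ 6 * d.
  rewrite -(@ler_pXn2r _ 4) ?nnegrE ?nm_ge0 //; last first.
    have r0 : 0 <= r by lra.
    by rewrite /d; nneg.
  apply: (le_trans (kloos_hat_bound _ _ _ c0 m0)).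
  rewrite !(natrM, natrX) -[in leLHS](root8X R c) -/r -/d.
  have -> : (2 * m%:R * r ^+ 6 * d) ^+ 4 =
     (2 * m%:R * (r ^+ 8) ^+ 3 * d ^+ 3) * (2 * m%:R * (2 * m%:R) * (2 * m%:R) * d) by ring.
  rewrite ler_peMr ?mulr_ge0 ?exprn_ge0 ?ler0n //; try lra.
  have h : 1 <= 2 * m%:R :> R by rewrite -natrM ler1n muln_gt0.
  by apply: mulr_ege1 => //; apply: mulr_ege1 => //; apply: mulr_ege1.
apply: (le_trans (kloos_interval c0 m0 A Lc hs)).
have hh := harmo_le R c; rewrite -/r in hh.
rewrite /Bc -/d -/r.
have -> : 130 * m%:R * d * r ^+ 7 = (2 * m%:R * r ^+ 6 * d) * (65 * r) by ring.
rewrite ler_wpM2l ?mulr_ge0 ?exprn_ge0 ?ler0n //; lra.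
Qed.

Lemma Bc_ge0 : 0 <= Bc.
Proof. by rewrite !mulr_ge0 ?exprn_ge0 ?ler0n ?root8_ge0. Qed.

(** The exponents are 7/8 - 2 = -9/8. The added 1 makes room for the quadratic error of
    [row_term_lin], for which no cancellation is used. *)
Lemma Bc_Dc : (Bc + 1) / c%:R ^+ 2 <= (130 * m%:R + 1) * Dc.
Proof.
rewrite ler_pdivrMr ?exprn_gt0 // /Bc /Dc /g9 -!(root8X R c).
set d : R := (size (divisors c))%:R; set r := root8 R c.
have r1 : 1 <= r by exact: root8_ge1.
have r0 : r != 0 by rewrite gt_eqF //; lra.
have -> : (130 * m%:R + 1) * (d * r ^- 9) * (r ^+ 8) ^+ 2 = 130 * m%:R * d * r ^+ 7 + d * r ^+ 7.
  by field.
by rewrite lerD2l mulr_ege1 // exprn_ege1.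
Qed.

Lemma Dc_ge0 : 0 <= Dc. Proof. by rewrite mulr_ge0 ?g9_ge0 ?ler0n. Qed.

Definition muc : R[i] := (\sum_(0 <= k < c) K k%:Z) / c%:R.

Lemma nm_muc : nm muc <= Bc / c%:R.
Proof.
rewrite /muc nmM nmV nm_nat ler_pM2r ?invr_gt0 //.
by have := kloos_interval_Bc 0 (leqnn c); under eq_bigr do rewrite add0r.
Qed.

Lemma sum_kloos_period (A : int) : \sum_(0 <= k < c) K (A + k%:Z) = c%:R * muc.
Proof.
rewrite /muc mulrC divfK ?pnatr_eq0 -?lt0n //.
have step (B : int) : \sum_(0 <= k < c) K (B + 1 + k%:Z) = \sum_(0 <= k < c) K (B + k%:Z).
  case: c c0 => // n _; rewrite big_nat_recr // [RHS]big_nat_recl //= addr0 addrC.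
  congr (_ + _); last by apply: eq_bigr => k _; congr kloos; rewrite -addrA intS.
  by rewrite -addrA -intS -[n.+1%:Z]mul1r kloosD.
have up (n : nat) (B : int) : \sum_(0 <= k < c) K (B + n%:Z + k%:Z) = \sum_(0 <= k < c) K (B + k%:Z).
  elim: n B => [|n IH] B; first by rewrite addr0.
  by rewrite intS addrA IH step.
case: A => n; first by rewrite -[Posz n]add0r up; apply: eq_bigr => k _; rewrite add0r.
rewrite -(up n.+1) NegzE addNr; by apply: eq_bigr => k _; rewrite add0r.
Qed.

(** After subtraction of the mean every full period sums to 0, so the bound does not grow with
    [L]. *)
Lemma sum_kloos_centered (A : int) (L : nat) :
  nm (\sum_(0 <= k < L) (K (A + k%:Z) - muc)) <= 2 * Bc.
Proof.
elim: {L}L.+1 {-2}L (ltnSn L) A => // n IH L Ln A.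
have [Lc|Lc] := leqP L c.
  rewrite sumrB (le_trans (nmB _ _)) // mulr_natl mulr2n lerD ?kloos_interval_Bc //.
  rewrite big_const_nat iter_addr_0 subn0 -mulr_natl nmM nm_nat.
  apply: (@le_trans _ _ (c%:R * (Bc / c%:R))).
    by rewrite ler_pM ?nm_ge0 ?ler0n ?ler_nat ?nm_muc.
  by rewrite mulrCA divff ?mulr1 // gt_eqF.
rewrite (big_cat_nat _ (n := c)) ?(ltnW Lc) //=.
have -> : \sum_(0 <= k < c) (K (A + k%:Z) - muc) = 0.
  by rewrite sumrB sum_kloos_period big_const_nat iter_addr_0 subn0 -[muc *+ c]mulr_natl subrr.
rewrite add0r -{1}[c]add0n big_addn.
under eq_bigr => k _ do rewrite PoszD [k%:Z + _]addrC addrA.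
by apply: IH; lia.
Qed.

(* [phi m (g z) = e(- m a / c) * row_term z d] when [g] has upper left entry
   proportional to [a] and lower row proportional to [(c, d)]; see [phi_gm]. *)
Definition row_term z (d : int) : R[i] :=
  let w := c%:R * z + d%:~R in
  e2pi (m%:R / (lam%:R * c%:R * w)) - e2pi (m%:R / (lam%:R * c%:R * conjc w)).

(** Expand both exponentials to first order. The constants cancel, the linear parts combine to the
    kernel because 1/w - 1/conj w = -2 i Y / |w|^2, and [cexp_quad] bounds the remainder. *)
Lemma row_term_lin z (d : int) (eta : R) : 0 < eta -> eta <= complex.Im z ->
  nm (row_term z d - (4 * pi * m%:R / (lam%:R * c%:R) *
       bump8 (c%:R * complex.Im z) (c%:R * complex.Re z + d%:~R))%:C) <=
  8 * (expR (2 * pi * m%:R / eta) + 1 + 2 * pi * m%:R / eta) * (2 * pi * m%:R) ^+ 2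
    / (c%:R ^+ 2 * (c%:R * complex.Im z)) *
    bump8 (c%:R * complex.Im z) (c%:R * complex.Re z + d%:~R).
Proof.
move=> e0 ey; set Y := c%:R * complex.Im z; have y0 : 0 < complex.Im z by lra.
have Y0 : 0 < Y by rewrite mulr_gt0.
set w := c%:R * z + d%:~R; set t := c%:R * complex.Re z + d%:~R.
have wE : w = t +i* Y.
  by apply: complex_eq; rewrite /w natC intC ?ReD ?ImD ?ReZ ?ImZ /= ?addr0.
have q0 : 0 < t ^+ 2 + Y ^+ 2 by rewrite ltr_wpDl ?sqr_ge0 ?exprn_gt0.
have w2 : nm w ^+ 2 = t ^+ 2 + Y ^+ 2 by rewrite wE nm_sqr.
have w0 : w != 0.
  by apply/eqP => h; move: w2; rewrite h nm0 expr0n /= => h2; rewrite -h2 ltxx in q0.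
have wY : Y <= nm w by rewrite (le_trans _ (nm_Im w)) // wE /= ler_norm.
have nw0 : 0 < nm w by rewrite nm_gt0.
pose a : R := 2 * pi * m%:R / (lam%:R * c%:R).
have a0 : 0 < a by rewrite divr_gt0 ?mulr_gt0 ?pi_gt0.
pose zt (v : R[i]) := (2 * pi)%:C * 'i * (m%:R / (lam%:R * c%:R * v)) : R[i].
have nzt v : v != 0 -> nm (zt v) = a / nm v.
  move=> v0; rewrite /zt !nmM nmV !nmM nm_i !nm_nat nm_real mulr1.
  rewrite ger0_norm ?mulr_ge0 ?pi_ge0 // /a; field.
  by rewrite !gt_eqF ?nm_gt0.
have a_le : a / nm w <= 2 * pi * m%:R / eta.
  rewrite /a -[leLHS]mulrA ler_wpM2l ?mulr_ge0 ?pi_ge0 ?ler0n // -invfM.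
  rewrite lef_pV2 ?posrE ?mulr_gt0 //.
  apply: (le_trans ey); apply: (@le_trans _ _ (1 * (1 * complex.Im z))); first by rewrite !mul1r.
  rewrite ler_pM ?mulr_ge0 ?mulr_ege1 ?(ltW y0) //.
  by apply: le_trans wY; rewrite ler_wpM2r // ltW.
have lin : zt w - zt (conjc w) = (4 * pi * m%:R / (lam%:R * c%:R) * bump8 Y t)%:C.
  have cw0 : conjc w != 0 by rewrite conjc_eq0.
  have -> : zt w - zt (conjc w) = (2 * pi)%:C * 'i * (m%:R / (lam%:R * c%:R)) * ((conjc w - w) / (w * conjc w)).
    rewrite /zt; field; rewrite w0 cw0 !pnatr_eq0 -!lt0n c0 lam0 //.
  have -> : w * conjc w = (t ^+ 2 + Y ^+ 2)%:C by rewrite -w2 nm_sqrC.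
  have -> : conjc w - w = (- 2 * Y)%:C * 'i.
    by rewrite wE; apply: complex_eq => /=; ring.
  rewrite !natC -!rmorphM -fmorphV -!rmorphM /= -fmorphV.
  rewrite /bump8; apply: complex_eq => /=; field; rewrite !gt_eqF ?mulr_gt0 //.
have quad v : v != 0 -> nm v = nm w -> nm (e2pi (m%:R / (lam%:R * c%:R * v)) - 1 - zt v) <=
    4 * (expR (2 * pi * m%:R / eta) + 1 + 2 * pi * m%:R / eta) * (a / nm w) ^+ 2.
  move=> v0 vw; have := @cexp_quad R (2 * pi * m%:R / eta) (zt v).
  by rewrite (nzt v v0) vw => /(_ a_le).
rewrite -lin /row_term -/w.
set E1 := e2pi _; set E2 := e2pi _.
have -> : E1 - E2 - (zt w - zt (conjc w)) = (E1 - 1 - zt w) - (E2 - 1 - zt (conjc w)) by ring.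
apply: (le_trans (nmB _ _)).
apply: (le_trans (lerD (quad w w0 erefl) (quad (conjc w) _ (nm_conj w)))).
  by rewrite conjc_eq0.
set k := expR _ + 1 + _.
have k0 : 0 <= k by rewrite !addr_ge0 ?expR_ge0 ?mulr_ge0 ?pi_ge0 ?ler0n ?invr_ge0 ?(ltW e0).
rewrite exprMn exprVn w2 /bump8 /a.
have -> : 8 * k * (2 * pi * m%:R) ^+ 2 / (c%:R ^+ 2 * Y) * (Y / (t ^+ 2 + Y ^+ 2)) =
   8 * k * ((2 * pi * m%:R) ^+ 2 / c%:R ^+ 2 / (t ^+ 2 + Y ^+ 2)).
  by field; rewrite !gt_eqF.
have -> : forall X, 4 * k * X + 4 * k * X = 8 * k * X by move=> X; ring.
rewrite ler_wpM2l ?mulr_ge0 // ler_wpM2r ?invr_ge0 ?(ltW q0) // exprMn ler_wpM2l ?sqr_ge0 //.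
rewrite exprVn lef_pV2 ?posrE ?exprn_gt0 ?mulr_gt0 // lerXn2r ?nnegrE ?mulr_ge0 ?ler0n //.
by rewrite ler_peMl ?ler0n.
Qed.

Definition Vsum z (A : int) (L : nat) : R[i] :=
  \sum_(0 <= k < L) K (A + k%:Z) * row_term z (A + k%:Z).

(** The factor in front of the integral of the kernel. Multiplied by the total mass pi it is the
    contribution of the row at the cusp. *)
Definition Vconst : R[i] := (4 * pi * m%:R / (lam%:R * c%:R))%:C * muc.

(** Collects the errors of [Vsum_est]: 128 m comes from the Kloosterman sums, the other summand from
    the quadratic error, and the factor in front from [Bc_Dc]. *)
Definition Cest (eta : R) : R := (130 * m%:R + 1) * (128 * m%:R +
  8 * (expR (2 * pi * m%:R / eta) + 1 + 2 * pi * m%:R / eta) * (2 * pi * m%:R) ^+ 2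
   * (4 + 2 / eta)).

Lemma Cest_ge0 (eta : R) : 0 < eta -> 0 <= Cest eta.
Proof.
by move=> e0; rewrite /Cest; nneg.
Qed.

Lemma nm_Vconst (eta : R) : 0 < eta -> nm Vconst <= Cest eta * Dc.
Proof.
move=> e0; rewrite /Vconst nmM nm_real ger0_norm; last first.
  by rewrite !mulr_ge0 ?invr_ge0 ?mulr_ge0 ?pi_ge0 ?ler0n.
apply: (@le_trans _ _ (16 * m%:R * ((Bc + 1) / c%:R ^+ 2))).
  have -> : 4 * pi * m%:R / (lam%:R * c%:R) * nm muc = (4 * pi * m%:R) * (lam%:R^-1 * (c%:R^-1 * nm muc)).
    by field; rewrite !gt_eqF.
  have p4 := pi_le4 R; have p0 := @pi_ge0 R.
  apply: ler_pM; rewrite ?mulr_ge0 ?invr_ge0 ?nm_ge0 ?ler0n //.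
    by rewrite ler_wpM2r ?ler0n //; lra.
  apply: (@le_trans _ _ (1 * (c%:R^-1 * (Bc / c%:R)))).
    apply: ler_pM; rewrite ?mulr_ge0 ?invr_ge0 ?nm_ge0 ?ler0n //.
      by rewrite invf_le1.
    by rewrite ler_wpM2l ?invr_ge0 ?ler0n // nm_muc.
  have -> : 1 * (c%:R^-1 * (Bc / c%:R)) = Bc / c%:R ^+ 2 by field; rewrite gt_eqF.
  by rewrite ler_wpM2r ?invr_ge0 ?exprn_ge0 ?ler0n //; lra.
have h := Bc_Dc; have D0 := Dc_ge0.
apply: (@le_trans _ _ (16 * m%:R * ((130 * m%:R + 1) * Dc))).
  by rewrite ler_wpM2l // mulr_ge0.
set X := 8 * (expR (2 * pi * m%:R / eta) + 1 + 2 * pi * m%:R / eta) * (2 * pi * m%:R) ^+ 2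
   * (4 + 2 / eta); have X0 : 0 <= X by rewrite /X; nneg.
rewrite /Cest -/X [leRHS]mulrAC [leRHS]mulrC ler_wpM2r //; first by nneg.
by have := mR1; lra.
Qed.

(** The main term is the mean of the Kloosterman sums times the integral of the kernel. The error is
    uniform in [A] and [L], as it must be for intervals cut out by a height condition, and it decays
    as Im z grows, which yields the limit at the cusp. *)
Lemma Vsum_est (eta : R) z (A : int) (L : nat) : 0 < eta -> eta <= complex.Im z ->
  nm (Vsum z A L - Vconst *
      (atan ((c%:R * complex.Re z + A%:~R + L%:R) / (c%:R * complex.Im z))
       - atan ((c%:R * complex.Re z + A%:~R) / (c%:R * complex.Im z)))%:C) <=
    Cest eta * Dc / complex.Im z.
Proof.
move=> e0 ey; set Y := c%:R * complex.Im z; set t := c%:R * complex.Re z + A%:~R; have y0 : 0 < complex.Im z by lra.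
have Y0 : 0 < Y by rewrite mulr_gt0.
pose a : R := 4 * pi * m%:R / (lam%:R * c%:R).
have a0 : 0 <= a by rewrite !mulr_ge0 ?invr_ge0 ?mulr_ge0 ?pi_ge0 ?ler0n.
pose b k := bump8 Y (t + k%:R).
have bE k : b k = bump8 Y (c%:R * complex.Re z + (A + k%:Z)%:~R).
  by rewrite /b /t intrD -pmulrn addrA.
pose at_ := atan ((t + L%:R) / Y) - atan (t / Y).
(* Three errors: linearisation of the row terms, the centred Kloosterman sums against the kernel
   (partial summation), and sum against integral of the kernel. *)
have -> : Vsum z A L - Vconst * at_%:C =
   \sum_(0 <= k < L) K (A + k%:Z) * (row_term z (A + k%:Z) - (a * b k)%:C)
   + a%:C * (\sum_(0 <= k < L) (K (A + k%:Z) - muc) * (b k)%:C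
            + muc * (\sum_(0 <= k < L) b k - at_)%:C).
  have E1 : \sum_(0 <= k < L) K (A + k%:Z) * (row_term z (A + k%:Z) - (a * b k)%:C) =
      Vsum z A L - a%:C * \sum_(0 <= k < L) K (A + k%:Z) * (b k)%:C.
    rewrite /Vsum mulr_sumr -sumrB; apply: eq_bigr => k _.
    by rewrite (rmorphM (real_complex R)); ring.
  have E2 : \sum_(0 <= k < L) (K (A + k%:Z) - muc) * (b k)%:C =
      \sum_(0 <= k < L) K (A + k%:Z) * (b k)%:C - muc * \sum_(0 <= k < L) (b k)%:C.
    by rewrite mulr_sumr -sumrB; apply: eq_bigr => k _; ring.
  have E3 : (\sum_(0 <= k < L) b k)%:C = \sum_(0 <= k < L) (b k)%:C :> R[i].
    exact: (rmorph_sum (real_complex R)).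
  have E4 : (\sum_(0 <= k < L) b k - at_)%:C = (\sum_(0 <= k < L) b k)%:C - at_%:C :> R[i].
    exact: (rmorphB (real_complex R)).
  by rewrite E1 E2 E4 E3 /Vconst -/a; ring.
set k8 := 8 * (expR (2 * pi * m%:R / eta) + 1 + 2 * pi * m%:R / eta) * (2 * pi * m%:R) ^+ 2.
have k80 : 0 <= k8.
  by rewrite /k8; nneg.
have B0 := Bc_ge0; have yi : 0 < (complex.Im z)^-1 by rewrite invr_gt0.
have h1 : nm (\sum_(0 <= k < L) K (A + k%:Z) * (row_term z (A + k%:Z) - (a * b k)%:C)) <=
    k8 * (4 + 2 / eta) / c%:R ^+ 2 / complex.Im z.
  apply: (le_trans (nm_sum _ _ _)).
  (* The quadratic error is of order c^-3 times the kernel, so the trivial bound c for the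
     Kloosterman sums suffices here. *)
  apply: (@le_trans _ _ (\sum_(0 <= k < L) c%:R * (k8 / (c%:R ^+ 2 * Y) * b k))).
    apply: ler_sum => k _; rewrite nmM ler_pM ?nm_ge0 ?nm_kloos //.
    by rewrite bE; exact: row_term_lin.
  rewrite -mulr_sumr -mulr_sumr.
  apply: (@le_trans _ _ (c%:R * (k8 / (c%:R ^+ 2 * Y) * (4 + 2 / eta)))).
    apply: ler_wpM2l; first by nneg.
    apply: ler_wpM2l; first by nneg.
    apply: (le_trans (sum_bump_le t L Y0)); rewrite lerD2l ler_wpM2l //.
    rewrite lef_pV2 ?posrE //; apply: (le_trans ey).
    by rewrite ler_peMl ?(ltW y0).
  rewrite le_eqVlt; apply/orP; left; apply/eqP; rewrite /Y; field.
  by rewrite !gt_eqF.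
have h2 : nm (\sum_(0 <= k < L) (K (A + k%:Z) - muc) * (b k)%:C) <= 3 * (2 * Bc) / Y.
  by apply: abel_bump => // j _; exact: sum_kloos_centered.
have h3 : nm (muc * (\sum_(0 <= k < L) b k - at_)%:C) <= Bc * (2 / Y).
  rewrite nmM nm_real ler_pM ?nm_ge0 //; last exact: sum_bump.
  rewrite (le_trans nm_muc) // ler_piMr // invf_le1 //.
apply: (le_trans (nmD _ _)); apply: (le_trans (lerD h1 (lexx _))).
rewrite nmM nm_real (ger0_norm a0).
apply: (@le_trans _ _ (k8 * (4 + 2 / eta) / c%:R ^+ 2 / complex.Im z +
     16 * m%:R / c%:R * (8 * Bc / Y))).
  rewrite lerD2l ler_pM ?nm_ge0 //.
    have p4 := pi_le4 R; have p0 := @pi_ge0 R.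
    rewrite /a ler_pM ?invr_ge0 ?mulr_ge0 ?ler0n // ?ler_wpM2r ?ler0n //; first lra.
    by rewrite lef_pV2 ?posrE ?mulr_gt0 // ler_peMl ?ler0n.
  apply: (le_trans (nmD _ _)); apply: (le_trans (lerD h2 h3)).
  by rewrite le_eqVlt; apply/orP; left; apply/eqP; ring.
have -> : 16 * m%:R / c%:R * (8 * Bc / Y) = 128 * m%:R * Bc / c%:R ^+ 2 / complex.Im z.
  by rewrite /Y; field; rewrite !gt_eqF.
rewrite -mulrDl ler_wpM2r ?(ltW yi) //.
apply: (@le_trans _ _ ((128 * m%:R + k8 * (4 + 2 / eta)) * ((Bc + 1) / c%:R ^+ 2))).
  rewrite -mulrDl mulrA ler_wpM2r ?invr_ge0 ?exprn_ge0 ?ler0n //.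
  set q := k8 * _; have q0 : 0 <= q.
    by rewrite mulr_ge0 // addr_ge0 // divr_ge0 // ltW.
  have := mR1; nra.
rewrite /Cest -/k8 [leRHS]mulrAC [leRHS]mulrC ler_wpM2l ?Bc_Dc //.
by nneg.
Qed.

End InnerSum.

Section Tails.
Variable R : realType.

(** The term at t is at most Y / ((t - 1) t), which telescopes. *)
Lemma bump_tail_right (Y T t : R) (L : nat) : 0 < Y -> 1 < T -> T <= t ->
  \sum_(0 <= k < L) bump8 Y (t + k%:R) <= Y / (T - 1).
Proof.
move=> Y0 T1 Tt.
apply: (@le_trans _ _ (Y / (t - 1) - Y / (t - 1 + L%:R))).
  elim: L => [|L IH]; first by rewrite big_geq // addr0 subrr.
  rewrite big_nat_recr //=; apply: (le_trans (lerD IH (lexx _))).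
  have L0 : (0 : R) <= L%:R by rewrite ler0n.
  have h1 : 0 < t - 1 + L%:R by lra.
  have h2 : 0 < t + L%:R by lra.
  suff h : bump8 Y (t + L%:R) <= Y / (t - 1 + L%:R) - Y / (t - 1 + L.+1%:R) by lra.
  have -> : t - 1 + L.+1%:R = t + L%:R by rewrite -natr1; ring.
  have -> : Y / (t - 1 + L%:R) - Y / (t + L%:R) = Y / ((t - 1 + L%:R) * (t + L%:R)).
    by field; rewrite !gt_eqF.
  rewrite /bump8 ler_wpM2l ?(ltW Y0) // lef_pV2 ?posrE ?mulr_gt0 //.
    have := sqr_ge0 Y; nra.
  by rewrite ltr_wpDl ?sqr_ge0 ?exprn_gt0.
have L0 : (0 : R) <= L%:R by rewrite ler0n.
have h3 : 0 <= Y / (t - 1 + L%:R) by rewrite divr_ge0 ?(ltW Y0) //; lra.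
apply: (@le_trans _ _ (Y / (t - 1))); first lra.
by rewrite ler_wpM2l ?(ltW Y0) // lef_pV2 ?posrE; lra.
Qed.

Lemma bump_tail_left (Y T t : R) (L : nat) : 0 < Y -> 1 < T -> t + L%:R - 1 <= - T ->
  \sum_(0 <= k < L) bump8 Y (t + k%:R) <= Y / (T - 1).
Proof.
move=> Y0 T1 Tt; apply: le_trans (@bump_tail_right Y T (- (t + L%:R - 1)) L Y0 T1 _); last lra.
rewrite big_nat_rev /= big_nat [leRHS]big_nat; apply: ler_sum => k /andP[_ kL].
rewrite le_eqVlt; apply/orP; left; apply/eqP; rewrite /bump8; congr (_ / (_ + _)).
by rewrite -[RHS]sqrrN; congr (_ ^+ 2); rewrite add0n natrB // -natr1; ring.
Qed.

Lemma sum_Dc_le n : \sum_(1 <= c < n) Dc R c <= 81.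
Proof. exact: sum_divisors_g9. Qed.

Lemma Dc_tail (e : R) : 0 < e -> exists N, forall n, \sum_(N.+1 <= c < n) Dc R c <= e.
Proof.
move=> e0; pose u n := \sum_(1 <= c < n.+1) Dc R c.
have un : nondecreasing_seq u.
  apply/nondecreasing_seqP => n; rewrite /u [leRHS]big_nat_recr //= lerDl.
  exact: Dc_ge0.
have cu : cvgn u.
  apply: nondecreasing_is_cvgn => //; exists 81 => _ [n _ <-]; exact: sum_Dc_le.
move/cvgrPdist_le : (cu) => /(_ e e0) [N _ hN]; exists N => n.
have [nN|Nn] := leqP n N; first by rewrite big_geq ?ltW // ltnW.
case: n Nn => // n Nn.
have -> : \sum_(N.+1 <= c < n.+1) Dc R c = u n - u N.
  by rewrite /u [X in _ = X - _](big_cat_nat _ (n := N.+1)) //= addrAC subrr add0r.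
have h1 : u n <= limn u by apply: nondecreasing_cvgn_le.
have := hN N (leqnn N); rewrite /= ler_norml => /andP[_ h2]; lra.
Qed.

Lemma atan_near_pihalf (e : R) : 0 < e -> exists T, forall s, T <= s -> pi / 2 - e <= atan s.
Proof.
move=> e0; have /cvgrPdist_le /(_ e e0) := @cvgy_atan R.
move=> [T [_ hT]]; exists (T + 1) => s Ts.
have := hT s; rewrite /= => /(_ ltac:(lra)); rewrite ler_norml => /andP[_]; lra.
Qed.

End Tails.

(** * Summation over d, then over c *)

Section LimitFunctions.
Variables (R : realType) (p m : nat).
Hypotheses (p0 : (0 < p)%N) (m0 : (0 < m)%N).
Implicit Types (z : R[i]) (c n L N : nat) (A : int).

(* The elements of Gamma_0^*(p) have lower row [sqrt lam * (c, d)] for integers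
   [c], [d], where [lam] is this function of [c]. *)
Definition row_scale (c : nat) : nat := if (p %| c)%N then 1%N else p.
Lemma row_scale_gt0 c : (0 < row_scale c)%N. Proof. by rewrite /row_scale; case: ifP. Qed.

Definition row_sum z c A L : R[i] := Vsum (row_scale c) m c z A L.
Definition row_const c : R[i] := Vconst R (row_scale c) m c * pi%:C.
Definition box z c n : R[i] := row_sum z c (- n%:Z) (2 * n)%N.

Lemma row_sum_cat z c A L1 L2 : row_sum z c A (L1 + L2) = row_sum z c A L1 + row_sum z c (A + L1%:Z) L2.
Proof.
rewrite /row_sum /Vsum (big_cat_nat _ (n := L1)) ?leq_addr //=; congr (_ + _).
rewrite -{1}[L1]add0n big_addn addKn; apply: eq_bigr => k _.
by rewrite PoszD [k%:Z + _]addrC addrA.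
Qed.

(** Independent of the interval, this bound passes to the limit [lc] and also dominates the
    truncated rows with large c, whatever the cut-off. *)
Lemma nm_row_sum z c A L (eta : R) : (0 < c)%N -> 0 < eta -> eta <= complex.Im z ->
  nm (row_sum z c A L) <= Cest m eta * (eta^-1 + 4) * Dc R c.
Proof.
move=> c0 e0 ey; have y0 : 0 < complex.Im z by lra.
have h1 := Vsum_est c0 m0 (row_scale_gt0 c) A L e0 ey.
have h2 := nm_Vconst c0 m0 (row_scale_gt0 c) e0.
move: h1; set at_ := atan _ - atan _; set v := Vsum _ _ _ _ _ _ => h1.
have hat : `|at_| <= 4.
  rewrite /at_; set s1 := _ / _; set s2 := _ / _.
  have := @atan_ltpi2 R s1; have := @atan_gtNpi2 R s1.
  have := @atan_ltpi2 R s2; have := @atan_gtNpi2 R s2; have := pi_le4 R.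
  by move=> *; rewrite ler_norml; apply/andP; split; lra.
have D0 := Dc_ge0 R c; have C0 := Cest_ge0 m e0.
have -> : row_sum z c A L = (v - Vconst R (row_scale c) m c * at_%:C) + Vconst R (row_scale c) m c * at_%:C.
  by rewrite subrK.
apply: (le_trans (nmD _ _)).
have -> : Cest m eta * (eta^-1 + 4) * Dc R c = Cest m eta * Dc R c * eta^-1 + Cest m eta * Dc R c * 4.
  by ring.
apply: lerD; last by rewrite nmM nm_real ler_pM ?nm_ge0.
apply: (le_trans h1); apply: ler_wpM2l; first by nneg.
by rewrite lef_pV2 ?posrE.
Qed.

Definition Ctail c (eta y1 : R) : R :=
  c%:R * (16 * m%:R * (c%:R * y1) +
   8 * (expR (2 * pi * m%:R / eta) + 1 + 2 * pi * m%:R / eta) * (2 * pi * m%:R) ^+ 2).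

(** A compact region on which the tails in d are uniformly small, so that the limits stay
    approximable on discs. *)
Definition in_box (eta y1 x1 : R) z :=
  [/\ 0 < eta, eta <= complex.Im z, complex.Im z <= y1 & `|complex.Re z| <= x1].

(** Within one row the sum over d converges absolutely, so the trivial bound for the Kloosterman
    sums is enough. The constant depends on c, which is harmless as only finitely many rows are
    treated in this way at a time. *)
Lemma row_sum_abs (eta y1 x1 S : R) z c A L : (0 < c)%N -> in_box eta y1 x1 z ->
  \sum_(0 <= k < L) bump8 (c%:R * complex.Im z) (c%:R * complex.Re z + A%:~R + k%:R)
    <= (c%:R * complex.Im z) * S ->
  nm (row_sum z c A L) <= Ctail c eta y1 * S.
Proof.
move=> c0 [e0 ey yy xx]; set Y := c%:R * complex.Im z => hS.
have y0 : 0 < complex.Im z by lra.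
have cR : (0 : R) < c%:R by rewrite ltr0n.
have c1 : (1 : R) <= c%:R by rewrite ler1n.
have Y0 : 0 < Y by rewrite mulr_gt0.
have S0 : 0 <= S.
  rewrite -(pmulr_rge0 _ Y0) (le_trans _ hS) // sumr_ge0 // => k _; exact: bump_ge0.
set k8 := 8 * (expR (2 * pi * m%:R / eta) + 1 + 2 * pi * m%:R / eta) * (2 * pi * m%:R) ^+ 2.
have k80 : 0 <= k8 by rewrite /k8; nneg.
apply: (le_trans (nm_sum _ _ _)).
pose b k := bump8 Y (c%:R * complex.Re z + A%:~R + k%:R).
have lR : (0 : R) < (row_scale c)%:R by rewrite ltr0n row_scale_gt0.
have l1 : (1 : R) <= (row_scale c)%:R by rewrite ler1n row_scale_gt0.
have p4 := pi_le4 R; have pp := @pi_ge0 R.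
apply: (@le_trans _ _ (\sum_(0 <= k < L) c%:R * ((16 * m%:R + k8 / Y) * b k))).
  apply: ler_sum => k _; rewrite nmM; apply: ler_pM; rewrite ?nm_ge0 ?nm_kloos //.
  have h := row_term_lin c0 m0 (row_scale_gt0 c) (A + k%:Z) e0 ey.
  have bE : bump8 Y (c%:R * complex.Re z + (A + k%:Z)%:~R) = b k.
    by rewrite /b intrD -pmulrn addrA.
  rewrite -/Y bE -/k8 in h.
  set H := row_term _ _ _ _ _ in h *; set a := 4 * pi * m%:R / _ in h.
  have a16 : 0 <= a <= 16 * m%:R.
    apply/andP; split; first by rewrite /a; nneg.
    rewrite /a ler_pdivrMr ?mulr_gt0 //.
    apply: (@le_trans _ _ (16 * m%:R * 1)); first by rewrite mulr1 ler_wpM2r ?ler0n //; lra.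
    by rewrite ler_wpM2l ?mulr_ge0 ?ler0n // mulr_ege1.
  have b0 : 0 <= b k by exact: bump_ge0.
  have -> : H = (H - (a * b k)%:C) + (a * b k)%:C by rewrite subrK.
  apply: (le_trans (nmD _ _)); rewrite [leRHS]mulrDl addrC; apply: lerD.
    case/andP: a16 => a1 a2.
    have -> : nm (a * b k)%:C = a * b k by rewrite nm_real ger0_norm // mulr_ge0.
    exact: ler_wpM2r.
  apply: (le_trans h); rewrite ler_wpM2r // ler_wpM2l // lef_pV2 ?posrE ?mulr_gt0 ?exprn_gt0 //.
  by rewrite ler_peMl ?(ltW Y0) // exprn_ege1.
rewrite -mulr_sumr -mulr_sumr /Ctail -[leRHS]mulrA; apply: ler_wpM2l; first exact: ltW.
apply: (@le_trans _ _ ((16 * m%:R + k8 / Y) * (Y * S))).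
  apply: ler_wpM2l => //; by nneg.
rewrite -/k8 mulrA; apply: ler_wpM2r => //.
rewrite mulrDl divfK ?gt_eqF // lerD2r; apply: ler_wpM2l; first by nneg.
by rewrite /Y; apply: ler_wpM2l => //; exact: ltW.
Qed.

Lemma row_sum_box (eta y1 x1 : R) z c n A L : (0 < c)%N -> in_box eta y1 x1 z ->
  c%:R * x1 + 1 < n%:R -> A <= - n%:Z -> n%:Z <= A + L%:Z ->
  nm (row_sum z c A L - box z c n) <= 2 * Ctail c eta y1 / (n%:R - c%:R * x1 - 1).
Proof.
move=> c0 hz hn hA hL; have [e0 ey yy xx] := hz.
have y0 : 0 < complex.Im z by lra.
have cR : (0 : R) < c%:R by rewrite ltr0n.
have Y0 : 0 < c%:R * complex.Im z by rewrite mulr_gt0.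
have cx : `|c%:R * complex.Re z| <= c%:R * x1.
  by rewrite normrM ger0_norm ?(ltW cR) // ler_wpM2l // ltW.
have x0 : 0 <= c%:R * x1 := le_trans (normr_ge0 _) cx.
move: cx; rewrite ler_norml => /andP[cx1 cx2].
set T := n%:R - c%:R * x1; have T1 : 1 < T by rewrite /T; lra.
pose L1 := `|(- n%:Z - A)%R|%N; pose L3 := `|(A + L%:Z - n%:Z)%R|%N.
have L1E : L1%:Z = - n%:Z - A by rewrite /L1 gez0_abs // subr_ge0.
have L3E : L3%:Z = A + L%:Z - n%:Z by rewrite /L3 gez0_abs // subr_ge0.
have LE : L = (L1 + 2 * n + L3)%N by apply/eqP; rewrite -eqz_nat PoszD [(L1 + _)%N%:Z]PoszD L1E L3E PoszM; apply/eqP; ring.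
have -> : row_sum z c A L - box z c n = row_sum z c A L1 + row_sum z c n%:Z L3.
  rewrite LE row_sum_cat row_sum_cat.
  have -> : A + L1%:Z = - n%:Z by rewrite L1E; ring.
  have -> : A + (L1 + 2 * n)%N%:Z = n%:Z by rewrite PoszD L1E PoszM; ring.
  by rewrite /box; ring.
apply: (le_trans (nmD _ _)).
have -> : 2 * Ctail c eta y1 / (T - 1) = Ctail c eta y1 * (T - 1)^-1 + Ctail c eta y1 * (T - 1)^-1.
  by ring.
apply: lerD; apply: (row_sum_abs c0 hz).
  apply: bump_tail_left => //.
  have : A%:~R + L1%:R = - n%:R :> R.
    rewrite [L1%:R]pmulrn -intrD L1E (_ : A + (- n%:Z - A) = - n%:Z); last by ring.
    by rewrite mulrNz -pmulrn.
  rewrite /T; lra.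
apply: bump_tail_right => //; rewrite -pmulrn /T; lra.
Qed.

Definition lc z c : R[i] := limn (box z c : nat -> R[i]^o).

Lemma uhp_in_box z : 0 < complex.Im z -> in_box (complex.Im z) (complex.Im z) `|complex.Re z| z.
Proof. by []. Qed.

Lemma inv_small (K a e : R) : 0 <= K -> 0 < e -> exists N : nat, forall n : nat, (N <= n)%N ->
  a < n%:R /\ K / (n%:R - a) <= e.
Proof.
move=> K0 e0; exists (Num.bound (`|a| + K / e + 1)) => n hn.
have h : `|a| + K / e + 1 < n%:R.
  apply: lt_le_trans (_ : (Num.bound (`|a| + K / e + 1))%:R <= _); last by rewrite ler_nat.
  by apply: archi_boundP; have := ltW e0; move=> ?; nneg.
have := ler_norm a; have Ke : 0 <= K / e by rewrite divr_ge0 // ltW.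
move=> ha; have na : a < n%:R by lra.
split=> //; rewrite ler_pdivrMr ?subr_gt0 // mulrC -ler_pdivrMr //; lra.
Qed.

Lemma Ctail_ge0 c (eta y1 : R) : 0 < eta -> 0 <= y1 -> 0 <= Ctail c eta y1.
Proof. by move=> e0 y10; rewrite /Ctail; nneg. Qed.

Lemma box_cvg z c : (0 < c)%N -> 0 < complex.Im z -> ccvg (box z c) (lc z c).
Proof.
move=> c0 y0; have hz := uhp_in_box y0.
suff [l hl] : exists l, ccvg (box z c) l by have [_] := ccvg_lim hl; rewrite /lc => ->.
apply: ccauchy => e e0.
have K0 : 0 <= 2 * Ctail c (complex.Im z) (complex.Im z).
  by rewrite mulr_ge0 // Ctail_ge0 // ltW.
have [N hN] := inv_small (c%:R * `|complex.Re z| + 1) K0 e0.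
exists N => n Nn; have [h1 h2] := hN N (leqnn N).
apply: le_trans (row_sum_box c0 hz h1 _ _) _; [lia|lia|].
by move: h2; rewrite opprD addrA.
Qed.

Lemma row_sum_lc (eta y1 x1 : R) z c n A L : (0 < c)%N -> in_box eta y1 x1 z ->
  c%:R * x1 + 1 < n%:R -> A <= - n%:Z -> n%:Z <= A + L%:Z ->
  nm (row_sum z c A L - lc z c) <= 4 * Ctail c eta y1 / (n%:R - c%:R * x1 - 1).
Proof.
move=> c0 hz hn hA hL; have [e0 ey yy xx] := hz; have y0 : 0 < complex.Im z by lra.
have h1 := row_sum_box c0 hz hn hA hL.
have h2 : nm (box z c n - lc z c) <= 2 * Ctail c eta y1 / (n%:R - c%:R * x1 - 1).
  rewrite nm_distC.
  have hb : ccvg (fun k => box z c k + (- box z c n)) (lc z c + (- box z c n)).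
    by apply: ccvgD; [exact: box_cvg | exact: ccvg_cst].
  apply: (ccvg_le (N := n) hb) => k nk.
  by apply: row_sum_box => //; lia.
apply: (le_trans (nm_triangle _ (box z c n) _)); apply: (le_trans (lerD h1 h2)).
by rewrite le_eqVlt; apply/orP; left; apply/eqP; ring.
Qed.

Lemma nm_lc z c (eta : R) : (0 < c)%N -> 0 < eta -> eta <= complex.Im z ->
  nm (lc z c) <= Cest m eta * (eta^-1 + 4) * Dc R c.
Proof.
move=> c0 e0 ey; have y0 : 0 < complex.Im z by lra.
by apply: (ccvg_le (N := 0) (box_cvg c0 y0)) => n _; exact: nm_row_sum.
Qed.

(** [Vsum_est] in the limit: the two arctangents tend to pi/2 and -pi/2, so their difference becomes
    pi. *)
Lemma lc_row_const z c (eta : R) : (0 < c)%N -> 0 < eta -> eta <= complex.Im z ->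
  nm (lc z c - row_const c) <= Cest m eta * Dc R c / complex.Im z.
Proof.
move=> c0 e0 ey; have y0 : 0 < complex.Im z by lra.
have cR : (0 : R) < c%:R by rewrite ltr0n.
have Y0 : 0 < c%:R * complex.Im z by rewrite mulr_gt0.
pose s1 n := (c%:R * complex.Re z + (- n%:Z)%:~R + (2 * n)%N%:R) / (c%:R * complex.Im z) : R.
pose s2 n := (c%:R * complex.Re z + (- n%:Z)%:~R) / (c%:R * complex.Im z) : R.
have hb : ccvg (fun n => box z c n + (- 1) * (Vconst R (row_scale c) m c * (atan (s1 n) - atan (s2 n))%:C))
    (lc z c + (- 1) * (Vconst R (row_scale c) m c * pi%:C)).
  apply: ccvgD; first exact: box_cvg.
  apply: ccvgZ; apply: ccvgZ => e' e'0.
  have [T hT] := @atan_near_pihalf R (e' / 2) ltac:(lra).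
  exists (Num.bound (`|c%:R * complex.Re z| + `|T| * (c%:R * complex.Im z))) => n hn.
  have hn' : `|c%:R * complex.Re z| + `|T| * (c%:R * complex.Im z) < n%:R.
    apply: lt_le_trans (_ : (Num.bound _)%:R <= _); last by rewrite ler_nat; exact: hn.
    by apply: archi_boundP; have := ltW e0; move=> ?; nneg.
  have T1 := ler_norm T; have x1 := ler_norm (c%:R * complex.Re z).
  have x2 := ler_norm (- (c%:R * complex.Re z)); rewrite normrN in x2.
  have h1 : T <= s1 n.
    rewrite /s1 ler_pdivlMr // mulrNz -pmulrn natrM.
    have : T * (c%:R * complex.Im z) <= `|T| * (c%:R * complex.Im z) by rewrite ler_wpM2r // ltW.
    lra.
  have h2 : T <= - s2 n.
    rewrite /s2 -mulNr ler_pdivlMr // mulrNz -pmulrn.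
    have : T * (c%:R * complex.Im z) <= `|T| * (c%:R * complex.Im z) by rewrite ler_wpM2r // ltW.
    lra.
  have := hT _ h1; have := hT _ h2; rewrite atanN.
  have := @atan_ltpi2 R (s1 n); have := @atan_gtNpi2 R (s2 n).
  have -> : (atan (s1 n) - atan (s2 n))%:C - pi%:C = (atan (s1 n) - atan (s2 n) - pi)%:C :> R[i].
    exact/esym/(rmorphB (real_complex R)).
  move=> g1 g2 g3 g4; rewrite nm_real ler_norml; apply/andP; split; lra.
have -> : lc z c - row_const c = lc z c + (- 1) * (Vconst R (row_scale c) m c * pi%:C) by rewrite mulN1r.
apply: (ccvg_le (N := 0) hb) => n _; rewrite mulN1r.
exact: (Vsum_est c0 m0 (row_scale_gt0 c) (- n%:Z) (2 * n)%N e0 ey).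
Qed.

(* The seed of the Poincare series: periodic and harmonic, but not holomorphic. *)
Definition phi z : R[i] := e2pi (- (m%:R * z)) - e2pi (- (m%:R * conjc z)).
Definition poincare_tail z : R[i] := limn ((fun n => \sum_(1 <= c < n.+1) lc z c) : nat -> R[i]^o).
Definition poincare z : R[i] := phi z + poincare_tail z.
Definition cusp_const : R[i] := limn ((fun n => \sum_(1 <= c < n.+1) row_const c) : nat -> R[i]^o).

Lemma series_cvg (u : nat -> R[i]) (M : R) : 0 <= M ->
  (forall c, (0 < c)%N -> nm (u c) <= M * Dc R c) ->
  ccvg (fun n => \sum_(1 <= c < n.+1) u c)
       (limn ((fun n => \sum_(1 <= c < n.+1) u c) : nat -> R[i]^o)).
Proof.
move=> M0 hu; set v := fun n => _.
suff [l hl] : exists l, ccvg v l by have [_ ->] := ccvg_lim hl.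
apply: ccauchy => e e0.
have [N hN] := @Dc_tail R (e / (M + 1)) ltac:(rewrite divr_gt0 //; lra).
exists N => n Nn.
have -> : v n - v N = \sum_(N.+1 <= c < n.+1) u c.
  by rewrite /v (big_cat_nat _ (n := N.+1)) //= addrAC subrr add0r.
apply: (le_trans (nm_sum _ _ _)).
apply: (@le_trans _ _ (\sum_(N.+1 <= c < n.+1) M * Dc R c)).
  rewrite big_nat [leRHS]big_nat; apply: ler_sum => c /andP[Nc _].
  by apply: hu; apply: leq_trans Nc.
rewrite -mulr_sumr; apply: (@le_trans _ _ (M * (e / (M + 1)))); first by rewrite ler_wpM2l.
rewrite mulrA ler_pdivrMr; last by lra.
by rewrite mulrC ler_wpM2l //; lra.
Qed.

Lemma poincare_tail_cvg z : 0 < complex.Im z ->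
  ccvg (fun n => \sum_(1 <= c < n.+1) lc z c) (poincare_tail z).
Proof.
move=> y0; apply: (series_cvg (M := Cest m (complex.Im z) * ((complex.Im z)^-1 + 4))).
  by have := Cest_ge0 m y0; move=> ?; nneg.
by move=> c c0; exact: nm_lc.
Qed.

Lemma cusp_const_cvg : ccvg (fun n => \sum_(1 <= c < n.+1) row_const c) cusp_const.
Proof.
apply: (series_cvg (M := Cest m 1 * 4)).
  by have := Cest_ge0 m (ltr01 : 0 < 1 :> R); move=> ?; nneg.
move=> c c0; rewrite /row_const nmM nm_real ger0_norm ?pi_ge0 // mulrAC.
by rewrite ler_pM ?nm_ge0 ?pi_ge0 ?pi_le4 ?nm_Vconst ?row_scale_gt0.
Qed.


Lemma poincare_tail_tail z (eta e : R) N : 0 < eta -> eta <= complex.Im z ->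
  (forall k, \sum_(N.+1 <= c < k) Dc R c <= e) ->
  nm (poincare_tail z - \sum_(1 <= c < N.+1) lc z c) <= Cest m eta * (eta^-1 + 4) * e.
Proof.
move=> e0 ey hN; have y0 : 0 < complex.Im z by lra.
have C0 := Cest_ge0 m e0; have M0 : 0 <= Cest m eta * (eta^-1 + 4) by nneg.
have hG : ccvg (fun n => \sum_(1 <= c < n.+1) lc z c + (- \sum_(1 <= c < N.+1) lc z c))
    (poincare_tail z + (- \sum_(1 <= c < N.+1) lc z c)).
  by apply: ccvgD; [exact: poincare_tail_cvg | exact: ccvg_cst].
apply: (ccvg_le (N := N) hG) => n Nn.
rewrite (big_cat_nat _ (n := N.+1)) //= addrAC subrr add0r.
apply: (le_trans (nm_sum _ _ _)).
apply: (@le_trans _ _ (\sum_(N.+1 <= c < n.+1) Cest m eta * (eta^-1 + 4) * Dc R c)).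
  rewrite big_nat [leRHS]big_nat; apply: ler_sum => c /andP[Nc _].
  by apply: nm_lc => //; apply: leq_trans Nc.
by rewrite -mulr_sumr ler_wpM2l.
Qed.

Lemma nm_poincare_tail z (eta : R) : 0 < eta -> eta <= complex.Im z ->
  nm (poincare_tail z) <= Cest m eta * (eta^-1 + 4) * 81.
Proof.
move=> e0 ey; have := @poincare_tail_tail z eta 81 0 e0 ey.
by rewrite big_geq // subr0; apply => k; exact: sum_Dc_le.
Qed.

Lemma poincare_tail_cusp z : 1 <= complex.Im z -> nm (poincare_tail z - cusp_const) <= Cest m 1 * 81 / complex.Im z.
Proof.
move=> y1; have y0 : 0 < complex.Im z by lra.
have C0 := Cest_ge0 m (ltr01 : 0 < 1 :> R).
have h : ccvg (fun n => \sum_(1 <= c < n.+1) lc z c + (- 1) * \sum_(1 <= c < n.+1) row_const c)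
    (poincare_tail z + (- 1) * cusp_const).
  by apply: ccvgD; [exact: poincare_tail_cvg | apply: ccvgZ; exact: cusp_const_cvg].
rewrite -[- cusp_const]mulN1r; apply: (ccvg_le (N := 0) h) => n _.
rewrite mulN1r -sumrB; apply: (le_trans (nm_sum _ _ _)).
apply: (@le_trans _ _ (\sum_(1 <= c < n.+1) Cest m 1 / complex.Im z * Dc R c)).
  rewrite big_nat [leRHS]big_nat; apply: ler_sum => c /andP[c0 _].
  by apply: (le_trans (lc_row_const c0 (ltr01 : 0 < 1 :> R) y1)); rewrite mulrAC.
rewrite -mulr_sumr [leRHS]mulrAC; apply: ler_wpM2l (sum_Dc_le _ _).
by rewrite divr_ge0 // ltW.
Qed.

(** Tannery's theorem with varying intervals. Only the rows with c <= N0 have to cover [-T, T); all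
    others are controlled by the majorant [Dc] alone. This is what makes the truncation by height
    converge. *)
Lemma poincare_tail_tannery z (e : R) : 0 < complex.Im z -> 0 < e ->
  exists N0 T : nat, forall N (A : nat -> int) (L : nat -> nat), (N0 <= N)%N ->
    (forall c, (0 < c <= N0)%N -> A c <= - T%:Z /\ T%:Z <= A c + (L c)%:Z) ->
    nm (\sum_(1 <= c < N.+1) row_sum z c (A c) (L c) - poincare_tail z) <= e.
Proof.
move=> y0 e0; set y := complex.Im z in y0.
have C0 := Cest_ge0 m y0; set M := Cest m y * (y^-1 + 4).
have M0 : 0 <= M by rewrite /M; nneg.
have [N0 hN0] := @Dc_tail R (e / (3 * (M + 1))) ltac:(rewrite divr_gt0 //; lra).
have MDe : M * (e / (3 * (M + 1))) <= e / 3.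
  rewrite mulrA ler_pdivrMr; last by lra.
  have -> : e / 3 * (3 * (M + 1)) = (M + 1) * e by field.
  by rewrite ler_wpM2r ?ltW //; lra.
have [T hT] : exists T, forall c (A : int) L, (0 < c <= N0)%N ->
    A <= - T%:Z -> T%:Z <= A + L%:Z -> nm (row_sum z c A L - lc z c) <= e / 3 / (N0.+1)%:R.
  have hz := uhp_in_box y0.
  have e'0 : 0 < e / 3 / (N0.+1)%:R by rewrite !divr_gt0.
  have pt c : exists T, forall n, (T <= n)%N -> c%:R * `|complex.Re z| + 1 < n%:R /\
      4 * Ctail c y y / (n%:R - (c%:R * `|complex.Re z| + 1)) <= e / 3 / (N0.+1)%:R.
    by apply: inv_small => //; rewrite mulr_ge0 // Ctail_ge0 // ltW.
  have [f hf] := choice pt.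
  exists (\max_(c < N0.+1) f c)%N => c A L /andP[c0 cN] hA hL.
  set T := (\max_(c < N0.+1) f c)%N in hA hL.
  have fT : (f c <= T)%N.
    by have := @leq_bigmax _ (fun c : 'I_N0.+1 => f c) (Ordinal (cN : (c < N0.+1)%N)).
  have [h1 h2] := hf c T fT.
  apply: le_trans (row_sum_lc c0 hz h1 hA hL) _.
  by move: h2; rewrite opprD addrA.
exists N0, T => N A L NN hAL.
have -> : \sum_(1 <= c < N.+1) row_sum z c (A c) (L c) - poincare_tail z =
  \sum_(1 <= c < N0.+1) (row_sum z c (A c) (L c) - lc z c) +
  \sum_(N0.+1 <= c < N.+1) row_sum z c (A c) (L c) -
  (poincare_tail z - \sum_(1 <= c < N0.+1) lc z c).
  by rewrite sumrB (big_cat_nat _ (n := N0.+1)) //=; ring.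
have -> : e = e / 3 + e / 3 + e / 3 by field.
apply: (le_trans (nmB _ _)); apply: lerD; last first.
  apply: (le_trans (@poincare_tail_tail z y (e / (3 * (M + 1))) N0 y0 (lexx _) hN0)); exact: MDe.
apply: (le_trans (nmD _ _)); apply: lerD.
  apply: (le_trans (nm_sum _ _ _)).
  apply: (@le_trans _ _ (\sum_(1 <= c < N0.+1) e / 3 / N0.+1%:R)).
    rewrite big_nat [leRHS]big_nat; apply: ler_sum => c hc.
    by have [h1 h2] := hAL c hc; exact: hT.
  rewrite big_const_nat iter_addr_0 subSS subn0 -[_ *+ N0]mulr_natr -[leLHS]mulrA.
  apply: ler_piMr; first by rewrite divr_ge0 // ltW.
  by rewrite mulrC ler_pdivrMr ?ltr0n // mul1r ler_nat.
apply: le_trans MDe; apply: (le_trans (nm_sum _ _ _)).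
apply: (@le_trans _ _ (\sum_(N0.+1 <= c < N.+1) M * Dc R c)).
  rewrite big_nat [leRHS]big_nat; apply: ler_sum => c /andP[Nc _].
  by apply: nm_row_sum => //; apply: leq_trans Nc.
by rewrite -mulr_sumr ler_wpM2l.
Qed.

End LimitFunctions.

(** * Approximately harmonic functions *)

Section PolynomialApproximation.
Variable R : realType.
Implicit Types (z w s : R[i]) (G H psi : R[i] -> R[i]) (P Q : {poly R[i]}).

Variables (z0 : R[i]) (r : R).
Hypothesis r0 : 0 <= r.

(** Takes the place of holomorphy on the closed disc, with polynomials in z - z0. It is stable under
    sums, products, exponentials and uniform limits. *)
Definition poly_approx G := forall e : R, 0 < e ->
  exists P, forall w, nm w <= r -> nm (G (z0 + w) - P.[w]) <= e.

Lemma nm_horner P w : nm w <= r -> nm P.[w] <= \sum_(i < size P) nm P`_i * r ^+ i.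
Proof.
move=> hw; rewrite horner_coef; apply: (le_trans (nm_sum _ _ _)).
apply: ler_sum => i _; rewrite nmM nmX ler_wpM2l ?nm_ge0 //.
by rewrite lerXn2r ?nnegrE ?nm_ge0.
Qed.

Lemma poly_approx_bounded G : poly_approx G -> exists2 M : R, 0 <= M & forall w, nm w <= r -> nm (G (z0 + w)) <= M.
Proof.
move=> /(_ 1 ltr01) [P hP]; exists (1 + \sum_(i < size P) nm P`_i * r ^+ i).
  by rewrite addr_ge0 // sumr_ge0 // => i _; rewrite mulr_ge0 ?nm_ge0 ?exprn_ge0.
move=> w hw; have -> : G (z0 + w) = (G (z0 + w) - P.[w]) + P.[w] by rewrite subrK.
by apply: (le_trans (nmD _ _)); rewrite lerD ?hP ?nm_horner.
Qed.

Lemma poly_approx_cst s : poly_approx (fun=> s).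
Proof. by move=> e e0; exists s%:P => w _; rewrite hornerC subrr nm0 ltW. Qed.

Lemma poly_approx_id : poly_approx id.
Proof.
move=> e e0; exists ('X + z0%:P) => w _.
by rewrite hornerD hornerX hornerC [w + z0]addrC subrr nm0 ltW.
Qed.

Lemma poly_approx_add G H : poly_approx G -> poly_approx H -> poly_approx (fun z => G z + H z).
Proof.
move=> hG hH e e0.
have [P hP] := hG (e / 2) ltac:(lra); have [Q hQ] := hH (e / 2) ltac:(lra).
exists (P + Q) => w hw; rewrite hornerD.
have -> : G (z0 + w) + H (z0 + w) - (P.[w] + Q.[w]) = (G (z0 + w) - P.[w]) + (H (z0 + w) - Q.[w]).
  by ring.
by apply: (le_trans (nmD _ _)); have := hP w hw; have := hQ w hw; lra.
Qed.

Lemma poly_approx_mul G H : poly_approx G -> poly_approx H -> poly_approx (fun z => G z * H z).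
Proof.
move=> hG hH e e0.
have [M M0 hM] := poly_approx_bounded hG; have [M' M'0 hM'] := poly_approx_bounded hH.
pose d := Num.min 1 (e / (M + M' + 1)).
have d0 : 0 < d by rewrite lt_min ltr01 divr_gt0 //; lra.
have d1 : d <= 1 by rewrite ge_min lexx.
have de : d * (M + M' + 1) <= e by rewrite -ler_pdivlMr ?ge_min ?lexx ?orbT //; lra.
have [P hP] := hG d d0; have [Q hQ] := hH d d0.
exists (P * Q) => w hw; rewrite hornerM.
have -> : G (z0 + w) * H (z0 + w) - P.[w] * Q.[w] =
   (G (z0 + w) - P.[w]) * H (z0 + w) + (P.[w] - G (z0 + w) + G (z0 + w)) * (H (z0 + w) - Q.[w]).
  by ring.
apply: (le_trans (nmD _ _)); rewrite !nmM.
have a1 := hP w hw; have a2 := hQ w hw; have a3 := hM w hw; have a4 := hM' w hw.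
have a5 : nm (P.[w] - G (z0 + w) + G (z0 + w)) <= d + M.
  by apply: (le_trans (nmD _ _)); rewrite nm_distC lerD.
have b1 : nm (G (z0 + w) - P.[w]) * nm (H (z0 + w)) <= d * M' by rewrite ler_pM ?nm_ge0.
have b2 : nm (P.[w] - G (z0 + w) + G (z0 + w)) * nm (H (z0 + w) - Q.[w]) <= (d + M) * d.
  by rewrite ler_pM ?nm_ge0.
nra.
Qed.

Lemma poly_approx_exp G n : poly_approx G -> poly_approx (fun z => G z ^+ n).
Proof.
move=> hG; elim: n => [|n IH].
  by move=> e e0; have [P hP] := poly_approx_cst 1 e0; exists P => w /hP; rewrite expr0.
move=> e e0; have [P hP] := poly_approx_mul hG IH e0; exists P => w /hP.
by rewrite exprS.
Qed.

Lemma poly_approx_unif G : (forall e : R, 0 < e -> exists2 H, poly_approx H &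
   forall w, nm w <= r -> nm (G (z0 + w) - H (z0 + w)) <= e) -> poly_approx G.
Proof.
move=> h e e0; have [H hH hG] := h (e / 2) ltac:(lra).
have [P hP] := hH (e / 2) ltac:(lra); exists P => w hw.
apply: (le_trans (nm_triangle _ (H (z0 + w)) _)).
by have := hG w hw; have := hP w hw; lra.
Qed.

Lemma nm_subX (a b : R[i]) (M : R) n : nm a <= M -> nm b <= M ->
  nm (a ^+ n - b ^+ n) <= n%:R * M ^+ n.-1 * nm (a - b).
Proof.
move=> ha hb; have M0 : 0 <= M := le_trans (nm_ge0 _) ha.
rewrite subrXX nmM mulrC ler_wpM2r ?nm_ge0 //; apply: (le_trans (nm_sum _ _ _)).
apply: (@le_trans _ _ (\sum_(i < n) M ^+ n.-1)); last first.
  by rewrite sumr_const card_ord mulr_natl.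
apply: ler_sum => i _; rewrite nmM !nmX.
have -> : M ^+ n.-1 = M ^+ (n.-1 - i) * M ^+ i.
  by rewrite -exprD subnK //; have := ltn_ord i; lia.
by rewrite ler_pM ?exprn_ge0 ?nm_ge0 // lerXn2r ?nnegrE ?nm_ge0.
Qed.

(** Both sides are n-th powers. Their bases exp(g/n) and 1 + g/n differ by O(n^-2) and have modulus
    at most exp(M/n). This turns the exponential of an approximable function into a uniform limit of
    polynomials in it. *)
Lemma cexp_limit (g : R[i]) (M : R) (n : nat) : 0 <= M -> nm g <= M -> 2 * M + 1 <= n%:R ->
  nm (cexp g - (1 + g / n%:R) ^+ n) <= 4 * M ^+ 2 * expR M / n%:R.
Proof.
move=> M0 gM hn; have n0 : (0 : R) < n%:R by lra.
have nn0 : (n%:R : R[i]) != 0 by rewrite pnatr_eq0 -lt0n -(ltr0n R).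
have gn : nm (g / n%:R) <= M / n%:R by rewrite nmM nmV nm_nat ler_wpM2r // invr_ge0 ltW.
have Mn : M / n%:R <= 1 / 2 by rewrite ler_pdivrMr //; lra.
have -> : cexp g = cexp (g / n%:R) ^+ n by rewrite -cexpMn mulrC divfK.
have ha : nm (cexp (g / n%:R)) <= expR (M / n%:R).
  by rewrite (le_trans (nm_cexp_le _)) // ler_expR.
have hb : nm (1 + g / n%:R) <= expR (M / n%:R).
  apply: (le_trans (nmD _ _)); rewrite nm1; apply: le_trans (expR_ge1Dx _).
  by rewrite lerD2l.
apply: (le_trans (nm_subX n ha hb)).
have h1 : nm (cexp (g / n%:R) - (1 + g / n%:R)) <= 4 * (M / n%:R) ^+ 2.
  rewrite opprD addrA; apply: (le_trans (cexp_quad_small (le_trans gn Mn))).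
  by rewrite ler_wpM2l // lerXn2r ?nnegrE ?nm_ge0 // divr_ge0 // ltW.
have h2 : expR (M / n%:R) ^+ n.-1 <= expR M.
  rewrite -expRM_natl ler_expR mulrCA ler_piMr // ler_pdivrMr // mul1r ler_nat leq_pred //.
apply: (@le_trans _ _ (n%:R * expR M * (4 * (M / n%:R) ^+ 2))).
  apply: ler_pM => //; rewrite ?nm_ge0 ?mulr_ge0 ?exprn_ge0 ?expR_ge0 ?ler0n //.
  by rewrite ler_wpM2l ?ler0n.
by rewrite le_eqVlt; apply/orP; left; apply/eqP; field; rewrite gt_eqF.
Qed.

Lemma poly_approx_cexp G : poly_approx G -> poly_approx (fun z => cexp (G z)).
Proof.
move=> hG; apply: poly_approx_unif => e e0; have [M M0 hM] := poly_approx_bounded hG.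
pose K := 4 * M ^+ 2 * expR M; have K0 : 0 <= K by rewrite /K; nneg.
pose n := Num.bound (2 * M + 1 + K / e).
have hn : 2 * M + 1 + K / e < n%:R.
  by apply: archi_boundP; have := ltW e0; move=> ?; nneg.
have Ke : 0 <= K / e by rewrite divr_ge0 // ltW.
exists (fun z => (1 + G z / n%:R) ^+ n).
  apply: poly_approx_exp; apply: poly_approx_add; first exact: poly_approx_cst.
  by apply: poly_approx_mul => //; exact: poly_approx_cst.
move=> w hw; apply: (le_trans (cexp_limit M0 (hM w hw) _)); first lra.
rewrite -/K ler_pdivrMr; last by lra.
rewrite mulrC -ler_pdivrMr //; lra.
Qed.

Lemma expr_small (q e : R) : 0 <= q < 1 -> 0 < e -> exists n, q ^+ n <= e.
Proof.
move=> /andP[q0 q1] e0.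
have /cvgrPdist_le /(_ e e0) [n _ hn] : (q ^+ n) @[n --> \oo] --> (0 : R).
  by apply: cvg_expr; rewrite ger0_norm.
by exists n; have := hn n (leqnn n); rewrite /= sub0r normrN ger0_norm // exprn_ge0.
Qed.

(** A truncated geometric series about [z0], whose disc does not reach the pole [s]. *)
Lemma poly_approx_inv s : r < nm (z0 - s) -> poly_approx (fun z => (z - s)^-1).
Proof.
move=> hs e e0; set b := z0 - s in hs; have b0 : 0 < nm b := le_lt_trans r0 hs.
have bn : b != 0 by apply/eqP => h; rewrite h nm0 ltxx in b0.
have q01 : 0 <= r / nm b < 1 by rewrite divr_ge0 ?nm_ge0 //= ltr_pdivrMr // mul1r.
have [n hn] := expr_small q01 (mulr_gt0 e0 (ltac:(lra) : 0 < nm b - r)).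
exists (\sum_(k < n) ((-1) ^+ k * b^-1 ^+ k.+1) *: 'X^k) => w hw.
have bw : nm b - r <= nm (b + w).
  by have := nm_lerB b (- w); rewrite opprK nmN; lra.
have bw0 : b + w != 0 by apply/eqP => h; rewrite h nm0 in bw; lra.
have -> : z0 + w - s = b + w by rewrite /b; ring.
have -> : (\sum_(k < n) ((-1) ^+ k * b^-1 ^+ k.+1) *: 'X^k).[w] =
    b^-1 * \sum_(k < n) (- w / b) ^+ k.
  rewrite horner_sum mulr_sumr; apply: eq_bigr => k _.
  rewrite hornerZ hornerXn (_ : - w / b = (-1) * (w * b^-1)); last by ring.
  by rewrite !exprMn exprS; ring.
have -> : (b + w)^-1 - b^-1 * \sum_(k < n) (- w / b) ^+ k = (- w / b) ^+ n / (b + w).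
  apply: (@mulIf _ (b + w)) => //; rewrite mulrBl mulVf // divfK //.
  have -> : b^-1 * (\sum_(k < n) (- w / b) ^+ k) * (b + w) =
     - ((- w / b - 1) * \sum_(k < n) (- w / b) ^+ k) by field.
  by rewrite -subrX1; ring.
rewrite nmM nmV nmX nmM nmV nmN ler_pdivrMr ?nm_gt0 //.
apply: (@le_trans _ _ (e * (nm b - r))); last by rewrite ler_wpM2l // ltW.
apply: le_trans hn; rewrite lerXn2r ?nnegrE ?divr_ge0 ?nm_ge0 //.
by rewrite ler_wpM2r // invr_ge0 nm_ge0.
Qed.

(* Stands in for harmonicity of [psi] on the closed disc. *)
Definition harm_approx psi := forall e : R, 0 < e -> exists P Q,
  forall w, nm w <= r -> nm (psi (z0 + w) - (P.[w] + conjc Q.[w])) <= e.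

Lemma harm_approx_poly_approx G : poly_approx G -> harm_approx G.
Proof.
move=> h e e0; have [P hP] := h e e0; exists P, 0 => w hw.
by rewrite horner0 conjc0 addr0 hP.
Qed.

Lemma harm_approx_conj G : poly_approx G -> harm_approx (fun z => conjc (G z)).
Proof.
move=> h e e0; have [P hP] := h e e0; exists 0, P => w hw.
rewrite horner0 add0r -[conjc _ - _]/(conjc _ + - conjc _).
have -> : conjc (G (z0 + w)) - conjc P.[w] = conjc (G (z0 + w) - P.[w]).
  by case: (G _) => a b; case: (P.[w]) => a' b'; apply: complex_eq => /=; ring.
by rewrite nm_conj hP.
Qed.

Lemma harm_approx_add f g : harm_approx f -> harm_approx g -> harm_approx (fun z => f z + g z).
Proof.
move=> hf hg e e0.
have [P [Q h1]] := hf (e / 2) ltac:(lra); have [P' [Q' h2]] := hg (e / 2) ltac:(lra).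
exists (P + P'), (Q + Q') => w hw; rewrite !hornerD.
have -> : conjc (Q.[w] + Q'.[w]) = conjc Q.[w] + conjc Q'.[w].
  by case: (Q.[w]) => a b; case: (Q'.[w]) => a' b'; apply: complex_eq => /=; ring.
set x := f _; set y := g _.
have -> : x + y - (P.[w] + P'.[w] + (conjc Q.[w] + conjc Q'.[w])) =
   (x - (P.[w] + conjc Q.[w])) + (y - (P'.[w] + conjc Q'.[w])) by ring.
by apply: (le_trans (nmD _ _)); have := h1 w hw; have := h2 w hw; rewrite /x /y; lra.
Qed.

Lemma harm_approx_scale k f : harm_approx f -> harm_approx (fun z => k * f z).
Proof.
move=> hf e e0; have k0 : 0 < nm k + 1 by rewrite ltr_wpDl ?nm_ge0.
have [P [Q h1]] := hf (e / (nm k + 1)) ltac:(exact: divr_gt0).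
exists (k *: P), (conjc k *: Q) => w hw; rewrite !hornerZ.
have -> : conjc (conjc k * Q.[w]) = k * conjc Q.[w].
  by case: (Q.[w]) => a b; case: (k) => a' b'; apply: complex_eq => /=; ring.
rewrite -mulrDr -mulrBr nmM.
apply: (@le_trans _ _ ((nm k + 1) * (e / (nm k + 1)))).
  by apply: ler_pM; rewrite ?nm_ge0 ?h1 //; lra.
by rewrite mulrCA divff ?mulr1 // gt_eqF.
Qed.

Lemma harm_approx_sum (I : Type) (s : seq I) (B : pred I) (f : I -> R[i] -> R[i]) :
  (forall i, B i -> harm_approx (f i)) -> harm_approx (fun z => \sum_(i <- s | B i) f i z).
Proof.
move=> h; elim: s => [|i s IH].
  move=> e e0; exists 0, 0 => w _.
  by rewrite big_nil !horner0 conjc0 addr0 subrr nm0 ltW.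
move=> e e0; case Bi : (B i).
  have [P [Q hPQ]] := harm_approx_add (h i Bi) IH e0; exists P, Q => w /hPQ.
  by rewrite big_cons Bi.
by have [P [Q hPQ]] := IH e e0; exists P, Q => w /hPQ; rewrite big_cons Bi.
Qed.

Lemma harm_approx_unif f : (forall e : R, 0 < e -> exists2 g, harm_approx g &
   forall w, nm w <= r -> nm (f (z0 + w) - g (z0 + w)) <= e) -> harm_approx f.
Proof.
move=> h e e0; have [g hg hfg] := h (e / 2) ltac:(lra).
have [P [Q hP]] := hg (e / 2) ltac:(lra); exists P, Q => w hw.
apply: (le_trans (nm_triangle _ (g (z0 + w)) _)).
by have := hfg w hw; have := hP w hw; lra.
Qed.

End PolynomialApproximation.

(** * Harnack's inequality and a Liouville theorem *)

Section Harnack.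
Variable R : realType.
Implicit Types (q : {poly R[i]}) (w z : R[i]).

Lemma dvdz_sub_small (n a b : nat) : (a < n)%N -> (b < n)%N ->
  (n%:Z %| a%:Z - b%:Z)%Z -> a = b.
Proof.
move=> an bn; rewrite -eqz_mod_dvd !modz_nat eqz_nat !modn_small //.
by move/eqP.
Qed.

(* Averaging over roots of unity gives the coefficient bound
   [|q_k| r^k <= 2 Re q_0]. *)
Lemma poly_harnack q (r : R) : 0 < r ->
  (forall w, nm w <= r -> 0 <= complex.Re q.[w]) ->
  forall w, nm w <= r / 2 -> complex.Re q.[w] <= 3 * complex.Re q.[0].
Proof.
(* With more than twice as many nodes as coefficients, the frequencies l - k and -(l + k) are
   divisible by n only when they are 0. *)
move=> r0 hq w hw; pose n := (2 * size q).+1.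
have n0 : (0 < n)%N by [].
have nR : (0 : R) < n%:R by rewrite ltr0n.
pose x j := r%:C * ee (j%:R / n%:R) : R[i].
have nx j : nm (x j) <= r by rewrite nmM nm_real nm_ee mulr1 gtr0_norm.
pose v j := complex.Re q.[x j].
have v0 j : 0 <= v j by apply: hq.
have vE j : (v j)%:C = (q.[x j] + conjc q.[x j]) / 2.
  by rewrite /v; case: (q.[x j]) => a b; apply: complex_eq => /=; field.
have qE j : q.[x j] = \sum_(l < size q) q`_l * r%:C ^+ l * ee (l%:R * j%:R / n%:R).
  rewrite horner_coef; apply: eq_bigr => l _; rewrite exprMn -eeMn -mulrA; congr (_ * (_ * ee _)).
  by rewrite mulrA.
have cqE j : conjc q.[x j] = \sum_(l < size q) conjc q`_l * r%:C ^+ l * ee (- (l%:R * j%:R / n%:R)).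
  rewrite qE conj_sum; apply: eq_bigr => l _.
  have cM (a b : R[i]) : conjc (a * b) = conjc a * conjc b by exact: rmorphM.
  by rewrite cM cM ee_conj -(rmorphXn (real_complex R)) conjc_real.
(* The discrete Fourier coefficients of Re q on the circle. The conjugate part contributes only at
   frequency 0. *)
have key (k : nat) : (k < size q)%N -> \sum_(0 <= j < n) (v j)%:C * ee (- (k%:R * j%:R / n%:R)) =
    n%:R * ((q`_k + (if k == 0%N then conjc q`_k else 0)) * r%:C ^+ k / 2).
  move=> ks.
  have S1 : \sum_(0 <= j < n) q.[x j] * ee (- (k%:R * j%:R / n%:R)) = n%:R * (q`_k * r%:C ^+ k).
    under eq_bigr => j _ do rewrite qE mulr_suml.
    rewrite exchange_big /= (bigD1 (Ordinal ks)) //= [X in _ + X]big1 ?addr0 => [|l lk].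
      under eq_bigr => j _ do rewrite -mulrA -eeD subrr ee0 mulr1.
      by rewrite big_const_nat iter_addr_0 subn0 mulr_natl.
    have E j : q`_l * r%:C ^+ l * ee (l%:R * j%:R / n%:R) * ee (- (k%:R * j%:R / n%:R)) =
       q`_l * r%:C ^+ l * ee ((l%:Z - k%:Z)%:~R * j%:R / n%:R).
      by rewrite -mulrA -eeD; congr (_ * ee _); rewrite intrB -!pmulrn; ring.
    under eq_bigr => j _ do rewrite E.
    rewrite -mulr_sumr sum_ee_full //; case: ifP; rewrite ?mulr0 // => dv.
    have ln : (l < n)%N by rewrite /n ltnS (leq_trans (ltnW (ltn_ord l))) // leq_pmull.
    have kn : (k < n)%N by rewrite /n ltnS (leq_trans (ltnW ks)) // leq_pmull.
    by case/eqP: lk; apply: val_inj; exact: dvdz_sub_small ln kn dv.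
  have S2 : \sum_(0 <= j < n) conjc q.[x j] * ee (- (k%:R * j%:R / n%:R)) =
      if k == 0%N then n%:R * (conjc q`_k * r%:C ^+ k) else 0.
    under eq_bigr => j _ do rewrite cqE mulr_suml.
    rewrite exchange_big /=.
    have E (l : nat) j : conjc q`_l * r%:C ^+ l * ee (- (l%:R * j%:R / n%:R)) * ee (- (k%:R * j%:R / n%:R)) =
       conjc q`_l * r%:C ^+ l * ee ((- (l%:Z + k%:Z))%:~R * j%:R / n%:R).
      by rewrite -mulrA -eeD; congr (_ * ee _); rewrite mulrNz intrD -!pmulrn; ring.
    under eq_bigr => l _.
      under eq_bigr => j _ do rewrite E.
      rewrite -mulr_sumr sum_ee_full //.
      over.
    have dv (l : 'I_(size q)) : (n%:Z %| - (l%:Z + k%:Z))%Z = (l == 0%N :> nat) && (k == 0%N).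
      have lq := ltn_ord l.
      change ((n %| `|(- (l%:Z + k%:Z))%R|)%N = (l == 0%N :> nat) && (k == 0%N)).
      rewrite abszN -PoszD absz_nat.
      rewrite -addn_eq0; have [h|h] := posnP (l + k)%N; first by rewrite h dvdn0.
      by rewrite gtnNdvd ?(gtn_eqF h) // /n mul2n -addnn ltnS leq_add // ltnW.
    under eq_bigr => l _ do rewrite dv.
    case: (eqVneq k 0%N) => [k0|kn0]; last first.
      by rewrite big1 // => l _; rewrite andbF mulr0.
    rewrite (bigD1 (Ordinal ks)) //= [X in _ + X]big1 ?addr0.
      by rewrite [X in if X then _ else _](_ : _ = true) 1?mulrC // k0.
    move=> l lk; case: ifP; rewrite ?mulr0 // => /andP[/eqP l0 _].
    by case/eqP: lk; apply: val_inj; rewrite /= l0 k0.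
  under eq_bigr => j _ do rewrite vE mulrAC mulrDl.
  by rewrite -mulr_suml big_split /= S1 S2; case: ifP => _; field.
have c0 : \sum_(0 <= j < n) v j = n%:R * complex.Re q.[0].
  have [sq|sq] := posnP (size q).
    have qz : q = 0 by apply/eqP; rewrite -size_poly_eq0 sq.
    by rewrite qz horner0 /= mulr0 big1 // => j _; rewrite /v qz horner0.
  have := key 0%N sq; under eq_bigr => j _ do rewrite !mul0r oppr0 ee0 mulr1.
  rewrite expr0 mulr1 horner_coef0 => h; apply: (@complexI R).
  rewrite (rmorph_sum (real_complex R)) h (rmorphM (real_complex R)) rmorph_nat; congr (_ * _).
  by case: (q`_0) => a b; apply: complex_eq => /=; field.
have q0 : 0 <= complex.Re q.[0] by apply: hq; rewrite nm0 ltW.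
have ck (k : nat) : (0 < k < size q)%N -> nm q`_k * r ^+ k <= 2 * complex.Re q.[0].
  move=> /andP[k0 ks]; have := key k ks; rewrite (gtn_eqF k0) addr0.
  move/(congr1 (@nm R)) => h.
  have : nm (\sum_(0 <= j < n) (v j)%:C * ee (- (k%:R * j%:R / n%:R))) <= n%:R * complex.Re q.[0].
    rewrite -c0; apply: (le_trans (nm_sum _ _ _)); apply: ler_sum => j _.
    by rewrite nmM nm_ee mulr1 nm_real ger0_norm.
  rewrite h !nmM nm_nat ler_pM2l // nmX nm_real (gtr0_norm r0) nmV nm_nat; lra.
rewrite horner_coef.
have [sq|sq] := posnP (size q).
  by rewrite sq big_ord0 /= mulr_ge0.
have bnd : forall k, (0 < k < size q)%N -> nm (q`_k * w ^+ k) <= 2 * complex.Re q.[0] * 2^-1 ^+ k.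
  move=> k hk; rewrite nmM nmX.
  apply: (@le_trans _ _ (nm q`_k * (r / 2) ^+ k)).
    by rewrite ler_wpM2l ?nm_ge0 // lerXn2r ?nnegrE ?nm_ge0 // divr_ge0 // ltW.
  by rewrite exprMn mulrA ler_wpM2r ?exprn_ge0 ?invr_ge0 // ck.
rewrite -(big_mkord xpredT (fun k => q`_k * w ^+ k)) big_ltn // expr0 mulr1 ReD -horner_coef0.
(* As |w| <= r / 2, the terms of positive degree add at most 2 Re q(0) times this sum, whence 3 = 1
   + 2. *)
have geo : \sum_(1 <= k < size q) (2^-1 : R) ^+ k <= 1.
  have H k : \sum_(1 <= i < k.+1) (2^-1 : R) ^+ i = 1 - 2^-1 ^+ k.
    elim: k => [|k IH]; first by rewrite big_geq // expr0 subrr.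
    by rewrite big_nat_recr //= IH exprS; field.
  by case: (size q) sq => // k _; rewrite H gerBl exprn_ge0 // invr_ge0.
have : complex.Re (\sum_(1 <= k < size q) q`_k * w ^+ k) <= 2 * complex.Re q.[0] * 1.
  apply: (le_trans (le_trans (ler_norm _) (nm_Re _))); apply: (le_trans (nm_sum _ _ _)).
  apply: (@le_trans _ _ (\sum_(1 <= k < size q) 2 * complex.Re q.[0] * 2^-1 ^+ k)).
    by rewrite big_nat [leRHS]big_nat; apply: ler_sum => k hk; exact: bnd.
  by rewrite -mulr_sumr ler_wpM2l // mulr_ge0.
lra.
Qed.

Lemma harnack (psi : R[i] -> R[i]) (S : R) z0 (r : R) : 0 < r -> harm_approx z0 r psi ->
  (forall w, nm w <= r -> complex.Re (psi (z0 + w)) <= S) ->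
  forall w, nm w <= r / 2 ->
   S - complex.Re (psi (z0 + w)) <= 3 * (S - complex.Re (psi z0)).
Proof.
move=> r0 hpsi hS w hw; apply/ler_addgt0Pr => e e0.
have [P [Q hPQ]] := hpsi (e / 10) ltac:(lra).
(* Since P + conj Q and P + Q have the same real part, a polynomial can stand for the harmonic
   approximant. The shift by [e / 10] keeps its real part nonnegative. *)
pose q : {poly R[i]} := (S + e / 10)%:C%:P - (P + Q).
have Rq x : complex.Re q.[x] = S + e / 10 - complex.Re (P.[x] + conjc Q.[x]).
  rewrite /q hornerD hornerN hornerD hornerC ReD ReN /= !ReD.
  by case: (Q.[x]).
have app x : nm x <= r -> `|complex.Re (psi (z0 + x)) - complex.Re (P.[x] + conjc Q.[x])| <= e / 10.
  by move=> hx; rewrite -ReN -ReD (le_trans (nm_Re _)) // hPQ.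
have q0 x : nm x <= r -> 0 <= complex.Re q.[x].
  move=> hx; rewrite Rq; have := app x hx; have := hS x hx.
  by rewrite ler_norml => h1 /andP[h2 h3]; lra.
have wr : nm w <= r by lra.
have n0r : nm (0 : R[i]) <= r by rewrite nm0 ltW.
have := poly_harnack r0 q0 hw; rewrite !Rq.
have := app w wr; have := app 0 n0r; rewrite addr0 !ler_norml.
by move=> /andP[h1 h2] /andP[h3 h4]; lra.
Qed.

(** A quantitative maximum principle. First fix the number k of steps that lead from height eta to
    height Y, then choose a point where psi is within d / (2 * 3^k) of its supremum. Each Harnack
    step upwards multiplies the height by 7/5 and the gap by at most 3, so the gap is still at most
    d / 2 at height Y, where psi is close to l. *)
Lemma harmonic_upper_bound (psi : R[i] -> R[i]) (l : R[i]) (eta M : R) :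
  (forall z0 r, 0 < r -> r < complex.Im z0 -> harm_approx z0 r psi) ->
  0 < eta ->
  (forall z, 0 < complex.Im z -> exists2 z', eta <= complex.Im z' & psi z' = psi z) ->
  (forall z, eta <= complex.Im z -> nm (psi z) <= M) ->
  (forall e : R, 0 < e -> exists Y, forall z, Y <= complex.Im z -> nm (psi z - l) <= e) ->
  forall z, 0 < complex.Im z -> complex.Re (psi z) <= complex.Re l.
Proof.
move=> hH e0 hI hB hL.
pose E := [set x : R | exists2 z, 0 < complex.Im z & x = complex.Re (psi z)].
have ubE : ubound E M.
  move=> _ [z z0 ->]; have [z' hz' <-] := hI z z0.
  by rewrite (le_trans (ler_norm _)) // (le_trans (nm_Re _)) // hB.
have supE : has_sup E.
  by split; [exists (complex.Re (psi 'i)); exists 'i => //=; exact: ltr01 | exists M].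
set S := sup E.
have leS z : 0 < complex.Im z -> complex.Re (psi z) <= S.
  by move=> z0; apply: sup_upper_bound => //; exists z.
suff SL : S <= complex.Re l by move=> z z0; exact: le_trans (leS z z0) SL.
apply/ler_addgt0Pr => d d0.
have [Y hY] := hL (d / 2) ltac:(lra).
have [k hk] : exists k, Y <= eta * (7 / 5) ^+ k.
  have [k hk] := @expr_small R (5 / 7) (eta / (`|Y| + 1)) ltac:(apply/andP; split; lra)
     ltac:(rewrite divr_gt0 // ltr_wpDl).
  exists k; have Y1 : 0 < `|Y| + 1 by rewrite ltr_wpDl.
  have p0 : 0 < (7 / 5 : R) ^+ k by rewrite exprn_gt0 //; lra.
  have inv : (5 / 7 : R) ^+ k * (7 / 5) ^+ k = 1.
    by rewrite -exprMn (_ : 5 / 7 * (7 / 5) = 1 :> R) ?expr1n //; field.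
  move: hk; rewrite ler_pdivlMr // => hk.
  have : (5 / 7) ^+ k * (`|Y| + 1) * (7 / 5) ^+ k <= eta * (7 / 5) ^+ k by rewrite ler_wpM2r // ltW.
  rewrite mulrAC inv mul1r; have := ler_norm Y; lra.
have p3 : 0 < (3 : R) ^+ k by rewrite exprn_gt0.
have dk : 0 < d / (2 * 3 ^+ k) by rewrite divr_gt0 // mulr_gt0.
have [_ [z z0 ->] hz] := sup_adherent dk supE; rewrite -/S in hz.
have [z' hz' E'] := hI z z0; rewrite -E' in hz.
have y0 : 0 < complex.Im z' by lra.
pose zj (j : nat) := complex.Re z' +i* (complex.Im z' * (7 / 5) ^+ j).
have step j : S - complex.Re (psi (zj j)) <= 3 ^+ j * (S - complex.Re (psi z')).
  elim: j => [|j IH].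
    rewrite expr0 mul1r /zj expr0 mulr1 le_eqVlt; apply/orP; left; apply/eqP.
    by case: (z').
  set yj := complex.Im z' * (7 / 5) ^+ j.
  have yj0 : 0 < yj by rewrite mulr_gt0 // exprn_gt0 //; lra.
  have -> : zj j.+1 = zj j + (0 +i* (2 / 5 * yj)).
    by rewrite /zj exprS; apply: complex_eq => /=; rewrite /yj; field.
  apply: (@le_trans _ _ (3 * (S - complex.Re (psi (zj j))))); last first.
    by rewrite exprS -mulrA ler_wpM2l.
  (* A disc of radius 4/5 of the height lies in the half plane; Harnack on the disc of half that
     radius allows a rise by 2/5 of the height. *)
  apply: (@harnack psi S (zj j) (4 / 5 * yj)); first by lra.
  - by apply: hH; rewrite ?/zj /=; rewrite -/yj; lra.
  - move=> w hw; apply: leS; rewrite ImD /zj /= -/yj.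
    by have := le_trans (nm_Im w) hw; rewrite ler_norml => /andP[]; lra.
  - apply: (le_trans (nm_le _)); rewrite /= normr0 add0r ger0_norm; lra.
have h1 := step k.
have Yk : Y <= complex.Im (zj k).
  by rewrite /zj /=; apply: (le_trans hk); rewrite ler_wpM2r // exprn_ge0 //; lra.
have h2 : complex.Re (psi (zj k)) <= complex.Re l + d / 2.
  have := le_trans (nm_Re _) (hY _ Yk); rewrite ReD ReN ler_norml => /andP[_]; lra.
have h3 : 3 ^+ k * (S - complex.Re (psi z')) <= d / 2.
  apply: (@le_trans _ _ (3 ^+ k * (d / (2 * 3 ^+ k)))).
    by rewrite ler_wpM2l ?(ltW p3) //; lra.
  by rewrite le_eqVlt; apply/orP; left; apply/eqP; field; rewrite gt_eqF.
lra.
Qed.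

(** The upper bound for k psi with k = 1, -1, i, -i gives both inequalities for the real and for the
    imaginary part. *)
Lemma harmonic_liouville (psi : R[i] -> R[i]) (l : R[i]) (eta M : R) :
  (forall z0 r, 0 < r -> r < complex.Im z0 -> harm_approx z0 r psi) ->
  0 < eta ->
  (forall z, 0 < complex.Im z -> exists2 z', eta <= complex.Im z' & psi z' = psi z) ->
  (forall z, eta <= complex.Im z -> nm (psi z) <= M) ->
  (forall e : R, 0 < e -> exists Y, forall z, Y <= complex.Im z -> nm (psi z - l) <= e) ->
  forall z, 0 < complex.Im z -> psi z = l.
Proof.
move=> hH e0 hI hB hL z z0.
have main (k : R[i]) : nm k = 1 -> complex.Re (k * psi z) <= complex.Re (k * l).
  move=> k1; apply: (@harmonic_upper_bound (fun z => k * psi z) (k * l) eta M) => //.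
  - by move=> z1 r r0 rz; apply: harm_approx_scale; exact: hH.
  - by move=> z1 /hI [z' h1 h2]; exists z' => //; rewrite h2.
  - by move=> z1 /hB; rewrite nmM k1 mul1r.
  - by move=> e /hL [Y hY]; exists Y => z1 /hY; rewrite -mulrBr nmM k1 mul1r.
have m1 := main 1 (nm1 R); have m2 := main (- 1) ltac:(by rewrite nmN nm1).
have m3 := main 'i (nm_i R); have m4 := main (- 'i) ltac:(by rewrite nmN nm_i).
move: m1 m2 m3 m4; case: (psi z) l {hL main} => [a b] [a' b'] /= m1 m2 m3 m4.
apply: complex_eq => /=; lra.
Qed.

End Harnack.

(** * The limit functions are approximately harmonic *)

Section HarmonicityF.
Variables (R : realType) (p m : nat).
Hypotheses (p0 : (0 < p)%N) (m0 : (0 < m)%N).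
Variables (z0 : R[i]) (r : R).
Hypotheses (r0 : 0 <= r) (rz : r < complex.Im z0).

Lemma poly_approx_ext (G H : R[i] -> R[i]) : (forall z, G z = H z) -> poly_approx z0 r G -> poly_approx z0 r H.
Proof. by move=> E hG e /hG [P hP]; exists P => w /hP; rewrite E. Qed.

Lemma harm_approx_ext (G H : R[i] -> R[i]) : (forall z, G z = H z) -> harm_approx z0 r G -> harm_approx z0 r H.
Proof. by move=> E hG e /hG [P [Q hP]]; exists P, Q => w /hP; rewrite E. Qed.

Lemma poly_approx_e2pi_lin (k : R[i]) : poly_approx z0 r (fun z => e2pi (k * z)).
Proof.
apply: poly_approx_cexp => //; apply: poly_approx_mul => //; first exact: poly_approx_cst.
by apply: poly_approx_mul => //; [exact: poly_approx_cst | exact: poly_approx_id].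
Qed.

Lemma harm_approx_e2pi_lin (k : R[i]) : harm_approx z0 r (fun z => e2pi (k * z)).
Proof. by apply: harm_approx_poly_approx; exact: poly_approx_e2pi_lin. Qed.

Lemma harm_approx_phi : harm_approx z0 r (phi m).
Proof.
apply: (@harm_approx_ext (fun z => e2pi (- m%:R * z) + (- 1) * conjc (e2pi (m%:R * z)))).
  move=> z; rewrite /phi mulNr mulN1r e2pi_conj; congr (_ - e2pi (- _)).
  by rewrite natC; case: z => a b; apply: complex_eq => /=; ring.
apply: harm_approx_add; first exact: harm_approx_e2pi_lin.
by apply: harm_approx_scale; apply: harm_approx_conj; exact: poly_approx_e2pi_lin.
Qed.

Lemma poly_approx_e2pi_inv (c : nat) (d : int) (k : R[i]) : (0 < c)%N ->
  poly_approx z0 r (fun z => e2pi (k / (c%:R * z + d%:~R))).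
Proof.
move=> c0; have cn : (c%:R : R[i]) != 0 by rewrite pnatr_eq0 -lt0n.
apply: (@poly_approx_ext (fun z => cexp ((2 * pi)%:C * 'i * (k / c%:R) * (z - (- d%:~R / c%:R))^-1))).
  move=> z; rewrite /e2pi -!mulrA; congr (cexp (_ * (_ * (_ * _)))).
  rewrite -invfM; congr (_^-1); rewrite mulrBr mulrCA divff // mulr1 opprK //.
apply: poly_approx_cexp => //; apply: poly_approx_mul => //; first exact: poly_approx_cst.
apply: poly_approx_inv => //; apply: (lt_le_trans rz); apply: le_trans (nm_Im _).
rewrite ImD ImN natC intC -fmorphV -!rmorphN -rmorphM /= subr0 ler_norm //.
Qed.

Lemma harm_approx_row_term (lam c : nat) (d : int) : (0 < c)%N -> harm_approx z0 r (fun z => row_term lam m c z d).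
Proof.
move=> c0.
apply: (@harm_approx_ext (fun z => e2pi (m%:R / (lam%:R * c%:R) / (c%:R * z + d%:~R)) +
   (- 1) * conjc (e2pi (- (m%:R / (lam%:R * c%:R)) / (c%:R * z + d%:~R))))).
  move=> z; rewrite /row_term mulN1r e2pi_conj; congr (e2pi _ - e2pi _).
    by rewrite -mulrA -invfM.
  have cM (a b : R[i]) : conjc (a * b) = conjc a * conjc b by exact: rmorphM.
  have cV (a : R[i]) : conjc a^-1 = (conjc a)^-1 by exact: conjc_inv.
  have cN (a : R[i]) : conjc (- a) = - conjc a by case: a.
  have cr : conjc (m%:R / (lam%:R * c%:R)) = m%:R / (lam%:R * c%:R) :> R[i].
    by rewrite !natC -(rmorphM (real_complex R)) -(fmorphV (real_complex R))
       -(rmorphM (real_complex R)) conjc_real.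
  by rewrite cM cN mulNr opprK cV cr [in RHS]invfM mulrA.
apply: harm_approx_add; first by apply: harm_approx_poly_approx; exact: poly_approx_e2pi_inv.
by apply: harm_approx_scale; apply: harm_approx_conj; exact: poly_approx_e2pi_inv.
Qed.

Lemma harm_approx_row_sum (c : nat) (A : int) (L : nat) : (0 < c)%N -> harm_approx z0 r (fun z => row_sum p m z c A L).
Proof.
by move=> c0; apply: harm_approx_sum => k _; apply: harm_approx_scale; exact: harm_approx_row_term.
Qed.

Lemma disc_in_box w : nm w <= r ->
  in_box (complex.Im z0 - r) (complex.Im z0 + r) (`|complex.Re z0| + r) (z0 + w).
Proof.
move=> hw; have := le_trans (nm_Im w) hw; rewrite ler_norml => /andP[h1 h2].
split; rewrite ?ImD ?ReD ?subr_gt0 ?lerD2l //.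
by apply: (le_trans (ler_normD _ _)); rewrite lerD2l (le_trans (nm_Re _)).
Qed.

Lemma harm_approx_lc (c : nat) : (0 < c)%N -> harm_approx z0 r (fun z => lc p m z c).
Proof.
move=> c0; apply: harm_approx_unif => e e0.
set eta := complex.Im z0 - r; set y1 := complex.Im z0 + r; set x1 := `|complex.Re z0| + r.
have K0 : 0 <= 4 * Ctail m c eta y1.
  rewrite mulr_ge0 // Ctail_ge0 // ?subr_gt0 // addr_ge0 //.
  exact: le_trans r0 (ltW rz).
have [n hn] := inv_small (c%:R * x1 + 1) K0 e0.
exists (fun z => row_sum p m z c (- n%:Z) (2 * n)%N); first exact: harm_approx_row_sum.
move=> w hw; rewrite nm_distC; have [h1 h2] := hn n (leqnn n).
apply: le_trans (row_sum_lc p0 m0 c0 (disc_in_box hw) h1 _ _) _; [by []|by lia|].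
by move: h2; rewrite opprD addrA.
Qed.

Lemma harm_approx_poincare_tail : harm_approx z0 r (poincare_tail p m).
Proof.
apply: harm_approx_unif => e e0.
set eta := complex.Im z0 - r; have eta0 : 0 < eta by rewrite /eta subr_gt0.
have C0 := Cest_ge0 m eta0; pose M := Cest m eta * (eta^-1 + 4).
have M0 : 0 <= M by rewrite /M; nneg.
have [N hN] := @Dc_tail R (e / (M + 1)) ltac:(rewrite divr_gt0 //; lra).
exists (fun z => \sum_(1 <= c < N.+1) lc p m z c).
  move=> e' e'0; have [|P [Q hPQ]] := @harm_approx_sum R z0 r nat (index_iota 1 N.+1)
     (fun c => 0 < c)%N (fun c z => lc p m z c) _ e' e'0.
    by move=> c c0; exact: harm_approx_lc.
  exists P, Q => w /hPQ; congr (nm (_ - _) <= _).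
  by rewrite big_nat_cond [RHS]big_nat_cond; apply: eq_bigl => c; case: c.
move=> w hw; have [_ h1 _ _] := disc_in_box hw.
apply: (le_trans (poincare_tail_tail p0 m0 eta0 h1 hN)); rewrite -/M mulrA ler_pdivrMr; last by lra.
by rewrite mulrC ler_wpM2l ?ltW //; lra.
Qed.

Lemma harm_approx_poincare : harm_approx z0 r (poincare p m).
Proof. by apply: harm_approx_add; [exact: harm_approx_phi | exact: harm_approx_poincare_tail]. Qed.

End HarmonicityF.

(** * Expansion of f in Poincare series *)

Section Expansion.
Variables (R : realType) (p N : nat) (f : R[i] -> R[i]) (a b : nat -> R[i]).
Hypothesis p0 : (0 < p)%N.

Definition princ (z : R[i]) : R[i] := \sum_(1 <= m < N.+1) a m * e2pi (- (m%:R * z)).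

Hypothesis hf : forall z : R[i], 0 < complex.Im z ->
  ccvg (fun k => princ z + \sum_(1 <= n < k) b n * e2pi (n%:R * z)) (f z).

(** Convergence at height eta / 2 bounds the terms of the series there, that is, |b_n| <= B exp(pi
    eta n). *)
Lemma coef_bound (eta : R) : 0 < eta -> exists2 B : R, 0 <= B &
  forall n, (0 < n)%N -> nm (b n) * expR (- (pi * eta * n%:R)) <= B.
Proof.
move=> e0; pose z := 0 +i* (eta / 2) : R[i].
have z0 : 0 < complex.Im z by rewrite /=; lra.
have [K hK] := hf z0 ltr01.
have tE n : nm (b n * e2pi (n%:R * z)) = nm (b n) * expR (- (pi * eta * n%:R)).
  rewrite nmM nm_e2pi natC ImZ /=; congr (_ * expR (- _)).
  by field.
pose B := 2 + \sum_(0 <= n < K) nm (b n) * expR (- (pi * eta * n%:R)).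
have t0 n : 0 <= nm (b n) * expR (- (pi * eta * n%:R)) by rewrite mulr_ge0 ?nm_ge0 ?expR_ge0.
have s0 k : 0 <= \sum_(0 <= n < k) nm (b n) * expR (- (pi * eta * n%:R)) by rewrite sumr_ge0.
exists B; first by rewrite /B addr_ge0.
move=> n n0; have [nK|Kn] := ltnP n K.
  rewrite /B (bigD1_seq n) ?mem_index_iota ?iota_uniq //= addrCA lerDl.
  by rewrite addr_ge0 // sumr_ge0.
rewrite -tE; have h1 := hK n Kn; have h2 := hK n.+1 (leqW Kn).
have -> : b n * e2pi (n%:R * z) =
  (princ z + \sum_(1 <= j < n.+1) b j * e2pi (j%:R * z) - f z) -
  (princ z + \sum_(1 <= j < n) b j * e2pi (j%:R * z) - f z).
  by rewrite big_nat_recr //=; ring.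
by apply: (le_trans (nmB _ _)); rewrite /B; have := s0 K; lra.
Qed.

(** The expansion is only assumed to converge pointwise. Bounding the coefficients at half the
    height makes the tail geometric, hence uniform on Im z >= eta. *)
Lemma f_approx (eta : R) : 0 < eta -> exists2 B : R, 0 <= B &
  forall z, eta <= complex.Im z -> forall k, (0 < k)%N ->
  nm (f z - (princ z + \sum_(1 <= n < k) b n * e2pi (n%:R * z))) <=
   B * expR (pi * eta - 2 * pi * complex.Im z) ^+ k / (1 - expR (pi * eta - 2 * pi * complex.Im z)).
Proof.
move=> e0; have [B B0 hB] := coef_bound e0; exists B => // z ez k k0.
have z0 : 0 < complex.Im z by lra.
set t := expR _; have pi0 := @pi_gt0 R.
have t0 : 0 <= t by exact: expR_ge0.
have t1 : t < 1 by rewrite /t expR_lt1; nra.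
have hc : ccvg (fun j => (princ z + \sum_(1 <= n < j) b n * e2pi (n%:R * z)) +
    (- (princ z + \sum_(1 <= n < k) b n * e2pi (n%:R * z))))
   (f z + (- (princ z + \sum_(1 <= n < k) b n * e2pi (n%:R * z)))).
  by apply: ccvgD; [exact: hf | exact: ccvg_cst].
apply: (ccvg_le (N := k) hc) => j kj.
rewrite (big_cat_nat _ (n := k)) //= opprD addrACA subrr add0r addrAC subrr add0r.
apply: (le_trans (nm_sum _ _ _)).
apply: (@le_trans _ _ (\sum_(k <= n < j) B * t ^+ n)).
  rewrite big_nat [leRHS]big_nat; apply: ler_sum => n /andP[kn _].
  have n0 : (0 < n)%N by apply: leq_trans kn.
  rewrite nmM nm_e2pi natC ImZ /t -expRM_natl.
  have -> : expR (- (2 * pi * (n%:R * complex.Im z))) =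
     expR (- (pi * eta * n%:R)) * expR (n%:R * (pi * eta - 2 * pi * complex.Im z)).
    by rewrite -expRD; congr expR; ring.
  by rewrite mulrA ler_wpM2r ?expR_ge0 // hB.
rewrite -mulr_sumr -mulrA ler_wpM2l // ler_pdivlMr ?subr_gt0 //.
suff -> : (\sum_(k <= n < j) t ^+ n) * (1 - t) = t ^+ k - t ^+ j.
  by rewrite gerBl exprn_ge0.
elim: j kj => [|j IH]; first by rewrite leqn0 => /eqP ->; rewrite big_geq // mul0r subrr.
rewrite leq_eqVlt => /orP[/eqP <-|kj]; first by rewrite big_geq // mul0r subrr.
by rewrite big_nat_recr //= mulrDl IH // exprS; ring.
Qed.

Lemma harm_approx_f z0 r : 0 <= r -> r < complex.Im z0 -> harm_approx z0 r f.
Proof.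
move=> r0 rz; set eta := complex.Im z0 - r.
have e0 : 0 < eta by rewrite /eta; lra.
have pi0 := @pi_gt0 R.
have [B B0 hB] := f_approx e0; apply: harm_approx_unif => e e'0.
pose t := expR (- (pi * eta)).
have t0 : 0 <= t by exact: expR_ge0.
have t1 : t < 1 by rewrite /t expR_lt1 oppr_lt0 mulr_gt0.
have [k hk] := @expr_small R t (e * (1 - t) / (B + 1)) ltac:(rewrite t0 t1 //)
   ltac:(rewrite divr_gt0 ?mulr_gt0 ?subr_gt0 //; lra).
exists (fun z => princ z + \sum_(1 <= n < k.+1) b n * e2pi (n%:R * z)).
  apply: harm_approx_add.
    apply: harm_approx_sum => j _; apply: harm_approx_scale.
    apply: (@harm_approx_ext _ z0 r (fun z => e2pi (- j%:R * z))); last exact: harm_approx_e2pi_lin.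
    by move=> z; rewrite mulNr.
  by apply: harm_approx_sum => j _; apply: harm_approx_scale; exact: harm_approx_e2pi_lin.
move=> w hw; have [_ h1 _ _] := disc_in_box rz hw.
apply: (le_trans (hB _ h1 k.+1 isT)).
set s := expR _; have s0 : 0 <= s by exact: expR_ge0.
have st : s <= t by rewrite /s /t ler_expR; rewrite -/eta in h1; nra.
have sk : s ^+ k.+1 <= t ^+ k.
  rewrite exprS; apply: (@le_trans _ _ (1 * s ^+ k)).
    by rewrite ler_wpM2r ?exprn_ge0 //; lra.
  by rewrite mul1r lerXn2r ?nnegrE.
rewrite ler_pdivrMr; last by lra.
have h2 : t ^+ k * (B + 1) <= e * (1 - t) by rewrite -ler_pdivlMr //; lra.
have h3 : e * (1 - t) <= e * (1 - s) by apply: ler_wpM2l; [exact: ltW | lra].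
have t_k0 : 0 <= t ^+ k by rewrite exprn_ge0.
have : B * s ^+ k.+1 <= B * t ^+ k by rewrite ler_wpM2l.
nra.
Qed.

Definition resid (z : R[i]) : R[i] := f z - \sum_(1 <= m < N.+1) a m * poincare p m z.
Definition resid_lim : R[i] := - \sum_(1 <= m < N.+1) a m * cusp_const R p m.

Lemma harm_approx_resid z0 r : 0 < r -> r < complex.Im z0 -> harm_approx z0 r resid.
Proof.
move=> r0 rz; apply: (@harm_approx_ext _ z0 r (fun z => f z + (- 1) * \sum_(1 <= m < N.+1) a m * poincare p m z)).
  by move=> z; rewrite mulN1r.
apply: harm_approx_add; first by apply: harm_approx_f => //; exact: ltW.
apply: harm_approx_scale => e e0.
have [|P [Q hPQ]] := @harm_approx_sum R z0 r nat (index_iota 1 N.+1)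
     (fun m => 0 < m)%N (fun m z => a m * poincare p m z) _ e e0.
  by move=> m m0; apply: harm_approx_scale; apply: harm_approx_poincare => //; exact: ltW.
exists P, Q => w /hPQ; congr (nm (_ - _) <= _).
by rewrite big_nat_cond [RHS]big_nat_cond; apply: eq_bigl => c; case: c.
Qed.

(** The growing exponentials e(-m z) cancel between f and the seeds [phi]; every remaining term is
    bounded on Im z >= eta. *)
Lemma residE z : resid z = (f z - princ z) -
  \sum_(1 <= m < N.+1) a m * (poincare_tail p m z - e2pi (- (m%:R * conjc z))).
Proof.
rewrite /resid /princ -[RHS]addrA -opprD -big_split /=; congr (_ - _).
by apply: eq_bigr => m _; rewrite /poincare /phi; ring.
Qed.

Lemma nm_antiholo (m : nat) (z : R[i]) : (0 < m)%N -> 0 < complex.Im z ->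
  nm (e2pi (- (m%:R * conjc z))) <= 1 /\ nm (e2pi (- (m%:R * conjc z))) <= (complex.Im z)^-1.
Proof.
move=> m0 y0; have m1 : (1 : R) <= m%:R by rewrite ler1n.
have p2 := @pi_ge2 R.
have -> : nm (e2pi (- (m%:R * conjc z))) = (expR (2 * pi * (m%:R * complex.Im z)))^-1.
  by rewrite nm_e2pi -expRN ImN natC ImZ; congr expR; case: z {y0} => x y /=; ring.
have h : complex.Im z <= expR (2 * pi * (m%:R * complex.Im z)).
  apply: le_trans (expR_ge1Dx _).
  have : complex.Im z <= m%:R * complex.Im z by rewrite ler_peMl // ltW.
  set q := m%:R * _ => hq; nra.
split; last by rewrite lef_pV2 ?posrE ?expR_gt0.
rewrite invf_le1 ?expR_gt0 // -expR0 ler_expR mulr_ge0 ?mulr_ge0 ?pi_ge0 ?ler0n //.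
exact: ltW.
Qed.

Lemma resid_bounded (eta : R) : 0 < eta ->
  exists M : R, forall z, eta <= complex.Im z -> nm (resid z) <= M.
Proof.
move=> e0; have [B B0 hB] := f_approx e0; have pi0 := @pi_gt0 R.
pose t := expR (- (pi * eta)).
have t0 : 0 <= t by exact: expR_ge0.
have t1 : t < 1 by rewrite /t expR_lt1 oppr_lt0 mulr_gt0.
exists (B / (1 - t) + \sum_(1 <= m < N.+1) nm (a m) * (Cest m eta * (eta^-1 + 4) * 81 + 1)).
move=> z ez; have z0 : 0 < complex.Im z by lra.
rewrite residE; apply: (le_trans (nmB _ _)); apply: lerD.
  have := hB z ez 1%N isT; rewrite big_geq // addr0 expr1.
  set s := expR _; have s0 : 0 <= s by exact: expR_ge0.
  have st : s <= t by rewrite /s /t ler_expR; nra.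
  move/le_trans; apply; apply: ler_pM; rewrite ?mulr_ge0 ?invr_ge0 //; try lra.
    by rewrite ler_piMr //; lra.
  by rewrite lef_pV2 ?posrE; lra.
apply: (le_trans (nm_sum _ _ _)); rewrite big_nat [leRHS]big_nat; apply: ler_sum => m /andP[m0 _].
rewrite nmM ler_wpM2l ?nm_ge0 //; apply: (le_trans (nmB _ _)); apply: lerD.
  exact: nm_poincare_tail.
by have [] := nm_antiholo m0 z0.
Qed.

Lemma resid_cusp : exists K : R, forall z, 1 <= complex.Im z ->
  nm (resid z - resid_lim) <= K / complex.Im z.
Proof.
have [B B0 hB] := f_approx (ltr01 : 0 < 1 :> R); have p2 := @pi_ge2 R.
exists (2 * B + \sum_(1 <= m < N.+1) nm (a m) * (Cest m 1 * 81 + 1)) => z y1.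
have y0 : 0 < complex.Im z by lra.
have yi : 0 < (complex.Im z)^-1 by rewrite invr_gt0.
have -> : resid z - resid_lim = (f z - princ z) -
  \sum_(1 <= m < N.+1) a m * ((poincare_tail p m z - cusp_const R p m) - e2pi (- (m%:R * conjc z))).
  rewrite residE /resid_lim opprK -addrA; congr (_ + _).
  rewrite [in RHS](eq_bigr (fun m => a m * (poincare_tail p m z - e2pi (- (m%:R * conjc z))) -
     a m * cusp_const R p m)); last by move=> m _; ring.
  by rewrite sumrB opprB addrC.
rewrite mulrDl; apply: (le_trans (nmB _ _)); apply: lerD.
  have := hB z y1 1%N isT; rewrite big_geq // addr0 expr1 mulr1.
  set s := expR _; have s0 : 0 <= s by exact: expR_ge0.
  have sy : s <= (2 * complex.Im z)^-1.
    rewrite /s -[leLHS]invrK -expRN lef_pV2 ?posrE ?expR_gt0 ?mulr_gt0 //.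
    apply: le_trans (expR_ge1Dx _); nra.
  have s2 : s <= 1 / 2.
    by apply: (le_trans sy); rewrite -[leLHS]mul1r ler_pdivrMr ?mulr_gt0 //; lra.
  move/le_trans; apply; rewrite ler_pdivrMr; last by lra.
  have : B * s <= B * (2 * complex.Im z)^-1 by rewrite ler_wpM2l.
  rewrite invfM => h; have : 0 <= B / complex.Im z by rewrite divr_ge0 // ltW.
  move: h; set q := B * (_ * _) => h h2.
  have qE : q = B / complex.Im z / 2 by rewrite /q; field; rewrite gt_eqF.
  rewrite qE in h; nra.
apply: (le_trans (nm_sum _ _ _)); rewrite mulr_suml big_nat [leRHS]big_nat.
apply: ler_sum => m /andP[m0 _]; rewrite nmM -mulrA ler_wpM2l ?nm_ge0 //.
rewrite mulrDl mul1r; apply: (le_trans (nmB _ _)); apply: lerD.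
  exact: poincare_tail_cusp.
by have [] := nm_antiholo m0 y0.
Qed.

(** The group enters only through the reduction hypothesis: every point has a partner of height at
    least eta at which f and all the series take the same values. *)
Lemma f_expand (eta : R) : 0 < eta ->
  (forall z : R[i], 0 < complex.Im z -> exists z', [/\ eta <= complex.Im z', f z' = f z &
     forall m, (0 < m)%N -> poincare p m z' = poincare p m z]) ->
  forall z : R[i], 0 < complex.Im z ->
  f z = \sum_(1 <= m < N.+1) a m * (poincare p m z - cusp_const R p m).
Proof.
move=> e0 hred z z0; have [M hM] := resid_bounded e0; have [K hK] := resid_cusp.
have : resid z = resid_lim.
  apply: (@harmonic_liouville R resid resid_lim eta M) => //.
  - exact: harm_approx_resid.
  - move=> z1 /hred [z' [h1 h2 h3]]; exists z'; first exact: h1.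
    rewrite /resid h2; apply: congr1; apply: congr1.
    by apply: eq_big_nat => m /andP[m0 _]; rewrite h3.
  - move=> e e'0; exists (1 + `|K| / e) => z1 hz1.
    have Ke : 0 <= `|K| / e by rewrite divr_ge0 // ltW.
    have y1 : 1 <= complex.Im z1 by lra.
    apply: (le_trans (hK z1 y1)); rewrite ler_pdivrMr; last by lra.
    rewrite mulrC -ler_pdivrMr //; apply: (@le_trans _ _ (`|K| / e)); last lra.
    by rewrite ler_wpM2r ?invr_ge0 ?(ltW e'0) // ler_norm.
rewrite /resid /resid_lim => h.
have -> : f z = (f z - \sum_(1 <= m < N.+1) a m * poincare p m z) + \sum_(1 <= m < N.+1) a m * poincare p m z.
  by rewrite subrK.
by rewrite h addrC -sumrB; apply: eq_bigr => m _; rewrite mulrBr.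
Qed.

End Expansion.

(** * The limit at the cusp *)

Section RealLimits.
Variable R : realType.

Definition rcvg (u : nat -> R) (l : R) := forall e : R, 0 < e ->
  exists N, forall n, (N <= n)%N -> `|u n - l| <= e.

Lemma rcvg_unique u l l' : rcvg u l -> rcvg u l' -> l = l'.
Proof.
move=> h h'; apply/eqP; rewrite -subr_eq0 -normr_le0; apply/ler_addgt0Pr => e e0.
have [N hN] := h (e / 2) ltac:(lra); have [N' hN'] := h' (e / 2) ltac:(lra).
have := hN _ (leq_maxl N N'); have := hN' _ (leq_maxr N N').
set x := u _ => h1; rewrite (distrC x l) => h2.
have -> : l - l' = (l - x) + (x - l') by ring.
by apply: (le_trans (ler_normD _ _)); lra.
Qed.

Lemma rcvgB u v l l' : rcvg u l -> rcvg v l' -> rcvg (fun n => u n - v n) (l - l').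
Proof.
move=> h h' e e0; have [N hN] := h (e / 2) ltac:(lra); have [N' hN'] := h' (e / 2) ltac:(lra).
exists (maxn N N') => n; rewrite geq_max => /andP[/hN h1 /hN' h2].
have -> : u n - v n - (l - l') = (u n - l) - (v n - l') by ring.
by apply: (le_trans (ler_normB _ _)); lra.
Qed.

Lemma rcvgZ u l k : rcvg u l -> rcvg (fun n => k * u n) (k * l).
Proof.
move=> h e e0; have k1 : 0 < `|k| + 1 by rewrite ltr_wpDl.
have [N hN] := h (e / (`|k| + 1)) ltac:(exact: divr_gt0).
exists N => n /hN hn; rewrite -mulrBr normrM.
apply: (@le_trans _ _ ((`|k| + 1) * (e / (`|k| + 1)))); first by apply: ler_pM => //; lra.
by rewrite mulrCA divff ?mulr1 // gt_eqF.
Qed.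

Lemma rcvg_sub u l (s : nat -> nat) : (forall n, (n <= s n)%N) -> rcvg u l ->
  rcvg (fun n => u (s n)) l.
Proof. by move=> hs h e /h [N hN]; exists N => n Nn; apply: hN; exact: leq_trans (hs n). Qed.

Lemma mono_le u l : (forall n, u n <= u n.+1) -> rcvg u l -> forall n, u n <= l.
Proof.
move=> um h n; apply/ler_addgt0Pr => e /h [N hN].
have mono k : u n <= u (n + k)%N.
  by elim: k => [|k IH]; rewrite ?addn0 // addnS (le_trans IH).
have := hN (n + N)%N (leq_addl _ _); rewrite ler_norml => /andP[_ h1].
by have := mono N; lra.
Qed.

Lemma mono_cvg u (M : R) : (forall n, u n <= u n.+1) -> (forall n, u n <= M) ->
  exists l, rcvg u l.
Proof.
move=> um uM; have cu : cvgn u.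
  apply: nondecreasing_is_cvgn; first exact/nondecreasing_seqP.
  by exists M => _ [n _ <-].
exists (limn u) => e e0; move/cvgrPdist_le : cu => /(_ e e0) [N _ hN].
by exists N => n /hN; rewrite distrC.
Qed.

Definition sq n : R := n%:R ^- 2.
Lemma sq_ge0 n : 0 <= sq n. Proof. by rewrite invr_ge0 exprn_ge0 ?ler0n. Qed.
Lemma sqM m n : sq (m * n) = sq m * sq n.
Proof. by rewrite /sq natrM exprMn invfM. Qed.

Definition Sq n : R := \sum_(1 <= k < n.+1) sq k.

Lemma Sq_mono n : Sq n <= Sq n.+1.
Proof. by rewrite /Sq [leRHS]big_nat_recr //= lerDl sq_ge0. Qed.

Lemma Sq_le2 n : Sq n <= 2.
Proof.
have H k : Sq k.+1 <= 2 - k.+1%:R^-1.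
  elim: k => [|k IH]; first by rewrite /Sq big_nat1 /sq expr1n invr1; lra.
  rewrite /Sq big_nat_recr //= -/(Sq k.+1); apply: (le_trans (lerD IH (lexx _))).
  rewrite /sq; set x : R := k.+1%:R; have x0 : 0 < x by rewrite ltr0n.
  have -> : k.+2%:R = x + 1 by rewrite /x natr1.
  have aux (a b c : R) : c <= a - b -> 2 - a + c <= 2 - b by lra.
  apply: aux.
  have -> : x^-1 - (x + 1)^-1 = (x * (x + 1))^-1 by field; rewrite !gt_eqF //; lra.
  rewrite lef_pV2 ?posrE ?exprn_gt0 ?mulr_gt0 //; try lra.
case: n => [|n]; first by rewrite /Sq big_geq.
by apply: (le_trans (H n)); rewrite gerBl invr_ge0 ler0n.
Qed.

Definition Sqp (p n : nat) : R := \sum_(1 <= k < n.+1) (if (p %| k)%N then 0 else sq k).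

Lemma SqpE p n : (0 < p)%N -> Sqp p n = Sq n - sq p * Sq (n %/ p).
Proof.
move=> p0; rewrite /Sqp /Sq.
have -> : sq p * \sum_(1 <= k < (n %/ p).+1) sq k = \sum_(1 <= k < n.+1) (if (p %| k)%N then sq k else 0).
  elim: n => [|n IH]; first by rewrite div0n !big_geq // mulr0.
  rewrite [RHS]big_nat_recr //= -IH; have [h|h] := boolP (p %| n.+1)%N.
    have [q qE] : exists q, (n.+1 %/ p = q.+1)%N.
      by exists (n.+1 %/ p).-1; rewrite prednK // divn_gt0 // dvdn_leq.
    have -> : (n %/ p = q)%N by move: (divnS n p0); rewrite h qE add1n => -[].
    rewrite qE big_nat_recr //= mulrDr -sqM; congr (_ + sq _).
    by rewrite -qE mulnC divnK.
  have -> : (n.+1 %/ p = n %/ p)%N by rewrite divnS // (negbTE h).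
  by rewrite addr0.
rewrite -sumrB; apply: eq_bigr => k _; case: ifP => _; ring.
Qed.

Lemma Sqp_cvg p Z : (0 < p)%N -> rcvg Sq Z -> rcvg (Sqp p) ((1 - sq p) * Z).
Proof.
move=> p0 hZ; have -> : (1 - sq p) * Z = Z - sq p * Z by ring.
have hd : rcvg (fun n => Sq (n %/ p)) Z.
  move=> e /hZ [N hN]; exists (N * p)%N => n Nn; apply: hN.
  by rewrite leq_divRL.
move=> e e0; have [N hN] := rcvgB hZ (rcvgZ (sq p) hd) e0.
by exists N => n /hN; rewrite SqpE.
Qed.

Definition csc2 (x : R) : R := sin x ^- 2.
(* The duplication formula for 1 / sin^2 gives [Acsc n = 4 ^ n]. *)
Definition Acsc n : R := \sum_(0 <= j < 2 ^ n) csc2 (pi * (2 * j + 1)%:R / (2 ^ n.+1)%:R).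

Lemma csc2_double (x : R) : sin x != 0 -> cos x != 0 ->
  csc2 x + csc2 (x + pi / 2) = 4 * csc2 (2 * x).
Proof.
move=> s0 c0; rewrite /csc2 sinDpihalf.
have -> : sin (2 * x) = 2 * cos x * sin x by rewrite mulr_natl sin_mulr2n -mulr_natl mulrA.
have e := cos2Dsin2 x.
have -> : sin x ^- 2 + cos x ^- 2 = (cos x ^+ 2 + sin x ^+ 2) / (cos x ^+ 2 * sin x ^+ 2).
  by field; rewrite s0 c0.
by rewrite e; field; rewrite s0 c0.
Qed.

(** The nodes j and j + 2^n of level n + 1 differ by pi/2, and doubling sends both to the node j of
    level n (modulo pi). *)
Lemma AcscE n : Acsc n = 4 ^+ n.
Proof.
elim: n => [|n IH].
  by rewrite /Acsc expn0 big_nat1 muln0 add0n mulr1 /csc2 sin_pihalf expr1n invr1.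
rewrite exprS -IH /Acsc mulr_sumr.
rewrite [LHS](_ : _ = \sum_(0 <= j < 2 ^ n + 2 ^ n) csc2 (pi * (2 * j + 1)%:R / (2 ^ n.+2)%:R));
  last by rewrite addnn -mul2n -expnS.
rewrite (big_cat_nat _ (n := (2 ^ n)%N)) ?leq_addr //=.
rewrite -{2}[(2 ^ n)%N]add0n big_addn addnK -big_split /=.
rewrite big_nat [RHS]big_nat; apply: eq_bigr => j /andP[_ jn].
set x : R := pi * (2 * j + 1)%:R / (2 ^ n.+2)%:R.
have p2 : (0 : R) < (2 ^ n)%:R by rewrite ltr0n expn_gt0.
have E : pi * (2 * j + 1)%:R / (2 ^ n.+1)%:R = 2 * x.
  by rewrite /x !expnS !natrM; field; rewrite gt_eqF.
have E2 : pi * (2 * (j + 2 ^ n) + 1)%:R / (2 ^ n.+2)%:R = x + pi / 2.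
  by rewrite /x !expnS !natrM mulnDr addnAC natrD natrM mulrDr; field; rewrite gt_eqF.
have x0 : 0 < x by rewrite /x divr_gt0 ?mulr_gt0 ?pi_gt0 ?ltr0n ?expn_gt0 // addn1.
have x1 : x < pi / 2.
  rewrite /x ltr_pdivrMr ?ltr0n ?expn_gt0 // -mulrA ltr_pM2l ?pi_gt0 // !expnS natrM mulKf //.
  by rewrite ltr_nat; lia.
rewrite E E2 csc2_double //.
  by rewrite gt_eqF // sin_gt0_pihalf // x0.
by rewrite gt_eqF // cos_gt0_pihalf // x1 andbT (lt_trans _ x0) // oppr_lt0 divr_gt0 ?pi_gt0.
Qed.

(** From x cos x <= sin x <= x; the upper bound uses 1/sin^2 = cot^2 + 1 and cot x <= 1/x. *)
Lemma csc2_bounds (x : R) : 0 < x < pi / 2 -> x ^- 2 <= csc2 x <= x ^- 2 + 1.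
Proof.
move=> /andP[x0 x1]; have s0 : 0 < sin x by rewrite sin_gt0_pihalf // x0.
have c0 : 0 < cos x.
  by rewrite cos_gt0_pihalf // x1 andbT (lt_trans _ x0) // oppr_lt0 divr_gt0 ?pi_gt0.
have h1 : sin x <= x by have := abs_sin_le x; rewrite !gtr0_norm.
have h2 : x * cos x <= sin x.
  have [t] := @MVT_segment R sin cos 0 x (ltW x0)
    (fun c _ => is_derive_sin c) (continuous_subspaceT (@continuous_sin R)).
  rewrite in_itv /= => /andP[t0 tx]; rewrite sin0 !subr0 => ->.
  rewrite mulrC ler_wpM2r ?(ltW x0) //; move: tx; rewrite le_eqVlt => /orP[/eqP -> //|tx].
  have p0 := @pi_gt0 R.
  by rewrite ltW // ltr_cos ?in_itv /= ?t0 ?(ltW x0) //=; lra.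
rewrite /csc2; apply/andP; split.
  rewrite lef_pV2 ?posrE ?exprn_gt0 //; apply: lerXn2r => //; rewrite nnegrE; exact: ltW.
have -> : sin x ^- 2 = (cos x / sin x) ^+ 2 + 1.
  have -> : (1 : R) = sin x ^+ 2 / sin x ^+ 2 by rewrite divff // gt_eqF // exprn_gt0.
  by rewrite expr_div_n -mulrDl cos2Dsin2 mul1r.
rewrite lerD2r -exprVn; apply: lerXn2r; rewrite ?nnegrE ?invr_ge0 ?divr_ge0 ?(ltW x0) ?(ltW s0) ?(ltW c0) //.
by rewrite ler_pdivrMr // mulrC ler_pdivlMr // mulrC.
Qed.

Lemma Acsc_half n : Acsc n.+1 =
  2 * \sum_(0 <= j < 2 ^ n) csc2 (pi * (2 * j + 1)%:R / (2 ^ n.+2)%:R).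
Proof.
rewrite /Acsc expnS mul2n -addnn (big_cat_nat _ (n := (2 ^ n)%N)) ?leq_addr //=.
rewrite mulr_natl mulr2n; congr (_ + _).
rewrite -[X in \sum_(X <= _ < _) _]add0n big_addn addnK big_nat_rev /= add0n.
rewrite big_nat [RHS]big_nat; apply: eq_bigr => j /andP[_ jn].
have p2 : (0 : R) < (2 ^ n)%:R by rewrite ltr0n expn_gt0.
rewrite /csc2; congr (_ ^- 2).
have -> : pi * (2 * (2 ^ n - j.+1 + 2 ^ n) + 1)%:R / (2 ^ n.+2)%:R =
   pi - pi * (2 * j + 1)%:R / (2 ^ n.+2)%:R :> R.
  have -> : ((2 * (2 ^ n - j.+1 + 2 ^ n) + 1)%N = 4 * 2 ^ n - (2 * j + 1))%N by lia.
  rewrite natrB; last by lia.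
  by rewrite !expnS !natrM; field; rewrite gt_eqF.
by rewrite sinB sinpi cospi; ring.
Qed.

Lemma sum_odd n : \sum_(0 <= j < n) sq (2 * j + 1) = Sqp 2 (2 * n).
Proof.
elim: n => [|n IH]; first by rewrite /Sqp !big_geq.
rewrite big_nat_recr //= IH (_ : (2 * n.+1 = (2 * n).+2)%N); last by lia.
rewrite /Sqp [RHS]big_nat_recr //= [X in _ = X + _]big_nat_recr //=.
by rewrite !dvdn2 /= !oddM /= addr0 addn1.
Qed.

(** At the nodes pi (2 j + 1) / 2^(n + 2) in (0, pi/2) compare 1/sin^2 x with 1/x^2. The exact value
    4^(n + 1) of the sum over all nodes then gives pi^2 / 8 for the sum over odd squares, with an
    error at most pi^2 / 2^n, and that sum is (1 - 1/4) Z. *)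
Theorem basel Z : rcvg Sq Z -> Z = pi ^+ 2 / 6.
Proof.
move=> hZ; have h2 := Sqp_cvg (isT : (0 < 2)%N) hZ.
have pi0 := @pi_gt0 R; have piN : (pi : R) != 0 by rewrite gt_eqF.
suff h3 : rcvg (fun n => Sqp 2 (2 * 2 ^ n)) (pi ^+ 2 / 8).
  have h4 : rcvg (fun n => Sqp 2 (2 * 2 ^ n)) ((1 - sq 2) * Z).
    apply: rcvg_sub h2 => n; apply: leq_trans (ltnW (ltn_expl n (isT : (1 < 2)%N))) _.
    by rewrite leq_pmull.
  have := rcvg_unique h3 h4; rewrite /sq => e.
  have : (1 - 2 ^- 2) * Z = 3 / 4 * Z :> R by field.
  by move=> e2; rewrite e2 in e; lra.
move=> e e0.
have [n0 hn0] := @expr_small R (1 / 2) (e / (pi ^+ 2)) ltac:(apply/andP; split; lra)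
  ltac:(by rewrite divr_gt0 ?exprn_gt0).
exists n0 => n nn.
have p2 : (0 : R) < (2 ^ n)%:R by rewrite ltr0n expn_gt0.
have hA := AcscE n.+1; rewrite Acsc_half in hA.
pose x j : R := pi * (2 * j + 1)%:R / (2 ^ n.+2)%:R.
have xb j : (j < 2 ^ n)%N -> 0 < x j < pi / 2.
  move=> jn; apply/andP; split.
    by rewrite /x divr_gt0 ?mulr_gt0 ?ltr0n ?expn_gt0 // addn1.
  rewrite /x ltr_pdivrMr ?ltr0n ?expn_gt0 // -mulrA ltr_pM2l // !expnS natrM mulKf //.
  by rewrite ltr_nat; lia.
have xE j : x j ^- 2 = 16 * 4 ^+ n / pi ^+ 2 * sq (2 * j + 1).
  have -> : (4 : R) ^+ n = (2 ^ n)%:R ^+ 2 by rewrite natrX -exprM mulnC exprM; congr (_ ^+ _); ring.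
  have j0 : ((2 * j + 1)%:R : R) != 0 by rewrite pnatr_eq0 addn1.
  rewrite /x /sq; move: j0; set J : R := (2 * j + 1)%:R => j0; rewrite !expnS !natrM.
  have T0 : ((2 ^ n)%:R : R) != 0 by rewrite gt_eqF.
  move: T0; set T : R := (2 ^ n)%:R => T0.
  rewrite expr_div_n invf_div [(pi * J) ^+ 2]exprMn invfM !mulrA.
  by congr (_ / _ / _); ring.
set S := \sum_(0 <= j < 2 ^ n) csc2 _ in hA.
have L : 16 * 4 ^+ n / pi ^+ 2 * Sqp 2 (2 * 2 ^ n) <= S.
  rewrite -sum_odd mulr_sumr /S big_nat [leRHS]big_nat; apply: ler_sum => j /andP[_ jn].
  by rewrite -xE; case/andP: (csc2_bounds (xb j jn)).
have U : S <= 16 * 4 ^+ n / pi ^+ 2 * Sqp 2 (2 * 2 ^ n) + 2 ^+ n.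
  rewrite -sum_odd mulr_sumr /S.
  have -> : (2 : R) ^+ n = \sum_(0 <= j < 2 ^ n) 1.
    by rewrite big_const_nat iter_addr_0 subn0 natrX.
  rewrite -big_split /= big_nat [leRHS]big_nat; apply: ler_sum => j /andP[_ jn].
  by rewrite -xE; case/andP: (csc2_bounds (xb j jn)).
set s := Sqp 2 _ in L U *.
have q0 : 0 < (4 : R) ^+ n by rewrite exprn_gt0.
have SE : S = 2 * 4 ^+ n by move: hA; rewrite exprS; lra.
have q4 : (4 : R) ^+ n = 2 ^+ n * 2 ^+ n by rewrite -exprMn; congr (_ ^+ _); ring.
have t0 : (0 : R) < 2 ^+ n by rewrite exprn_gt0.
have hn : (1 / 2 : R) ^+ n * pi ^+ 2 <= e.
  rewrite -ler_pdivlMr ?exprn_gt0 //; apply: le_trans hn0.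
  by apply: ler_wiXn2l => //; lra.
have P0 : 0 < (pi : R) ^+ 2 by rewrite exprn_gt0.
have i2 : (1 / 2 : R) ^+ n * 2 ^+ n = 1.
  by rewrite -exprMn (_ : 1 / 2 * 2 = 1 :> R) ?expr1n //; field.
move: L U; rewrite SE; set P := (pi : R) ^+ 2 in P0 hn *; set Q := (4 : R) ^+ n in q0 q4 *.
rewrite [16 * Q / P * s](_ : _ = 16 * Q * s / P); last by field; rewrite gt_eqF.
rewrite ler_pdivrMr // => L; rewrite -lerBlDr ler_pdivlMr // => U.
have L' : s <= P / 8.
  rewrite -(ler_pM2l q0); lra.
have U' : P / 8 - (1 / 2) ^+ n * P <= s.
  rewrite -(ler_pM2l q0) mulrBr.
  have -> : Q * ((1 / 2) ^+ n * P) = 2 ^+ n * P.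
    by rewrite q4; transitivity (((1 / 2) ^+ n * 2 ^+ n) * (2 ^+ n * P)); [ring | rewrite i2 mul1r].
  have : 0 <= 2 ^+ n * P by rewrite mulr_ge0 // ltW.
  lra.
by rewrite ler_norml; apply/andP; split; lra.
Qed.

End RealLimits.

(** * Ramanujan sums and their Dirichlet series *)

Section Ramanujan.
Variables (R : realType) (m : nat).
Hypothesis m0 : (0 < m)%N.

Definition ramanujan (c : nat) : R[i] := \sum_(0 <= a < c | coprime a c) ee (- (m%:R * a%:R / c%:R)).

Lemma sum_multiples (d k : nat) (P : pred nat) (G : nat -> R[i]) : (0 < k)%N ->
  (forall x, P x -> (k %| x)%N) ->
  \sum_(0 <= x < d * k | P x) G x = \sum_(0 <= a < d | P (a * k)%N) G (a * k)%N.
Proof.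
move=> k0 hP; elim: d => [|d IH]; first by rewrite mul0n !big_geq.
rewrite mulSn addnC (big_cat_nat _ (n := (d * k)%N)) ?leq_addr //= IH.
rewrite [RHS]big_mkcond big_nat_recr //= -big_mkcond; congr (_ + _).
rewrite big_ltn_cond; last by rewrite -[X in (X < _)%N]addn0 ltn_add2l.
have -> : \sum_((d * k).+1 <= i < d * k + k | P i) G i = 0.
  rewrite big_nat_cond big1 // => x /andP[/andP[x1 x2] /hP kx].
  move: kx x1 x2 => /dvdnP[q ->]; rewrite ltn_mul2r => /andP[_ h1].
  by rewrite addnC -mulSn ltn_mul2r => /andP[_]; lia.
by case: ifP => _; rewrite ?addr0.
Qed.

Lemma divn_divn (n d : nat) : (0 < n)%N -> (d %| n)%N -> (n %/ (n %/ d) = d)%N.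
Proof.
move=> n0 dn; have d0 : (0 < d)%N := dvdn_gt0 n0 dn.
have k0 : (0 < n %/ d)%N by rewrite divn_gt0 // dvdn_leq.
by rewrite -{1}(divnK dn) mulKn.
Qed.

(** Sort the residues x modulo n by gcd(x, n) = n / d. The class of d contributes the Ramanujan sum
    modulo d, and the full sum of the character is n or 0. *)
Lemma ramanujan_divisors n : (0 < n)%N ->
  \sum_(d <- divisors n) ramanujan d = if (n %| m)%N then n%:R else 0.
Proof.
move=> n0.
have -> : (if (n %| m)%N then n%:R else 0) = \sum_(0 <= x < n) ee (- (m%:R * x%:R / n%:R)) :> R[i].
  have := @sum_ee_full R n (- m%:Z) n0.
  rewrite (_ : (n%:Z %| - m%:Z)%Z = (n %| m)%N) => [<-|]; last first.
    by change ((n %| `|(- m%:Z)%R|)%N = (n %| m)%N); rewrite abszN.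
  by apply: eq_bigr => x _; congr ee; rewrite mulrNz -pmulrn; ring.
transitivity (\sum_(0 <= x < n) \sum_(d <- divisors n | (gcdn x n == n %/ d)%N) ee (- (m%:R * x%:R / n%:R : R))).
  apply/esym; under eq_bigr => x _ do rewrite big_mkcond.
  rewrite exchange_big /= big_seq [RHS]big_seq; apply: eq_bigr => d.
  rewrite -dvdn_divisors // => dn; rewrite -big_mkcond /=.
  have d0 : (0 < d)%N by apply: dvdn_gt0 dn.
  set k := (n %/ d)%N; have nE : n = (d * k)%N by rewrite mulnC divnK.
  have k0 : (0 < k)%N by rewrite divn_gt0 // dvdn_leq.
  rewrite {1}nE sum_multiples //; last by move=> x /eqP <-; exact: dvdn_gcdl.
  apply: eq_big => [a|a _].
    rewrite {1}nE -muln_gcdl -{2}[k]mul1n eqn_pmul2r //.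
  congr ee; rewrite {1}nE !natrM.
  have dR : (d%:R : R) != 0 by rewrite pnatr_eq0 -lt0n.
  have kR : (k%:R : R) != 0 by rewrite pnatr_eq0 -lt0n.
  by field; rewrite dR kR.
apply: eq_bigr => x _; rewrite -big_filter.
rewrite (_ : [seq _ <- _ | _] = [:: (n %/ gcdn x n)%N]) ?big_seq1 //.
apply: perm_small_eq => //; apply: uniq_perm; rewrite ?filter_uniq ?divisors_uniq // => d.
have g0 : (0 < gcdn x n)%N by rewrite gcdn_gt0 n0 orbT.
rewrite mem_filter -dvdn_divisors // inE; apply/andP/eqP => [[/eqP h dn]|->].
  by rewrite h divn_divn.
rewrite dvdn_div ?dvdn_gcdr //; split=> //.
by rewrite divn_divn // dvdn_gcdr.
Qed.

Lemma modn_cancel (b c u v : nat) : coprime b c ->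
  (b * u = b * v %[mod c])%N -> (u = v %[mod c])%N.
Proof.
move=> hb; wlog vu : u v / (v <= u)%N.
  move=> W; have [h|h] := leqP v u; first exact: W.
  by move=> e; apply/esym; apply: W; rewrite ?(ltnW h).
move=> /eqP; rewrite eqn_mod_dvd ?leq_mul2l ?vu ?orbT // -mulnBr Gauss_dvdr 1?coprime_sym //.
by rewrite -eqn_mod_dvd // => /eqP.
Qed.

Lemma mod_inverse_unique (lam a c : nat) : (0 < c)%N -> coprime lam c -> coprime a c ->
  exists k0 : 'I_c, forall k : 'I_c, (lam * a * k == 1 %[mod c])%N = (k == k0).
Proof.
move=> c0 hl ha; have hb : coprime (lam * a) c by rewrite coprimeMl hl ha.
set b := (lam * a)%N in hb *.
have [u hu] : exists u, (b * u = 1 %[mod c])%N.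
  (* [egcdnP] asks for a positive argument; b = 0 is prime to c only for c = 1. *)
  have [b0|b0] := posnP b.
    by exists 0%N; move: hb; rewrite b0 /coprime gcd0n => /eqP ->; rewrite !modn1.
  have [u v e _] := egcdnP c b0; exists u; rewrite mulnC e.
  by rewrite (eqP hb) modnMDl.
exists (Ordinal (ltn_pmod u c0)) => k; apply/eqP/eqP => [h|->]; last by rewrite /= modnMmr.
apply: val_inj => /=; rewrite -[LHS](modn_small (ltn_ord k)).
by apply: (modn_cancel hb); rewrite h hu.
Qed.

(** For a prime to c exactly one d modulo c satisfies lam a d = 1, for any other a there is none. *)
Lemma sum_kloos_ramanujan (lam c : nat) : (0 < c)%N -> coprime lam c ->
  \sum_(0 <= k < c) kloos R lam m c k%:Z = ramanujan c.
Proof.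
move=> c0 hl; rewrite big_mkord /kloos /ramanujan.
under eq_bigr => k _ do rewrite big_mkcond.
rewrite exchange_big /= big_mkord [RHS]big_mkcond; apply: eq_bigr => a _.
have E (k : 'I_c) : (lam%:Z * (a : nat)%:Z * (k : nat)%:Z == 1 %[mod c])%Z = (lam * a * k == 1 %[mod c])%N.
  by rewrite -!PoszM -[1]/(Posz 1) !modz_nat eqz_nat.
under eq_bigr => k _ do rewrite E.
rewrite -big_mkcond /=; case: ifP => ha.
  by have [k0 hk0] := mod_inverse_unique c0 hl ha; rewrite (big_pred1 k0).
rewrite big_pred0 // => k; apply: contraFF ha => h.
apply/eqP/eqP; rewrite eqn_leq gcdn_gt0 c0 orbT andbT.
have d1 : (gcdn a c %| lam * a * k)%N by rewrite dvdn_mulr // dvdn_mull // dvdn_gcdl.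
have d2 : (gcdn a c %| c)%N := dvdn_gcdr _ _.
apply: dvdn_leq => //.
have : (gcdn a c %| (lam * a * k) %% c)%N by rewrite /dvdn modn_dvdm.
by rewrite (eqP h) /dvdn modn_dvdm.
Qed.

(** The inner sum is cut at n / c, so this is not a plain product of limits. For c <= N0 the cut
    tends to infinity with n; for larger c the majorant [Dc] takes over. *)
Lemma dirichlet_limit (x : nat -> R[i]) (M : R) (w : nat -> R) (Z : R) (Sx : R[i]) :
  0 <= M -> (forall c, (0 < c)%N -> nm (x c) <= M * Dc R c) -> (forall n, 0 <= w n) ->
  rcvg (fun n => \sum_(1 <= k < n.+1) w k) Z ->
  ccvg (fun n => \sum_(1 <= c < n.+1) x c) Sx ->
  ccvg (fun n => \sum_(1 <= c < n.+1) x c * (\sum_(1 <= k < (n %/ c).+1) w k)%:C) (Sx * Z%:C).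
Proof.
move=> M0 hx w0 hZ hS; pose W n := \sum_(1 <= k < n.+1) w k.
have Wm n : W n <= W n.+1 by rewrite /W [leRHS]big_nat_recr //= lerDl.
have WZ := mono_le Wm hZ.
have W0 n : 0 <= W n by rewrite /W sumr_ge0.
have Z0 : 0 <= Z := le_trans (W0 0%N) (WZ 0%N).
have hZS : ccvg (fun n => Z%:C * \sum_(1 <= c < n.+1) x c) (Z%:C * Sx) by exact: ccvgZ.
move=> e e0.
have [N1 h1] := hZS (e / 3) ltac:(lra).
have MZ1 : 0 < e / (3 * (M * Z + 1)) by rewrite divr_gt0 // mulr_gt0 // ltr_wpDl // mulr_ge0.
have M81 : 0 < e / (3 * (M * 81 + 1)) by rewrite divr_gt0 // mulr_gt0 // ltr_wpDl // mulr_ge0.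
have [N0 hN0] := Dc_tail MZ1; have [K hK] := hZ _ M81.
exists (maxn N1 (maxn N0 (K * N0.+1))) => n; rewrite !geq_max => /and3P[n1 n2 n3].
have -> : \sum_(1 <= c < n.+1) x c * (\sum_(1 <= k < (n %/ c).+1) w k)%:C - Sx * Z%:C =
  (Z%:C * \sum_(1 <= c < n.+1) x c - Z%:C * Sx) -
   (\sum_(1 <= c < N0.+1) x c * (Z - W (n %/ c)%N)%:C +
    \sum_(N0.+1 <= c < n.+1) x c * (Z - W (n %/ c)%N)%:C).
  rewrite -(big_cat_nat _ (n := N0.+1)) //=.
  have -> : \sum_(1 <= c < n.+1) x c * (Z - W (n %/ c)%N)%:C =
     Z%:C * \sum_(1 <= c < n.+1) x c - \sum_(1 <= c < n.+1) x c * (W (n %/ c)%N)%:C.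
    rewrite mulr_sumr -sumrB; apply: eq_bigr => c _.
    by rewrite (rmorphB (real_complex R)); ring.
  by rewrite /W; ring.
have -> : e = e / 3 + (e / 3 + e / 3) by field.
apply: (le_trans (nmB _ _)); apply: lerD; first exact: h1.
apply: (le_trans (nmD _ _)); apply: lerD.
  apply: (le_trans (nm_sum _ _ _)).
  apply: (@le_trans _ _ (\sum_(1 <= c < N0.+1) M * Dc R c * (e / (3 * (M * 81 + 1))))).
    rewrite big_nat [leRHS]big_nat; apply: ler_sum => c /andP[c0 cN].
    rewrite nmM nm_real; apply: ler_pM; rewrite ?nm_ge0 ?hx //.
    rewrite distrC; apply: hK; rewrite leq_divRL //.
    by apply: leq_trans n3; rewrite leq_mul2l ltnW ?orbT.
  rewrite -mulr_suml -mulr_sumr.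
  apply: (@le_trans _ _ (M * 81 * (e / (3 * (M * 81 + 1))))).
    by apply: ler_wpM2r; [rewrite divr_ge0 ?ltW // mulr_gt0 // ltr_wpDl // mulr_ge0 | apply: ler_wpM2l => //; exact: sum_Dc_le].
  rewrite mulrA ler_pdivrMr; last by rewrite mulr_gt0 // ltr_wpDl // mulr_ge0.
  have -> : e / 3 * (3 * (M * 81 + 1)) = (M * 81 + 1) * e by field.
  by apply: ler_wpM2r; [exact: ltW | lra].
apply: (le_trans (nm_sum _ _ _)).
apply: (@le_trans _ _ (\sum_(N0.+1 <= c < n.+1) M * Z * Dc R c)).
  rewrite big_nat [leRHS]big_nat; apply: ler_sum => c /andP[c0 cN].
  have c0' : (0 < c)%N by apply: leq_trans c0.
  rewrite nmM nm_real mulrAC; apply: ler_pM; rewrite ?nm_ge0 ?hx //.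
  have := W0 (n %/ c)%N; have := WZ (n %/ c)%N => a1 a2.
  by rewrite ger0_norm; lra.
rewrite -mulr_sumr; apply: (@le_trans _ _ (M * Z * (e / (3 * (M * Z + 1))))).
  by apply: ler_wpM2l => //; exact: mulr_ge0.
have MZ : 0 <= M * Z by exact: mulr_ge0.
rewrite mulrA ler_pdivrMr; last by rewrite mulr_gt0 // ltr_wpDl.
have -> : e / 3 * (3 * (M * Z + 1)) = (M * Z + 1) * e by field.
by apply: ler_wpM2r; [exact: ltW | lra].
Qed.

Lemma nm_ramanujan (c : nat) : (0 < c)%N -> nm (ramanujan c * (sq R c)%:C) <= (130 * m%:R + 1) * Dc R c.
Proof.
move=> c0; have h := nm_muc R 1 c0 m0.
have cR : (0 : R) < c%:R by rewrite ltr0n.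
move: h; rewrite /muc sum_kloos_ramanujan ?coprime1n // nmM nmV nm_nat ler_pM2r ?invr_gt0 // => h.
apply: le_trans (Bc_Dc R m c0); rewrite nmM nm_real ger0_norm ?sq_ge0 // /sq.
by apply: ler_wpM2r; [rewrite invr_ge0 exprn_ge0 // ltW | lra].
Qed.

(** For completely multiplicative w, the Dirichlet product of [ramanujan c * w c] with w has at N
    the value w(N) times the divisor sum of the Ramanujan sums, which is N or 0 according as N
    divides m or not. It is applied to w(n) = n^-2 and to its restriction to n prime to p. *)
Lemma ramanujan_zeta (w : nat -> R) (Z : R) (Sx : R[i]) :
  (forall n, 0 <= w n) -> (forall n, w n <= sq R n) -> (forall a b, w (a * b)%N = w a * w b) ->
  rcvg (fun n => \sum_(1 <= k < n.+1) w k) Z ->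
  ccvg (fun n => \sum_(1 <= c < n.+1) ramanujan c * (w c)%:C) Sx ->
  Sx * Z%:C = (\sum_(N <- divisors m) N%:R * w N)%:C.
Proof.
move=> w0 wsq wM hZ hS.
have M0 : 0 <= 130 * m%:R + 1 :> R by nneg.
have hx c : (0 < c)%N -> nm (ramanujan c * (w c)%:C) <= (130 * m%:R + 1) * Dc R c.
  move=> c0; apply: le_trans (nm_ramanujan c0); rewrite !nmM !nm_real !ger0_norm ?sq_ge0 //.
  by apply: ler_wpM2l; rewrite ?nm_ge0.
have := dirichlet_limit M0 hx w0 hZ hS; set u := fun n => _ => hu.
apply: (ccvg_unique hu) => e e0; exists m => n mn.
suff -> : u n = (\sum_(N <- divisors m) N%:R * w N)%:C by rewrite subrr nm0 ltW.
rewrite /u.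
transitivity (\sum_(1 <= N < n.+1) \sum_(c <- divisors N) ramanujan c * (w c * w (N %/ c)%N)%:C).
  rewrite (sum_divisors_exchange (fun c k => ramanujan c * (w c * w k)%:C)).
  rewrite big_nat [RHS]big_nat; apply: eq_bigr => c /andP[c0 cn].
  rewrite (rmorph_sum (real_complex R)) mulr_sumr.
  rewrite [RHS](eq_bigl (fun k => (k < (n %/ c).+1)%N)); last first.
    by move=> k; rewrite !ltnS leq_divRL // mulnC.
  rewrite (big_cat_nat _ (n := (n %/ c).+1) (P := fun k => (k < (n %/ c).+1)%N)) //=; last first.
    by rewrite ltnS leq_div.
  rewrite [X in _ = _ + X]big_nat_cond [X in _ = _ + X]big_pred0 ?addr0; last first.
    by move=> k; rewrite [(k < (n %/ c).+1)%N]ltnNge; case: leqP => //; rewrite ?andbF.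
  rewrite [RHS]big_nat_cond [LHS]big_nat_cond; apply: eq_big.
    by move=> k; rewrite andbT; case: (0 < k)%N => //=; rewrite andbb.
  by move=> k _; rewrite (rmorphM (real_complex R)) mulrA.
transitivity (\sum_(1 <= N < n.+1) (w N)%:C * (if (N %| m)%N then N%:R else 0)).
  rewrite big_nat [RHS]big_nat; apply: eq_bigr => N /andP[N0 _].
  rewrite -ramanujan_divisors // mulr_sumr big_seq [RHS]big_seq; apply: eq_bigr => c.
  by rewrite -dvdn_divisors // => cN; rewrite -wM mulnC divnK // mulrC.
rewrite (rmorph_sum (real_complex R)).
rewrite (eq_bigr (fun N => if (N %| m)%N then (N%:R * w N)%:C else 0)); last first.
  move=> N _; case: ifP; rewrite ?mulr0 // => _.
  by rewrite (rmorphM (real_complex R)) rmorph_nat mulrC.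
rewrite -big_mkcond -big_filter; apply: perm_big; apply: uniq_perm.
- by rewrite filter_uniq // iota_uniq.
- exact: divisors_uniq.
move=> N; rewrite mem_filter mem_index_iota -dvdn_divisors //.
case: (boolP (N %| m)%N) => //= Nm; rewrite (dvdn_gt0 m0 Nm) /= ltnS.
exact: leq_trans (dvdn_leq m0 Nm) mn.
Qed.

End Ramanujan.

Section CuspConstant.
Variables (R : realType) (p m : nat).
Hypotheses (pp : prime p) (m0 : (0 < m)%N).

Let p0 : (0 < p)%N. Proof. exact: prime_gt0. Qed.

Lemma row_scale_coprime c : coprime (row_scale p c) c.
Proof.
rewrite /row_scale; case: ifP => [_|h]; first by rewrite coprime1n.
by rewrite prime_coprime // h.
Qed.

Definition sqp (c : nat) : R := if (p %| c)%N then 0 else sq R c.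

Lemma sqpM a b : sqp (a * b) = sqp a * sqp b.
Proof.
rewrite /sqp Euclid_dvdM //; case: (p %| a)%N => /=; first by rewrite mul0r.
by case: ifP => _; rewrite ?mulr0 // sqM.
Qed.

Lemma sum_inv_divisors n : (0 < n)%N ->
  \sum_(N <- divisors n) N%:R * sq R N = (sigma n)%:R / n%:R.
Proof.
move=> n0; have nR : (n%:R : R) != 0 by rewrite pnatr_eq0 -lt0n.
have pm : perm_eq [seq (n %/ N)%N | N <- divisors n] (divisors n).
  apply: uniq_perm; rewrite ?divisors_uniq //.
    rewrite map_inj_in_uniq ?divisors_uniq // => a b.
    rewrite -!dvdn_divisors // => an bn h.
    by rewrite -(divn_divn n0 an) h divn_divn.
  move=> N; apply/mapP/idP => [[a]|].
    by rewrite -!dvdn_divisors // => an ->; exact: dvdn_div.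
  rewrite -dvdn_divisors // => Nn; exists (n %/ N)%N; last by rewrite divn_divn.
  by rewrite -dvdn_divisors // dvdn_div.
rewrite /sigma -(perm_big _ pm) /= big_map natr_sum mulr_suml.
rewrite big_seq [RHS]big_seq; apply: eq_bigr => N; rewrite -dvdn_divisors // => Nn.
have N0 : (N%:R : R) != 0 by rewrite pnatr_eq0 -lt0n (dvdn_gt0 n0 Nn).
have E : (n%:R : R) = (n %/ N)%N%:R * N%:R by rewrite -natrM divnK.
have q0 : ((n %/ N)%N%:R : R) != 0.
  by apply: contraNneq nR => h; rewrite E h mul0r.
by rewrite /sq E; field; rewrite q0 N0.
Qed.

Lemma sum_inv_divisors_p :
  \sum_(N <- divisors m) N%:R * sqp N =
  (sigma (m %/ p ^ logn p m))%:R / (m %/ p ^ logn p m)%N%:R.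
Proof.
set al := logn p m; set m' := (m %/ p ^ al)%N.
have pd : (p ^ al %| m)%N by rewrite pfactor_dvdnn.
have mE : m = (m' * p ^ al)%N by rewrite divnK.
have m'0 : (0 < m')%N by rewrite divn_gt0 ?expn_gt0 ?p0 // dvdn_leq.
have pm' : ~~ (p %| m')%N.
  apply/negP => h; have : (p ^ al.+1 %| m)%N.
    by rewrite mE expnS dvdn_mul // dvdnn.
  by rewrite pfactor_dvdn // ltnn.
rewrite -sum_inv_divisors //.
have -> : \sum_(N <- divisors m) N%:R * sqp N =
   \sum_(N <- divisors m | ~~ (p %| N)%N) N%:R * sq R N.
  rewrite [RHS]big_mkcond; apply: eq_bigr => N _; rewrite /sqp.
  by case: (p %| N)%N; rewrite ?mulr0.
rewrite -big_filter; apply: perm_big; apply: uniq_perm.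
- by rewrite filter_uniq // divisors_uniq.
- exact: divisors_uniq.
move=> N; rewrite mem_filter -!dvdn_divisors //; apply/andP/idP => [[pN]|Nm'].
  by rewrite mE Gauss_dvdl // coprimeXr // coprime_sym prime_coprime.
split; last by rewrite mE dvdn_mulr.
by apply: contra pm' => h; exact: dvdn_trans Nm'.
Qed.

(** A row contributes 4 pi^2 m / c^2 times its Ramanujan sum, with a further factor 1 / p if p does
    not divide c. This gives S1 - (1 - 1/p) S2, with S1 over all c and S2 over c prime to p. The
    Euler factor 1 - p^-2 belonging to S2 produces p / (p + 1), and zeta(2) turns 4 pi^2 into 24. *)
Lemma cusp_const_value : cusp_const R p m = - (cconst R p m)%:C.
Proof.
have [Z hZ] := mono_cvg (@Sq_mono R) (@Sq_le2 R).
have ZE := basel hZ; have pi0 := @pi_gt0 R.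
have piN : (pi : R) != 0 by rewrite gt_eqF.
have Z0 : Z != 0 by rewrite ZE mulf_neq0 ?expf_neq0 ?invr_eq0 ?pnatr_eq0.
have pR : (1 : R) < p%:R by rewrite ltr1n prime_gt1.
have M0 : 0 <= 130 * m%:R + 1 :> R by nneg.
have sqp0 n : 0 <= sqp n by rewrite /sqp; case: ifP => // _; exact: sq_ge0.
have sqp_le n : sqp n <= sq R n by rewrite /sqp; case: ifP => // _; exact: sq_ge0.
have h1 c : (0 < c)%N -> nm (ramanujan R m c * (sq R c)%:C) <= (130 * m%:R + 1) * Dc R c.
  exact: nm_ramanujan.
have h2 c : (0 < c)%N -> nm (ramanujan R m c * (sqp c)%:C) <= (130 * m%:R + 1) * Dc R c.
  move=> c0; apply: le_trans (h1 c c0); rewrite !nmM !nm_real !ger0_norm ?sq_ge0 //.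
  by apply: ler_wpM2l; rewrite ?nm_ge0.
have := series_cvg M0 h1; set S1 := limn _ => hS1.
have := series_cvg M0 h2; set S2 := limn _ => hS2.
have hZp : rcvg (fun n => \sum_(1 <= k < n.+1) sqp k) ((1 - sq R p) * Z).
  exact: (Sqp_cvg p0 hZ).
have E1 := ramanujan_zeta m0 (@sq_ge0 R) (fun n => lexx _) (@sqM R) hZ hS1.
have E2 := ramanujan_zeta m0 sqp0 sqp_le sqpM hZp hS2.
rewrite sum_inv_divisors // in E1; rewrite sum_inv_divisors_p in E2.
set s : R := (sigma m)%:R in E1; set m' := (m %/ p ^ logn p m)%N in E2.
set s' : R := (sigma m')%:R in E2.
set P : R := p%:R in pR.
have sqP : 1 - sq R p = 1 - P ^- 2 by [].
have P1 : 1 - P ^- 2 != 0.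
  rewrite subr_eq0 eq_sym invr_eq1; apply/eqP; nra.
have CN (x : R) : x != 0 -> x%:C != 0 :> R[i].
  by move=> h; rewrite eq_complex /= negb_and h.
have S1E : S1 = (s / m%:R / Z)%:C.
  apply: (@mulIf _ Z%:C); first exact: CN.
  by rewrite E1 -(rmorphM (real_complex R)) divfK.
have S2E : S2 = (s' / m'%:R / ((1 - P ^- 2) * Z))%:C.
  apply: (@mulIf _ ((1 - P ^- 2) * Z)%:C); first by apply: CN; rewrite mulf_neq0.
  by rewrite -sqP E2 -(rmorphM (real_complex R)) divfK // mulf_neq0.
have hC : ccvg (fun n => \sum_(1 <= c < n.+1) row_const R p m c)
   ((4 * pi ^+ 2 * m%:R)%:C * (S1 + (- (1 - P^-1))%:C * S2)).
  have := ccvgZ (4 * pi ^+ 2 * m%:R)%:C (ccvgD hS1 (ccvgZ (- (1 - P^-1))%:C hS2)).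
  congr ccvg; apply/funext => n; rewrite mulr_sumr -big_split mulr_sumr /=.
  rewrite big_nat [RHS]big_nat; apply: eq_bigr => c /andP[c0 _].
  have cR : (c%:R : R) != 0 by rewrite pnatr_eq0 -lt0n.
  rewrite /row_const /Vconst /muc sum_kloos_ramanujan // ?row_scale_coprime // natC -(fmorphV (real_complex R)).
  transitivity ((4 * pi * m%:R / ((row_scale p c)%:R * c%:R) * c%:R^-1 * pi)%:C * ramanujan R m c); last first.
    by rewrite !(rmorphM (real_complex R)); ring.
  transitivity ((4 * pi ^+ 2 * m%:R * (sq R c + (- (1 - P^-1)) * sqp c))%:C * ramanujan R m c).
    have aux (x y k w : R) (r : R[i]) : x%:C * (r * y%:C + k%:C * (r * w%:C)) = (x * (y + k * w))%:C * r.
      by rewrite (rmorphM (real_complex R)) (rmorphD (real_complex R)) (rmorphM (real_complex R)); ring.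
    by rewrite -aux.
  congr (_%:C * _); rewrite /sqp /row_scale /sq; case: ifP => _; field; rewrite cR //=;
    by rewrite gt_eqF // -/P; lra.
have := ccvg_unique (@cusp_const_cvg R _ _ p0 m0) hC => ->.
rewrite S1E S2E -(rmorphM (real_complex R)) -(rmorphD (real_complex R)) -(rmorphM (real_complex R)) -(rmorphN (real_complex R)).
congr (_%:C); rewrite /cconst -/m' -/s -/s' -/P.
have pd : (p ^ logn p m %| m)%N by rewrite pfactor_dvdnn.
have m'0 : (0 < m')%N by rewrite divn_gt0 ?expn_gt0 ?p0 // dvdn_leq.
have mE : (m%:R : R) = m'%:R * P ^+ logn p m by rewrite /P -natrX -natrM divnK.
have m'R : (m'%:R : R) != 0 by rewrite pnatr_eq0 -lt0n.
have PN : P != 0 by rewrite gt_eqF //; lra.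
have PaN : P ^+ logn p m != 0 by rewrite expf_neq0.
have P1N : P + 1 != 0 by rewrite gt_eqF //; lra.
have P2N : P - 1 != 0 by rewrite gt_eqF //; lra.
have -> : 1 - P ^- 2 = (P - 1) * (P + 1) / P ^+ 2 by field.
rewrite ZE mE [P ^+ (logn p m).+1]exprS; move: PaN piN; set Q := P ^+ _; move: (pi : R) => Pi PaN PiN.
by field; rewrite PaN P1N P2N PN m'R PiN.
Qed.

End CuspConstant.

(** * The group *)

Section Matrices.
Variable R : realType.
Implicit Types (g h : 'M[R]_2) (z w : R[i]).

Lemma mx2E (T : Type) (a b c d : T) :
  [/\ mx2 a b c d 0 0 = a, mx2 a b c d 0 1 = b, mx2 a b c d 1 0 = c & mx2 a b c d 1 1 = d].
Proof. by rewrite !mxE. Qed.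

Lemma mx2_eta (T : Type) (g : 'M[T]_2) : g = mx2 (g 0 0) (g 0 1) (g 1 0) (g 1 1).
Proof.
apply/matrixP => i j; rewrite mxE.
have o2 (k : 'I_2) : k = 0 \/ k = 1.
  by case: k => [[|[|//]] hk]; [left|right]; apply: val_inj.
by have [->|->] := o2 i; have [->|->] := o2 j.
Qed.

Lemma mul_mx2 (T : pzRingType) (a b c d a' b' c' d' : T) :
  mx2 a b c d *m mx2 a' b' c' d' =
  mx2 (a * a' + b * c') (a * b' + b * d') (c * a' + d * c') (c * b' + d * d').
Proof.
rewrite [LHS]mx2_eta; congr mx2; rewrite mxE !big_ord_recl big_ord0 addr0 !mxE //=.
Qed.

Lemma det_mx2 (T : comPzRingType) (a b c d : T) : \det (mx2 a b c d) = a * d - b * c.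
Proof.
rewrite (expand_det_row _ 0) !big_ord_recl big_ord0 /cofactor !det_mx11 !mxE /=.
by rewrite expr0 expr1 mul1r mulN1r addr0 mulrN.
Qed.

Lemma inv_mx2 (a b c d : R) : a * d - b * c = 1 -> invmx (mx2 a b c d) = mx2 d (- b) (- c) a.
Proof.
move=> h; have u : mx2 a b c d \in unitmx by rewrite unitmxE det_mx2 h unitr1.
apply: (can_inj (mulKmx u)); rewrite mulmxV // mul_mx2.
rewrite [LHS]mx2_eta !mxE /=; congr mx2; first 1 last.
- by rewrite /=; ring.
- by rewrite /=; ring.
- by rewrite /= -h; ring.
by rewrite /= -h; ring.
Qed.

Lemma det2 g : \det g = g 0 0 * g 1 1 - g 0 1 * g 1 0.
Proof. by rewrite {1}(mx2_eta g) det_mx2. Qed.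

Lemma mulmx2 g h : [/\ (g *m h) 0 0 = g 0 0 * h 0 0 + g 0 1 * h 1 0,
   (g *m h) 0 1 = g 0 0 * h 0 1 + g 0 1 * h 1 1,
   (g *m h) 1 0 = g 1 0 * h 0 0 + g 1 1 * h 1 0 &
   (g *m h) 1 1 = g 1 0 * h 0 1 + g 1 1 * h 1 1].
Proof.
have -> : g *m h = mx2 (g 0 0 * h 0 0 + g 0 1 * h 1 0) (g 0 0 * h 0 1 + g 0 1 * h 1 1)
   (g 1 0 * h 0 0 + g 1 1 * h 1 0) (g 1 0 * h 0 1 + g 1 1 * h 1 1).
  by rewrite -mul_mx2 -!mx2_eta.
exact: mx2E.
Qed.

Lemma det1_int (T : comNzRingType) (n : nat) (a b c d : int) : n%:Z * a * d - b * c = 1 ->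
  n%:R * a%:~R * d%:~R - b%:~R * c%:~R = 1 :> T.
Proof. by move=> h; rewrite -[RHS]/(1%:~R) -h rmorphB /= !intrM. Qed.

Definition jm g z : R[i] := (g 1 0)%:C * z + (g 1 1)%:C.

Lemma Im_affine (a b : R) z : complex.Im (a%:C * z + b%:C) = a * complex.Im z.
Proof. by case: z => x y /=; ring. Qed.
Lemma Re_affine (a b : R) z : complex.Re (a%:C * z + b%:C) = a * complex.Re z + b.
Proof. by case: z => x y /=; ring. Qed.

Lemma jm_neq0 g z : \det g = 1 -> 0 < complex.Im z -> jm g z != 0.
Proof.
move=> hg z0; apply/eqP => h; have := hg; rewrite (mx2_eta g) det_mx2.
have /eqP := congr1 (@complex.Im R) h; rewrite Im_affine /= mulf_eq0 (gt_eqF z0) orbF => /eqP c0.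
have := congr1 (@complex.Re R) h; rewrite Re_affine c0 mul0r add0r /= => ->.
by rewrite !mulr0 subrr => /eqP; rewrite eq_sym oner_eq0.
Qed.

Lemma divc (u v : R[i]) : v != 0 -> u / v = (nm v ^- 2)%:C * (u * conjc v).
Proof.
move=> v0; have n0 : nm v ^+ 2 != 0 by rewrite expf_neq0 // gt_eqF // nm_gt0.
have h : (nm v ^+ 2)%:C != 0 by rewrite eq_complex /= eqxx andbT.
rewrite (fmorphV (real_complex R)) /= nm_sqrC; move: h; rewrite nm_sqrC mulf_eq0 negb_or => /andP[_ h].
by field; rewrite v0 h.
Qed.

Lemma mobius_parts g z : \det g = 1 -> 0 < complex.Im z ->
  complex.Im (mobius g z) = complex.Im z / nm (jm g z) ^+ 2 /\
  complex.Re (mobius g z) = ((g 0 0 * complex.Re z + g 0 1) * (g 1 0 * complex.Re z + g 1 1)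
    + g 0 0 * g 1 0 * complex.Im z ^+ 2) / nm (jm g z) ^+ 2.
Proof.
move=> hg z0; rewrite /mobius divc ?jm_neq0 // -/(jm g z).
set n := nm _ ^- 2; rewrite ReZ ImZ /n ![_^-1 * _]mulrC.
have := hg; rewrite det2 => d1.
rewrite /jm; case: z z0 {n} => x y /= _; split; congr (_ / _); last by ring.
by rewrite -[RHS]mul1r -d1; ring.
Qed.

Lemma Im_mobius g z : \det g = 1 -> 0 < complex.Im z ->
  complex.Im (mobius g z) = complex.Im z / nm (jm g z) ^+ 2.
Proof. by move=> hg z0; case: (mobius_parts hg z0). Qed.

Lemma Im_mobius_gt0 g z : \det g = 1 -> 0 < complex.Im z -> 0 < complex.Im (mobius g z).
Proof.
by move=> hg z0; rewrite Im_mobius // divr_gt0 // exprn_gt0 // nm_gt0 // jm_neq0.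
Qed.

Lemma mobiusM g h z : \det g = 1 -> \det h = 1 -> 0 < complex.Im z ->
  mobius (g *m h) z = mobius g (mobius h z).
Proof.
move=> hg hh z0; have j0 := jm_neq0 hh z0.
have j1 : jm (g *m h) z != 0 by apply: jm_neq0; rewrite // det_mulmx hg hh mulr1.
have j2 := jm_neq0 hg (Im_mobius_gt0 hh z0).
move: j0 j1 j2; rewrite /mobius /jm.
case: (mulmx2 g h) => -> -> -> ->.
have E (x y u v : R) : (x * y + u * v)%:C = x%:C * y%:C + u%:C * v%:C.
  by apply: complex_eq => /=; ring.
rewrite !E.
move: (g 0 0)%:C (g 0 1)%:C (g 1 0)%:C (g 1 1)%:C (h 0 0)%:C (h 0 1)%:C (h 1 0)%:C (h 1 1)%:C.
move=> a b c d a' b' c' d' j0 j1 j2; field; rewrite j0 /=.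
by apply: contraNneq j1 => e; apply/eqP; rewrite -[RHS]e; ring.
Qed.

Lemma mobius1 z : mobius 1%:M z = z.
Proof. by rewrite /mobius !mxE /= mul1r addr0 mul0r add0r divr1. Qed.

Lemma mobiusN g z : mobius (- g) z = mobius g z.
Proof.
rewrite /mobius !mxE !(rmorphN (real_complex R)) /= !mulNr -!opprD invrN mulrNN //.
Qed.

Lemma detV1 g : \det g = 1 -> \det (invmx g) = 1.
Proof. by move=> h; rewrite det_inv h invr1. Qed.

Lemma unit_det1 g : \det g = 1 -> g \in unitmx.
Proof. by move=> h; rewrite unitmxE h unitr1. Qed.

Lemma mobiusVK g z : \det g = 1 -> 0 < complex.Im z -> mobius (invmx g) (mobius g z) = z.
Proof. by move=> h z0; rewrite -mobiusM ?detV1 // mulVmx ?unit_det1 // mobius1. Qed.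
Lemma mobiusKV g z : \det g = 1 -> 0 < complex.Im z -> mobius g (mobius (invmx g) z) = z.
Proof. by move=> h z0; rewrite -mobiusM ?detV1 // mulmxV ?unit_det1 // mobius1. Qed.

Definition trans (k : int) : 'M[R]_2 := mx2 1 k%:~R 0 1.

Lemma det_trans k : \det (trans k) = 1.
Proof. by rewrite det_mx2 mulr1 mulr0 subr0. Qed.

Lemma mobius_trans k z : mobius (trans k) z = z + k%:~R.
Proof.
rewrite /mobius; case: (mx2E (1 : R) k%:~R 0 1) => -> -> -> ->.
by rewrite mul1r mul0r add0r divr1 -intC.
Qed.

(* A matrix of determinant 1 acting trivially is a scalar, hence 1 or -1. *)
Lemma mobius_inj_pm g h : \det g = 1 -> \det h = 1 ->
  (forall z, 0 < complex.Im z -> mobius g z = mobius h z) -> g = h \/ g = - h.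
Proof.
move=> hg hh H; pose k := invmx h *m g.
have hk : \det k = 1 by rewrite det_mulmx detV1 // mul1r.
have gE : g = h *m k by rewrite mulKVmx ?unit_det1.
have fixk z : 0 < complex.Im z -> mobius k z = z.
  by move=> z0; rewrite mobiusM ?detV1 // H // mobiusVK.
have key (y : R) : 0 < y -> (k 0 0)%:C * (0 +i* y) + (k 0 1)%:C = (0 +i* y) * jm k (0 +i* y).
  move=> y0; have z0 : 0 < complex.Im (0 +i* y) by [].
  by rewrite -[X in _ = X * _](fixk _ z0) /mobius -/(jm k _) divfK ?jm_neq0.
have e y (y0 : 0 < y) : k 0 1 = - (k 1 0 * y ^+ 2) /\ k 0 0 * y = k 1 1 * y.
  move: (key y y0) => h1.
  have := congr1 (@complex.Re R) h1; have := congr1 (@complex.Im R) h1.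
  by rewrite /jm /= => h2 h3; split; [move: h3|move: h2]; rewrite !(mul0r, mulr0, oppr0, addr0, add0r, subr0, sub0r) // mulrC => ->; ring.
have [e1 e2] := e 1 ltac:(by []); have [e3 _] := e 2 ltac:(by []).
have c0 : k 1 0 = 0 by lra.
have b0 : k 0 1 = 0 by rewrite e1 c0; ring.
have ad : k 0 0 = k 1 1 by lra.
have := hk; rewrite (mx2_eta k) det_mx2 c0 b0 ad mulr0 subr0 -expr2 => /eqP.
rewrite sqrf_eq1 => kk.
have kE : k = (k 1 1)%:M.
  rewrite [LHS]mx2_eta [RHS]mx2_eta c0 b0 ad !mxE //=.
case/orP: kk => /eqP k1; [left|right]; rewrite gE kE k1 ?mulmx1 //.
by rewrite raddfN mulmxN mulmx1.
Qed.

End Matrices.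

Section GroupStructure.
Variables (R : realType) (p : nat).
Hypothesis pp : prime p.

Let p0 : (0 < p)%N. Proof. exact: prime_gt0. Qed.
Let s : R := Num.sqrt p%:R.
Let s0 : s != 0. Proof. by rewrite sqrtr_eq0 -ltNge ltr0n. Qed.
Let s2 : (p%:R : R) = s ^+ 2. Proof. by rewrite sqr_sqrtr. Qed.

(** [G1] and [Gp] are the two cosets of Gamma_0(p) in the group, with sqrt p made explicit, so that
    membership becomes a condition on four integers. *)
Definition G1 (g : 'M[R]_2) := exists a b c d : int,
  a * d - p%:Z * b * c = 1 /\ g = mx2 a%:~R b%:~R (p%:R * c%:~R) d%:~R.
Definition Gp (g : 'M[R]_2) := exists a b c d : int,
  p%:Z * a * d - b * c = 1 /\ g = mx2 (s * a%:~R) (b%:~R / s) (s * c%:~R) (s * d%:~R).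

Lemma G1_intr g : Gamma0 p g -> G1 (map_mx intr g).
Proof.
move=> [hd /dvdzP [c hc]]; exists (g 0 0), (g 0 1), c, (g 1 1).
move: hd; rewrite {1}(mx2_eta g) det_mx2 hc => hd; split; first by rewrite -hd; ring.
by rewrite [LHS]mx2_eta !mxE /= hc intrM mulrC -pmulrn.
Qed.

(** By induction on the generation: in a product of two elements of [Gp] the factors sqrt p combine
    to p, which leads back to [G1]. *)
Lemma Gamma0star_split g : Gamma0star p g -> G1 g \/ Gp g.
Proof.
elim=> {g} [g /G1_intr|||].
- by left.
- right; exists 0, (-1), 1, 0; split; first by ring.
  rewrite /Fricke [LHS]mx2_eta !mxE /= -/s s2; congr mx2; field; rewrite ?s0 //.
- move=> g h _ [|] [a [b [c [d [e ->]]]]] _ [|] [a' [b' [c' [d' [e' ->]]]]]; rewrite mul_mx2.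
  + left; exists (a * a' + p%:Z * b * c'), (a * b' + b * d'), (c * a' + d * c'), (p%:Z * c * b' + d * d').
    split; last by rewrite !(intrD, intrM) -!pmulrn; congr mx2; ring.
    by rewrite -[RHS]mulr1 -{1}e -e'; ring.
  + right; exists (a * a' + b * c'), (a * b' + p%:Z * b * d'), (p%:Z * c * a' + d * c'), (c * b' + d * d').
    split; last by rewrite !(intrD, intrM) -!pmulrn s2; congr mx2; field; rewrite ?s0 //.
    by rewrite -[RHS]mulr1 -{1}e -e'; ring.
  + right; exists (a * a' + b * c'), (p%:Z * a * b' + b * d'), (c * a' + p%:Z * d * c'), (c * b' + d * d').
    split; last by rewrite !(intrD, intrM) -!pmulrn s2; congr mx2; field; rewrite ?s0 //.
    by rewrite -[RHS]mulr1 -{1}e -e'; ring.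
  + left; exists (p%:Z * a * a' + b * c'), (a * b' + b * d'), (c * a' + d * c'), (c * b' + p%:Z * d * d').
    split; last by rewrite !(intrD, intrM) -!pmulrn s2; congr mx2; field; rewrite ?s0 //.
    by rewrite -[RHS]mulr1 -{1}e -e'; ring.
move=> g _ [|] [a [b [c [d [e ->]]]]]; rewrite inv_mx2.
- left; exists d, (- b), (- c), a; split; first by rewrite -e; ring.
  by rewrite !rmorphN /= mulrN.
- have e' : 1%:Z * a * d - (p%:Z * b) * c = 1 by rewrite -e; ring.
  by have := det1_int R e'; rewrite intrM -pmulrn => h; rewrite -[RHS]h; ring.
- right; exists d, (- b), (- c), a; split; first by rewrite -e; ring.
  by rewrite !rmorphN /= mulrN mulNr.
have := det1_int R e; rewrite s2 => h; rewrite -[RHS]h.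
by field; rewrite ?s0 //.
Qed.

(* The general element of Gamma_0^*(p), by [Gamma0starP]. *)
Definition gm (a b c d : int) : 'M[R]_2 :=
  mx2 (Num.sqrt (row_scale p `|c|)%:R * a%:~R) (b%:~R / Num.sqrt (row_scale p `|c|)%:R)
      (Num.sqrt (row_scale p `|c|)%:R * c%:~R) (Num.sqrt (row_scale p `|c|)%:R * d%:~R).
Definition gm_cond (a b c d : int) := (row_scale p `|c|)%:Z * a * d - b * c = 1.

Lemma row_scale_dvd (c : int) : (p%:Z %| c)%Z -> row_scale p `|c| = 1%N.
Proof. by rewrite /row_scale dvdzE /= => ->. Qed.
Lemma row_scale_ndvd (c : int) : ~~ (p%:Z %| c)%Z -> row_scale p `|c| = p.
Proof. by rewrite /row_scale dvdzE /= => /negbTE ->. Qed.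

(** Divisibility of c by p tells the cosets apart, since p a d - b c = 1 excludes p | c in [Gp].
    Conversely, a matrix of the second shape is the Fricke matrix times an element of Gamma_0(p). *)
Lemma Gamma0starP g : Gamma0star p g <->
  exists a b c d : int, gm_cond a b c d /\ g = gm a b c d.
Proof.
split=> [/Gamma0star_split [|] [a [b [c [d [e ->]]]]]|[a [b [c [d [e ->]]]]]].
- exists a, b, (p%:Z * c), d; rewrite /gm_cond /gm row_scale_dvd ?dvdz_mulr //.
  rewrite sqrtr1 !mul1r divr1 intrM -pmulrn; split=> //.
  by rewrite -e; ring.
- have pc : ~~ (p%:Z %| c)%Z.
    apply/negP => pc; have : (p%:Z %| p%:Z * a * d - b * c)%Z.
      by apply: rpredB; [rewrite -mulrA dvdz_mulr | exact: dvdz_mull].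
    by rewrite e dvdzE /= dvdn1 => /eqP p1; move: pp; rewrite p1.
  by exists a, b, c, d; rewrite /gm_cond /gm row_scale_ndvd.
have [pc|pc] := boolP (p%:Z %| c)%Z.
  move: e; rewrite /gm_cond /gm row_scale_dvd // sqrtr1 !mul1r divr1 => e.
  have -> : mx2 a%:~R b%:~R c%:~R d%:~R = map_mx intr (mx2 a b c d) :> 'M[R]_2.
    by rewrite [RHS]mx2_eta !mxE.
  apply: Gamma0star_Gamma0; split; last by rewrite mxE.
  by rewrite det_mx2 -e; ring.
move: e; rewrite /gm_cond /gm row_scale_ndvd // -/s => e.
have -> : mx2 (s * a%:~R) (b%:~R / s) (s * c%:~R) (s * d%:~R) =
   Fricke R p *m map_mx intr (mx2 c d (- (p%:Z * a)) (- b)).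
  rewrite /Fricke -/s -scalemxAl.
  have -> : map_mx intr (mx2 c d (- (p%:Z * a)) (- b)) =
     mx2 c%:~R d%:~R (- (p%:R * a%:~R)) (- b%:~R) :> 'M[R]_2.
    by rewrite [LHS]mx2_eta !mxE /= !rmorphN /= intrM -pmulrn.
  rewrite mul_mx2 s2 [RHS]mx2_eta !mxE /=; congr mx2; field; rewrite ?s0 //.
apply: Gamma0star_mul; first exact: Gamma0star_Fricke.
apply: Gamma0star_Gamma0; split; last by rewrite mxE /= dvdzE abszN abszM dvdn_mulr.
by rewrite det_mx2 -e; ring.
Qed.

Lemma sqrt_row_scale_gt0 c : 0 < Num.sqrt (row_scale p c)%:R :> R.
Proof. by rewrite sqrtr_gt0 ltr0n row_scale_gt0. Qed.

Lemma det_gm a b c d : gm_cond a b c d -> \det (gm a b c d) = 1.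
Proof.
move=> e; rewrite det_mx2; have := sqrt_row_scale_gt0 `|c|; set l : R := Num.sqrt _ => l0.
have l2 : (row_scale p `|c|)%:R = l ^+ 2 :> R by rewrite sqr_sqrtr.
have := det1_int R e; rewrite l2 => h; rewrite -[RHS]h.
by field; rewrite gt_eqF.
Qed.

Lemma det_Gstar (g : 'M[R]_2) : Gamma0star p g -> \det g = 1.
Proof. by move/Gamma0starP => [a [b [c [d [e ->]]]]]; exact: det_gm. Qed.

Lemma Gstar_trans k : Gamma0star p (trans R k).
Proof.
have -> : trans R k = map_mx intr (mx2 1 k 0 1 : 'M[int]_2).
  by rewrite [RHS]mx2_eta !mxE.
by apply: Gamma0star_Gamma0; split; [rewrite det_mx2 mulr1 mulr0 subr0 | rewrite mxE dvdz0].
Qed.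

Lemma Gstar1 : Gamma0star p (1%:M : 'M[R]_2).
Proof. by rewrite -(map_mx1 (intr : {rmorphism int -> R})); apply: Gamma0star_Gamma0; split; [rewrite det1 | rewrite mxE dvdz0]. Qed.

Lemma GstarN (g : 'M[R]_2) : Gamma0star p g -> Gamma0star p (- g).
Proof.
move=> hg; have -> : - g = map_mx intr (- 1%:M : 'M[int]_2) *m g.
  by rewrite map_mxN map_mx1 mulNmx mul1mx.
apply: Gamma0star_mul => //; apply: Gamma0star_Gamma0; split.
  by rewrite -scaleN1r detZ det1 mulr1 sqrrN expr1n.
by rewrite !mxE /= oppr0 dvdz0.
Qed.

End GroupStructure.

Section PairLists.
Variables (S T : eqType) (s : seq S) (t : S -> seq T).

Lemma uniq_dep_pairs : uniq s -> (forall x, x \in s -> uniq (t x)) ->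
  uniq [seq (x, y) | x <- s, y <- t x].
Proof. by move=> us ut; apply: allpairs_uniq_dep => // -[x y] [x' y'] _ _ /= [-> ->]. Qed.

Lemma mem_dep_pairs x y :
  ((x, y) \in [seq (x, y) | x <- s, y <- t x]) = (x \in s) && (y \in t x).
Proof.
apply/allpairsPdep/andP => [[x' [y' [h1 h2 [-> ->]]]] //|[h1 h2]].
by exists x, y.
Qed.
End PairLists.

Section Intervals.
Variable R : realType.

Definition itv_lo (s : R) : int := Num.floor s + 1.
(** Truncated at 0, so that an empty interval yields an empty window. *)
Definition itv_len (s t : R) : nat := `|(Num.max 0 (- Num.floor (- t) - itv_lo s))%R|%N.

Lemma itvP (s t : R) (d : int) :
  (s < d%:~R < t) = (itv_lo s <= d < itv_lo s + (itv_len s t)%:Z).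
Proof.
have -> : (s < d%:~R) = (itv_lo s <= d) by rewrite -floor_lt_int /itv_lo lezD1.
have -> : (d%:~R < t) = (d < - Num.floor (- t)).
  by rewrite ltrNr floor_lt_int mulrNz ltrN2.
rewrite /itv_len abszE ger0_norm ?le_max ?lexx //.
by set f := Num.floor (- t); set l := itv_lo s; move: f l => f l; lia.
Qed.

(** The strip is (-1, 0] rather than [0, 1) because Re z_Q = -b / 2a: it then corresponds to 0 <= b
    < 2a. *)
Definition strip_shift (x : R) : int := Num.floor (- x).

Lemma strip_shiftP (x : R) (k : int) : (-1 < x + k%:~R <= 0) = (k == strip_shift x).
Proof.
rewrite /strip_shift eq_sym floor_eq rmorphD /=.
by apply/andP/andP => -[h1 h2]; split; lra.
Qed.

Lemma strip_shift_itv (x : R) : -1 < x + (strip_shift x)%:~R <= 0.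
Proof. by rewrite strip_shiftP. Qed.

End Intervals.

(** * The truncated series, enumerated by lower rows *)

Section Rows.
Variables (R : realType) (p : nat).
Hypothesis pp : prime p.
Implicit Types (z w : R[i]) (a b d : int) (c m : nat).

Let p0 : (0 < p)%N. Proof. exact: prime_gt0. Qed.

Definition in_strip (e : R) w := [/\ e < complex.Im w, -1 < complex.Re w & complex.Re w <= 0].
Definition strip_elts (e : R) z : set 'M[R]_2 := [set g | Gamma0star p g /\ in_strip e (mobius g z)].
(* The cut-off on the height of [g z] makes invariance evident; the factor 1/2
   accounts for [g] and [- g]. *)
Definition poincare_cut m (e : R) z : R[i] := 2^-1 * \sum_(g \in strip_elts e z) phi m (mobius g z).

(** The matrix shows c only multiplied by the square root of lam = [row_scale p c]. As lam c^2
    contains p to an even power if p | c and to the first power otherwise, lam can be read off. *)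
Lemma gm_inj a b (c : int) d a' b' (c' : int) d' : 0 < c -> 0 < c' ->
  gm_cond p a b c d -> gm_cond p a' b' c' d' ->
  gm R p a b c d = gm R p a' b' c' d' -> [/\ a = a', b = b', c = c' & d = d'].
Proof.
move=> c0 c'0 h h' e.
have E i j : gm R p a b c d i j = gm R p a' b' c' d' i j by rewrite e.
move: (E 0 0) (E 0 1) (E 1 0) (E 1 1) => {E e}; rewrite /gm.
case: (mx2E (Num.sqrt (row_scale p `|c|)%:R * a%:~R : R) (b%:~R / Num.sqrt (row_scale p `|c|)%:R)
      (Num.sqrt (row_scale p `|c|)%:R * c%:~R) (Num.sqrt (row_scale p `|c|)%:R * d%:~R)) => -> -> -> ->.
case: (mx2E (Num.sqrt (row_scale p `|c'|)%:R * a'%:~R : R) (b'%:~R / Num.sqrt (row_scale p `|c'|)%:R)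
      (Num.sqrt (row_scale p `|c'|)%:R * c'%:~R) (Num.sqrt (row_scale p `|c'|)%:R * d'%:~R)) => -> -> -> ->.
have L0 := sqrt_row_scale_gt0 R pp `|c|; have L0' := sqrt_row_scale_gt0 R pp `|c'|.
move=> ea eb ec ed.
have cc : (row_scale p `|c| * (`|c| * `|c|) = row_scale p `|c'| * (`|c'| * `|c'|))%N.
  apply/eqP; rewrite -(eqr_nat R) !natrM.
  have cE (x : int) : 0 < x -> (`|x|%N%:R : R) = x%:~R by case: x.
  rewrite !cE // -[X in X * _ == _](sqr_sqrtr (ler0n _ _)) -[X in _ == X * _](sqr_sqrtr (ler0n _ _)).
  by rewrite -!expr2 -!exprMn ec.
have lE : row_scale p `|c| = row_scale p `|c'|.
  have aux (x y : nat) : (p %| x)%N -> ~~ (p %| y)%N ->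
      (x * x = p * (y * y))%N -> False.
    move=> /dvdnP [k ->] py E; move: py; apply/negP; rewrite negbK.
    have : (k * k * p = y * y)%N.
      by apply/eqP; rewrite -(eqn_pmul2l p0) -E; apply/eqP; ring.
    by move=> E'; have : (p %| y * y)%N; [rewrite -E' dvdn_mull | rewrite Euclid_dvdM // orbb].
  move: cc; rewrite /row_scale; case: (boolP (p %| `|c|)%N) => h1; case: (boolP (p %| `|c'|)%N) => h2 //.
    by rewrite mul1n => E; case: (aux _ _ h1 h2 E).
  by rewrite mul1n => /esym E; case: (aux _ _ h2 h1 E).
move: ea eb ec ed; rewrite -lE; set l : R := Num.sqrt _ in L0 *.
have lN : l != 0 by rewrite gt_eqF.
move=> /(mulfI lN) /(@intr_inj R) -> /(mulIf (invr_neq0 lN)) /(@intr_inj R) ->.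
by move=> /(mulfI lN) /(@intr_inj R) -> /(mulfI lN) /(@intr_inj R) ->.
Qed.

Lemma nm_jm_gm a b c d z : nm (jm (gm R p a b c%:Z d) z) ^+ 2 =
  (row_scale p c)%:R * nm (c%:R * z + d%:~R) ^+ 2.
Proof.
rewrite /jm /gm; case: (mx2E (Num.sqrt (row_scale p c)%:R * a%:~R : R) (b%:~R / Num.sqrt (row_scale p c)%:R)
      (Num.sqrt (row_scale p c)%:R * c%:Z%:~R) (Num.sqrt (row_scale p c)%:R * d%:~R)) => _ _ -> ->.
have -> : (Num.sqrt (row_scale p c)%:R * c%:Z%:~R)%:C * z + (Num.sqrt (row_scale p c)%:R * d%:~R)%:C =
  (Num.sqrt (row_scale p c)%:R)%:C * (c%:R * z + d%:~R) :> R[i].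
  by rewrite !(rmorphM (real_complex R)) -pmulrn natC intC; ring.
by rewrite nmM nm_real exprMn real_normK ?num_real // sqr_sqrtr.
Qed.

(** Apart from a / c the value depends only on the lower row, so a enters [phi] through a root of
    unity. *)
Lemma mobius_gm a b c d z : (0 < c)%N -> gm_cond p a b c%:Z d -> 0 < complex.Im z ->
  mobius (gm R p a b c%:Z d) z =
  (a%:~R / c%:R : R)%:C - ((row_scale p c)%:R * c%:R * (c%:R * z + d%:~R))^-1.
Proof.
move=> c0 h z0; have j0 := jm_neq0 (det_gm R pp h) z0.
move: j0; rewrite /mobius /jm /gm; set l : R := Num.sqrt _.
case: (mx2E (l * a%:~R) (b%:~R / l) (l * c%:Z%:~R) (l * d%:~R)) => -> -> -> ->.
have l0 : l != 0 by rewrite gt_eqF // sqrt_row_scale_gt0.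
have lC : l%:C != 0 :> R[i] by rewrite eq_complex /= eqxx andbT.
have l2 : ((row_scale p c)%:R : R[i]) = l%:C ^+ 2.
  by rewrite natC -[in LHS](sqr_sqrtr (ler0n R _)) (rmorphXn (real_complex R)).
have e := det1_int R[i] h; rewrite l2 -pmulrn in e.
rewrite !(rmorphM (real_complex R)) !(fmorphV (real_complex R)) -pmulrn /= -!natC -!intC l2.
have cN : (c%:R : R[i]) != 0 by rewrite pnatr_eq0 -lt0n.
move: (a%:~R : R[i]) (b%:~R : R[i]) (d%:~R : R[i]) (c%:R : R[i]) (l%:C : R[i]) e lC cN.
move=> A B D C L e L0 C0 j0.
have w0 : C * z + D != 0.
  by apply: contraNneq j0 => E; rewrite -mulrA -mulrDr E mulr0.
have -> : B = (L ^+ 2 * A * D - 1) / C by rewrite -e; field.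
by field; rewrite L0 C0 w0 j0.
Qed.

Lemma phi_gm m a b c d z : (0 < c)%N -> gm_cond p a b c%:Z d -> 0 < complex.Im z ->
  phi m (mobius (gm R p a b c%:Z d) z) =
  ee (- (m%:R * a%:~R / c%:R)) * row_term (row_scale p c) m c z d.
Proof.
move=> c0 h z0; rewrite mobius_gm // /phi /row_term /=; set w := c%:R * z + _.
set x : R := a%:~R / c%:R.
have E (v : R[i]) : - (m%:R * (x%:C - v^-1)) = (- (m%:R * a%:~R / c%:R) : R)%:C + m%:R / v.
  have -> : (- (m%:R * a%:~R / c%:R) : R) = - (m%:R * x) by rewrite /x mulrA.
  have -> : (- (m%:R * x))%:C = - (m%:R * x%:C) :> R[i] by rewrite natC; apply: complex_eq => /=; ring.
  by ring.
have -> : conjc (x%:C - ((row_scale p c)%:R * c%:R * w)^-1) = x%:C - ((row_scale p c)%:R * c%:R * conjc w)^-1.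
  rewrite rmorphB fmorphV !rmorphM !rmorph_nat /=; congr (_ - _).
  by apply: complex_eq => /=; rewrite ?oppr0.
by rewrite !E !e2piD -mulrBr.
Qed.

Definition bof a c d : int := (((row_scale p c)%:Z * a * d - 1) %/ c%:Z)%Z.

Lemma bofP a c d : (0 < c)%N ->
  ((row_scale p c)%:Z * a * d == 1 %[mod c])%Z -> gm_cond p a (bof a c d) c%:Z d.
Proof.
move=> c0; rewrite eqz_mod_dvd => h; rewrite /gm_cond /bof divzK //=; ring.
Qed.

Lemma gm_cond_bof a b c d : (0 < c)%N -> gm_cond p a b c%:Z d -> b = bof a c d.
Proof.
move=> c0 h; rewrite /bof; move: h; rewrite /gm_cond /= => h.
have -> : (row_scale p c)%:Z * a * d - 1 = b * c%:Z by rewrite -h; ring.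
by rewrite mulzK // eqz_nat -lt0n.
Qed.

Lemma gm_cond_mod a b c d : gm_cond p a b c%:Z d -> ((row_scale p c)%:Z * a * d == 1 %[mod c])%Z.
Proof.
rewrite /gm_cond eqz_mod_dvd /= => h; apply/dvdzP; exists b; rewrite -h; ring.
Qed.

Lemma trans_gm k a b c d : trans R k *m gm R p a b c%:Z d =
  gm R p (a + k * c%:Z) (b + (row_scale p c)%:Z * k * d) c%:Z d.
Proof.
rewrite /trans /gm mul_mx2; have := sqrt_row_scale_gt0 R pp c; rewrite absz_nat.
set l : R := Num.sqrt _ => l0.
have l2 : (row_scale p c)%:R = l ^+ 2 :> R by rewrite sqr_sqrtr.
rewrite !(intrD, intrM) -!pmulrn l2; congr mx2; field; rewrite ?gt_eqF //.
Qed.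

Lemma trans_cond k a b c d : gm_cond p a b c%:Z d ->
  gm_cond p (a + k * c%:Z) (b + (row_scale p c)%:Z * k * d) c%:Z d.
Proof. by rewrite /gm_cond => <- /=; ring. Qed.

Section Fixed.
Variables (z : R[i]) (e : R).
Hypotheses (z0 : 0 < complex.Im z) (e0 : 0 < e).

Definition row_in c d : bool := (row_scale p c)%:R * nm (c%:R * z + d%:~R) ^+ 2 < complex.Im z / e.

(** For fixed c the height condition confines d to an open interval centred at -c Re z. If c is too
    large the root is taken of a negative number and is 0, and the interval is empty. *)
Definition row_rad c : R :=
  Num.sqrt (complex.Im z / e / (row_scale p c)%:R - (c%:R * complex.Im z) ^+ 2).
Definition row_lo c : int := itv_lo (- row_rad c - c%:R * complex.Re z).
Definition row_len c : nat :=
  itv_len (- row_rad c - c%:R * complex.Re z) (row_rad c - c%:R * complex.Re z).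

Lemma row_inP c d : row_in c d = (row_lo c <= d < row_lo c + (row_len c)%:Z).
Proof.
rewrite -itvP /row_in nm_sqr.
have l0 : (0 : R) < (row_scale p c)%:R by rewrite ltr0n row_scale_gt0.
rewrite mulrC -ltr_pdivlMr //.
have -> : complex.Re (c%:R * z + d%:~R) = c%:R * complex.Re z + d%:~R.
  by rewrite natC intC Re_affine.
have -> : complex.Im (c%:R * z + d%:~R) = c%:R * complex.Im z.
  by rewrite natC intC Im_affine.
rewrite -ltrBrDr /row_rad; set M := _ / _ - _ ^+ 2; set u := c%:R * complex.Re z.
have -> : (- Num.sqrt M - u < d%:~R < Num.sqrt M - u) = (`|u + d%:~R| < Num.sqrt M).
  by rewrite ltr_norml; apply/andP/andP => -[h1 h2]; split; lra.
have [M0|M0] := ltP 0 M; first by rewrite -sqrtr_sqr ltr_sqrt.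
rewrite ler0_sqrtr // normr_lt0; apply/negbTE; rewrite -leNgt.
by apply: (le_trans M0); exact: sqr_ge0.
Qed.

Lemma strip_gm a b c d : gm_cond p a b c%:Z d ->
  (e < complex.Im (mobius (gm R p a b c%:Z d) z)) = row_in c d.
Proof.
move=> h; have dt := det_gm R pp h.
have j0 : 0 < nm (jm (gm R p a b c%:Z d) z) by rewrite nm_gt0 // jm_neq0.
rewrite Im_mobius // ltr_pdivlMr ?exprn_gt0 // mulrC -ltr_pdivlMr // nm_jm_gm //.
Qed.

(** A triple (c, k, a) stands for the lower row (c, [row_lo c + k]) and the residue a modulo c of
    the upper left entry. *)
Definition rows N : seq (nat * nat * nat) :=
  [seq (ck, x) | ck <- [seq (c, k) | c <- index_iota 1 N.+1, k <- index_iota 0 (row_len c)],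
     x <- [seq x <- index_iota 0 ck.1 |
       ((row_scale p ck.1)%:Z * x%:Z * (row_lo ck.1 + ck.2%:Z) == 1 %[mod ck.1])%Z]].

Lemma rows_uniq N : uniq (rows N).
Proof.
apply: uniq_dep_pairs => [|x _]; last by rewrite filter_uniq // iota_uniq.
by apply: uniq_dep_pairs => [|x _]; rewrite iota_uniq.
Qed.

Lemma mem_rows N c (k a : nat) : ((c, k, a) \in rows N) = [&& (0 < c <= N)%N, (k < row_len c)%N, (a < c)%N
   & ((row_scale p c)%:Z * a%:Z * (row_lo c + k%:Z) == 1 %[mod c])%Z].
Proof. by rewrite !mem_dep_pairs mem_filter !mem_index_iota /= ltnS -andbA; case: eqP; rewrite ?andbT ?andbF. Qed.

Definition base (t : nat * nat * nat) : 'M[R]_2 :=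
  let: (c, k, a) := t in gm R p a%:Z (bof a%:Z c (row_lo c + k%:Z)) c%:Z (row_lo c + k%:Z).
Definition rowmx (t : nat * nat * nat) : 'M[R]_2 :=
  trans R (strip_shift (complex.Re (mobius (base t) z))) *m base t.

Definition Apos : set 'M[R]_2 := [set g | strip_elts e z g /\ 0 < g 1 0].

Lemma gm10 a b (c : int) d : gm R p a b c d 1 0 = Num.sqrt (row_scale p `|c|)%:R * c%:~R.
Proof. by rewrite mxE. Qed.

(** Up to translation from the left, an element with c > 0 is its lower row together with a modulo
    c; the strip selects exactly one of the translates. *)
Lemma rowmx_bij N : (forall c d, (0 < c)%N -> row_in c d -> (c <= N)%N) ->
  set_bij [set` rows N] Apos rowmx.
Proof.
move=> hN; split.
- move=> [[c k] a] /=; rewrite mem_rows => /and4P[/andP[c0 cN] kL ac hm].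
  have hc := bofP c0 hm; set d := row_lo c + k%:Z in hc *.
  rewrite /Apos /strip_elts /rowmx /base -/d /=; set s := strip_shift _.
  rewrite trans_gm; have hc' := trans_cond s hc; split; last first.
    by rewrite gm10 mulr_gt0 ?sqrt_row_scale_gt0 // ltr0z ltz_nat.
  split; first by apply/(Gamma0starP pp); do 4 eexists; split; [exact: hc'|].
  have rd : row_in c d by rewrite row_inP /d lerDl /= ltrD2l ltz_nat kL.
  rewrite /in_strip strip_gm // rd -trans_gm mobiusM ?det_trans ?det_gm //.
  rewrite mobius_trans ReD intC /= -/(base (c, k, a)).
  by have /andP[h1 h2] := strip_shift_itv (complex.Re (mobius (gm R p a (bof a c d) c d) z)).
- move=> [[c k] a] [[c' k'] a']; rewrite !inE /= !mem_rows.
  move=> /and4P[/andP[c0 cN] kL ac hm] /and4P[/andP[c0' cN'] kL' ac' hm'].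
  have hc := bofP c0 hm; have hc' := bofP c0' hm'.
  rewrite /rowmx /base; set s := strip_shift _; set s' := strip_shift _.
  rewrite !trans_gm => /gm_inj; rewrite !ltz_nat => /(_ c0 c0' (trans_cond _ hc) (trans_cond _ hc')).
  move=> [ea _ [ec] ed]; move: ea ed; rewrite -ec => ea /addrI [ek].
  have : (a%:Z = a'%:Z %[mod c%:Z])%Z.
    by rewrite -[LHS](modzMDl s) -[RHS](modzMDl s') ![_ * c%:Z + _]addrC {1}ea ec.
  have ac2 : (a' < c)%N by rewrite ec.
  by rewrite !modz_small ?ltz_nat ?ac ?ac2 // => -[->]; rewrite ek.
- move=> g [[/(Gamma0starP pp) [a [b [c [d [h ->]]]]] hs]]; rewrite gm10.
  rewrite pmulr_rgt0 ?sqrt_row_scale_gt0 // ltr0z.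
  case: c h hs => // c h hs; rewrite ltz_nat => c0.
  have [h1 h2 h3] := hs; rewrite strip_gm // in h1.
  move: (h1); rewrite row_inP => /andP[dl du].
  have dE : d = row_lo c + `|d - row_lo c|%N%:Z.
    by rewrite gez0_abs ?subr_ge0 //; ring.
  set k := `|d - row_lo c|%N in dE.
  have kL : (k < row_len c)%N by move: du; rewrite dE ltrD2l ltz_nat.
  pose a0 := `|(a %% c%:Z)%Z|%N; pose q := (a %/ c%:Z)%Z.
  have cz : c%:Z != 0 by rewrite eqz_nat -lt0n.
  have a0E : a0%:Z = (a %% c%:Z)%Z by rewrite gez0_abs // modz_ge0.
  have aE : a = a0%:Z + q * c%:Z by rewrite a0E addrC -divz_eq.
  have ac : (a0 < c)%N by rewrite -ltz_nat a0E ltz_mod.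
  have hb : gm_cond p a0%:Z (b - (row_scale p c)%:Z * q * d) c%:Z d.
    by rewrite /gm_cond -[RHS]h aE /=; ring.
  have bE := gm_cond_bof c0 hb.
  exists (c, k, a0).
    by rewrite /= mem_rows c0 (hN _ _ c0 h1) kL ac -dE (gm_cond_mod hb).
  rewrite /rowmx /base -dE -bE.
  have -> : gm R p a b c%:Z d = trans R q *m gm R p a0%:Z (b - (row_scale p c)%:Z * q * d) c%:Z d.
    by rewrite trans_gm -aE subrK.
  suff <- : q = strip_shift (complex.Re (mobius (gm R p a0%:Z (b - (row_scale p c)%:Z * q * d) c%:Z d) z)) by [].
  apply/eqP; rewrite -strip_shiftP.
  have E : complex.Re (mobius (gm R p a b c%:Z d) z) =
      complex.Re (mobius (gm R p a0%:Z (b - (row_scale p c)%:Z * q * d) c%:Z d) z) + q%:~R.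
    have -> : gm R p a b c%:Z d = trans R q *m gm R p a0%:Z (b - (row_scale p c)%:Z * q * d) c%:Z d.
      by rewrite trans_gm -aE subrK.
    by rewrite mobiusM ?det_trans ?det_gm // mobius_trans ReD intC.
  by rewrite -E h2 h3.
Qed.

(** The imaginary part of c z + d alone gives (c Im z)^2 < Im z / e. *)
Lemma row_bound : exists N, forall c d, (0 < c)%N -> row_in c d -> (c <= N)%N.
Proof.
exists (Num.trunc (e * complex.Im z)^-1).+2 => c d c0; rewrite /row_in => h.
have cR : (1 : R) <= c%:R by rewrite ler1n.
have l1 : (1 : R) <= (row_scale p c)%:R by rewrite ler1n row_scale_gt0.
have n0 : 0 <= nm (c%:R * z + d%:~R) ^+ 2 by rewrite sqr_ge0.
have hI : (c%:R * complex.Im z) ^+ 2 <= nm (c%:R * z + d%:~R) ^+ 2.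
  by rewrite nm_sqr natC intC Im_affine lerDr sqr_ge0.
have : (c%:R * complex.Im z) ^+ 2 < complex.Im z / e by apply: le_lt_trans h; nra.
rewrite ltr_pdivlMr // => h2.
have ey : 0 < e * complex.Im z by rewrite mulr_gt0.
have : c%:R < (e * complex.Im z)^-1.
  rewrite -[ltRHS]mul1r ltr_pdivlMr //.
  have : complex.Im z * (c%:R * (e * complex.Im z)) < complex.Im z * 1.
    apply: le_lt_trans (_ : (c%:R * complex.Im z) ^+ 2 * e < _); last by rewrite mulr1.
    have -> : (c%:R * complex.Im z) ^+ 2 * e = complex.Im z * (c%:R * (e * complex.Im z)) * c%:R by ring.
    by rewrite ler_peMr // !mulr_ge0 ?ltW //; lra.
  by rewrite ltr_pM2l.
move=> h3; rewrite ltnW // -(ltr_nat R); apply: (lt_trans h3).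
by apply: lt_trans (_ : _ < (Num.trunc (e * complex.Im z)^-1).+1%:R) _; rewrite ?truncnS_gt ?ltr_nat.
Qed.

Lemma Apos_finite : finite_set Apos.
Proof.
have [N hN] := row_bound; have [_ _ hs] := rowmx_bij hN.
by apply: (sub_finite_set hs); apply: finite_image; exact: finite_seq.
Qed.

Lemma sum_Apos m N : (forall c d, (0 < c)%N -> row_in c d -> (c <= N)%N) ->
  \sum_(g \in Apos) phi m (mobius g z) =
  \sum_(1 <= c < N.+1) row_sum p m z c (row_lo c) (row_len c).
Proof.
move=> hN; rewrite (reindex_fsbig _ _ _ _ (rowmx_bij hN)) /= -fsbig_seq ?rows_uniq //.
rewrite /rows !big_allpairs_dep /=; rewrite big_nat [RHS]big_nat.
apply: eq_bigr => c /andP[c0 cN]; rewrite /row_sum /Vsum; apply: eq_bigr => k _.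
set d := row_lo c + k%:Z; rewrite /kloos mulr_suml big_filter big_mkord.
rewrite big_mkcond [RHS]big_mkcond /=; apply: eq_bigr => a _; case: ifP => // hm.
have hc := bofP c0 hm; rewrite /rowmx trans_gm phi_gm //; last exact: trans_cond.
congr (_ * _); set s := strip_shift _.
have -> : (- (m%:R * (a%:Z + s * c%:Z)%:~R / c%:R) : R) = - (m%:R * a%:R / c%:R) + (- (m%:Z * s))%:~R.
  have cR : (c%:R : R) != 0 by rewrite pnatr_eq0 -lt0n.
  by rewrite rmorphN /= intrD !intrM -!pmulrn; field.
by rewrite eeDint.
Qed.

Definition Azero : set 'M[R]_2 := [set g | strip_elts e z g /\ g 1 0 = 0].
Definition Aneg : set 'M[R]_2 := [set g | strip_elts e z g /\ g 1 0 < 0].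

Lemma strip_eltsN g : strip_elts e z g -> strip_elts e z (- g).
Proof. by move=> [h1 h2]; split; [exact: GstarN | rewrite mobiusN]. Qed.

Lemma Aneg_bij : set_bij Apos Aneg (fun g => - g).
Proof.
split.
- by move=> g [h1 h2]; split; [exact: strip_eltsN | rewrite mxE oppr_lt0].
- by move=> g h _ _ /oppr_inj.
by move=> g [h1 h2]; exists (- g); [split; [exact: strip_eltsN | rewrite mxE oppr_gt0] | rewrite opprK].
Qed.

Lemma Aneg_finite : finite_set Aneg.
Proof.
have [_ _ hs] := Aneg_bij; apply: (sub_finite_set hs); apply: finite_image; exact: Apos_finite.
Qed.

Lemma AzeroE : Azero = if e < complex.Im z then
  [set trans R (strip_shift (complex.Re z))] `|` [set - trans R (strip_shift (complex.Re z))]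
  else set0.
Proof.
set T := trans R _.
have hT : e < complex.Im z -> strip_elts e z T.
  move=> h; split; first exact: Gstar_trans.
  rewrite /in_strip mobius_trans ImD ReD intC /= addr0.
  by have /andP[h1 h2] := strip_shift_itv (complex.Re z); rewrite h h1 h2.
have T10 : T 1 0 = 0 by rewrite mxE.
apply/seteqP; split=> [g|g]; last first.
  case: ifP => // h [|] ->; split=> //; first exact: hT.
    by apply: strip_eltsN; exact: hT.
  by rewrite mxE T10 oppr0.
move=> [[/(Gamma0starP pp) [a [b [c [d [h ->]]]]] hs]]; rewrite gm10 => /eqP.
rewrite mulf_eq0 gt_eqF ?sqrt_row_scale_gt0 //= intr_eq0 => /eqP cE; move: h hs; rewrite cE.
rewrite /gm_cond mulr0 subr0 absz0 /row_scale dvdn0 mul1r => ad.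
have aE : (a = 1 /\ d = 1) \/ (a = -1 /\ d = -1).
  have : (`|a| * `|d| == 1)%N by rewrite -abszM ad.
  rewrite muln_eq1 => /andP[/eqP h1 _]; have [aE|aE] : a = 1 \/ a = -1 by lia.
    by left; split=> //; move: ad; rewrite aE mul1r.
  by right; split=> //; move: ad; rewrite aE mulN1r => <-; rewrite opprK.
have gE : gm R p a b 0 d = trans R b \/ gm R p a b 0 d = - trans R (- b).
  case: aE => -[-> ->]; [left|right]; rewrite /gm /trans absz0 /row_scale dvdn0 sqrtr1 ?mulr1 ?mulr0 ?divr1 //.
  by rewrite [RHS]mx2_eta !mxE /= oppr0 !mul1r !mulrNz mulr1z opprK.
have key k g' : g' = trans R k \/ g' = - trans R k -> in_strip e (mobius g' z) ->
    e < complex.Im z /\ k = strip_shift (complex.Re z).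
  move=> hg; have -> : mobius g' z = mobius (trans R k) z by case: hg => ->; rewrite ?mobiusN.
  rewrite /in_strip mobius_trans ImD ReD intC /= addr0 => -[h1 h2 h3]; split=> //.
  by apply/eqP; rewrite -strip_shiftP h2 h3.
case: gE => E /key; rewrite E.
  by move=> /(_ b (or_introl erefl)) [-> ->]; left.
by move=> /(_ (- b) (or_intror erefl)) [-> ->]; right.
Qed.

Lemma strip_eltsE : strip_elts e z = (Apos `|` Aneg) `|` Azero.
Proof.
apply/seteqP; split=> [g hg|g]; last by case=> [[|]|] [].
have [h|h|h] := ltgtP (g 1 0) 0; [left; right|left; left|right] => //.
Qed.

Lemma Azero_finite : finite_set Azero.
Proof. by rewrite AzeroE; case: ifP => _ //; rewrite finite_setU; split; exact: finite_set1. Qed.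

Lemma strip_elts_finite : finite_set (strip_elts e z).
Proof.
rewrite strip_eltsE !finite_setU; split; last exact: Azero_finite.
by split; [exact: Apos_finite | exact: Aneg_finite].
Qed.

Lemma phi_int m w (k : int) : phi m (w + k%:~R) = phi m w.
Proof.
have E (v : R[i]) : e2pi (- (m%:R * (v + k%:~R))) = e2pi (- (m%:R * v)).
  have -> : - (m%:R * (v + k%:~R)) = - (m%:R * v) + (- (m%:Z * k))%:~R.
    by rewrite rmorphN /= intrM -pmulrn; ring.
  by rewrite e2pi_intD.
rewrite /phi E rmorphD /= intC.
have -> : conjc (k%:~R : R)%:C = (k%:~R : R)%:C by apply: complex_eq => /=; rewrite ?oppr0.
by rewrite -intC E.
Qed.

(** The sign change g -> -g exchanges c > 0 and c < 0, which cancels the factor 1/2. For c = 0 only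
    plus or minus one translation remains, provided z itself lies above the cut. *)
Lemma poincare_cut_rows m N : (forall c d, (0 < c)%N -> row_in c d -> (c <= N)%N) ->
  poincare_cut m e z = (if e < complex.Im z then phi m z else 0) +
    \sum_(1 <= c < N.+1) row_sum p m z c (row_lo c) (row_len c).
Proof.
move=> hN; rewrite /poincare_cut strip_eltsE fsbigU0 ?finite_setU; first last.
- by move=> g [[|] [_ h] [_ h']]; move: h; rewrite h' ltxx.
- exact: Azero_finite.
- by split; [exact: Apos_finite | exact: Aneg_finite].
rewrite fsbigU0; first last.
- by move=> g [[_ h] [_ h']]; have := lt_trans h h'; rewrite ltxx.
- exact: Aneg_finite.
- exact: Apos_finite.
rewrite (reindex_fsbig _ _ _ _ Aneg_bij) /=.
under [X in _ + X + _]eq_fsbigr do rewrite mobiusN.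
rewrite (sum_Apos m hN) AzeroE; set S := \sum_(1 <= c < N.+1) _.
set T := trans R _.
have -> : \sum_(g \in (if e < complex.Im z then [set T] `|` [set - T] else set0)) phi m (mobius g z) =
   2 * (if e < complex.Im z then phi m z else 0).
  case: ifP => _; last by rewrite fsbig_set0 mulr0.
  rewrite fsbigU0 ?fsbig_set1; first last.
  - move=> g [-> /= /matrixP /(_ 0 0)]; rewrite !mxE /= => /eqP; rewrite -addr_eq0 -[1 + 1]/2%:R pnatr_eq0 //.
  - exact: finite_set1.
  - exact: finite_set1.
  by rewrite /= mobiusN mobius_trans phi_int; ring.
have two : (2 : R[i]) != 0 by rewrite pnatr_eq0.
by field.
Qed.

End Fixed.

(** When the cut is low enough, each row with c <= N0 contains -T and T, hence everything between
    them, and [poincare_tail_tannery] applies. [M] bounds the finitely many values of lam |c z +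
    d|^2 involved. *)
Lemma poincare_cut_cvg m z : (0 < m)%N -> 0 < complex.Im z -> forall del : R, 0 < del ->
  exists2 e1 : R, 0 < e1 & forall e : R, 0 < e -> e <= e1 -> nm (poincare_cut m e z - poincare p m z) <= del.
Proof.
move=> m0 z0 del del0; set y := complex.Im z in z0 *.
have [N0 [T hT]] := poincare_tail_tannery p0 m0 z0 del0.
pose M : R := p%:R * \sum_(1 <= c < N0.+1) (nm (c%:R * z + (- T%:Z)%:~R) ^+ 2 + nm (c%:R * z + T%:Z%:~R) ^+ 2) + 1.
have M0 : 0 < M.
  rewrite /M ltr_wpDl // mulr_ge0 ?ler0n // sumr_ge0 // => c _; rewrite addr_ge0 ?sqr_ge0 //.
exists (Num.min (y / 2) (y / M / 2)).
  by rewrite lt_min !divr_gt0.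
move=> e e0; rewrite le_min => /andP[ey eM].
have [N hN] := row_bound z0 e0.
have hN' c d : (0 < c)%N -> row_in z e c d -> (c <= maxn N N0)%N.
  by move=> c0 h; rewrite leq_max (hN _ _ c0 h).
rewrite (poincare_cut_rows z0 e0 m hN') /poincare ifT; last by rewrite -/y; lra.
rewrite opprD addrACA subrr add0r; apply: hT; first exact: leq_maxr.
move=> c /andP[c0 cN].
have rin d : nm (c%:R * z + d%:~R) ^+ 2 * p%:R < M -> row_in z e c d.
  move=> h; rewrite /row_in -/y ltr_pdivlMr //.
  have hl : (row_scale p c)%:R <= p%:R :> R by rewrite ler_nat /row_scale; case: ifP.
  have hE : e * M < y.
    have : y / M / 2 * M = y / 2 by field; rewrite gt_eqF.
    have : e * M <= y / M / 2 * M by rewrite ler_pM2r.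
    by lra.
  apply: le_lt_trans hE; rewrite mulrC ler_pM2l // ltW //.
  apply: le_lt_trans h; rewrite mulrC; apply: ler_wpM2l => //; exact: sqr_ge0.
have cS (G : nat -> R) : (forall i, 0 <= G i) -> G c <= \sum_(1 <= i < N0.+1) G i.
  move=> G0; rewrite (bigD1_seq c) ?iota_uniq ?mem_index_iota ?c0 //=.
  by rewrite lerDl sumr_ge0.
have pR : (0 : R) < p%:R by rewrite ltr0n.
have G0 (i : nat) : 0 <= nm (i%:R * z + (- T%:Z)%:~R) ^+ 2 + nm (i%:R * z + T%:Z%:~R) ^+ 2.
  by rewrite addr_ge0 ?sqr_ge0.
have hc := cS _ G0.
have hS : p%:R * (nm (c%:R * z + (- T%:Z)%:~R) ^+ 2 + nm (c%:R * z + T%:Z%:~R) ^+ 2) < M.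
  by rewrite /M ltr_pwDr // ler_pM2l.
have n1 : 0 <= nm (c%:R * z + (- T%:Z)%:~R) ^+ 2 by exact: sqr_ge0.
have n2 : 0 <= nm (c%:R * z + T%:Z%:~R) ^+ 2 by exact: sqr_ge0.
have r1 : row_in z e c (- T%:Z) by apply: rin; apply: le_lt_trans hS; rewrite mulrC ler_pM2l // lerDl.
have r2 : row_in z e c T%:Z by apply: rin; apply: le_lt_trans hS; rewrite mulrC ler_pM2l // lerDr.
move: r1 r2; rewrite !row_inP // => /andP[h1 _] /andP[_ h2]; split; first exact: h1.
exact: ltW.
Qed.

Lemma poincare_cut_inv m (e : R) h z : Gamma0star p h -> 0 < complex.Im z ->
  poincare_cut m e (mobius h z) = poincare_cut m e z.
Proof.
move=> hh z0; congr (_ * _); have dh := det_Gstar pp hh; have uh := unit_det1 dh.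
have B : set_bij (strip_elts e (mobius h z)) (strip_elts e z) (fun g => g *m h).
  split.
  - move=> g [hg hs]; split; first exact: Gamma0star_mul.
    by rewrite mobiusM // (det_Gstar pp hg).
  - by move=> g g' _ _ /(can_inj (mulmxK uh)).
  move=> g [hg hs]; exists (g *m invmx h); last by rewrite mulmxKV.
  have hi : Gamma0star p (invmx h) by exact: Gamma0star_inv.
  split; first exact: Gamma0star_mul.
  by rewrite mobiusM ?(det_Gstar pp hg) ?(det_Gstar pp hi) ?Im_mobius_gt0 // mobiusVK.
rewrite (reindex_fsbig _ _ _ _ B); apply: eq_fsbigr => g; rewrite inE => -[hg _].
by rewrite mobiusM // (det_Gstar pp hg).
Qed.

Lemma poincare_inv m h z : (0 < m)%N -> Gamma0star p h -> 0 < complex.Im z ->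
  poincare p m (mobius h z) = poincare p m z.
Proof.
move=> m0 hh z0; have hz0 := Im_mobius_gt0 (det_Gstar pp hh) z0.
apply/eqP; rewrite -subr_eq0; apply/eqP; apply: nm_eq0; apply/eqP; rewrite eq_le nm_ge0 andbT.
apply/ler_addgt0Pr => del del0; rewrite add0r.
have [e1 h1 he1] := poincare_cut_cvg m0 hz0 (divr_gt0 del0 (ltr0n R 2)).
have [e2 h2 he2] := poincare_cut_cvg m0 z0 (divr_gt0 del0 (ltr0n R 2)).
set e := Num.min e1 e2; have e0 : 0 < e by rewrite lt_min h1 h2.
have [b1 b2] : e <= e1 /\ e <= e2 by rewrite /e !ge_min !lexx orbT.
have := he1 e e0 b1; have := he2 e e0 b2.
rewrite poincare_cut_inv // => a1 a2.
move: (poincare p m (mobius h z)) (poincare p m z) (poincare_cut m e z) a1 a2 => u v w a1 a2.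
have -> : u - v = (w - v) - (w - u) by ring.
by apply: (le_trans (nmB _ _)); lra.
Qed.

Lemma seq_min (T : eqType) (F : T -> R) (s : seq T) x0 : x0 \in s ->
  exists2 x, x \in s & forall y, y \in s -> F x <= F y.
Proof.
elim: s x0 => // x s IH x0 _; case: s IH => [_|y s IH].
  by exists x; rewrite ?mem_head // => y; rewrite inE => /eqP ->.
have [w ws hw] := IH y (mem_head _ _).
have [h|h] := leP (F x) (F w).
  exists x; first exact: mem_head.
  move=> v; rewrite inE => /orP[/eqP -> //|/hw]; exact: le_trans.
exists w; first by rewrite inE ws orbT.
move=> v; rewrite inE => /orP[/eqP ->|/hw //]; exact: ltW.
Qed.

(* The row of a shortest vector of the lattice Z z + Z. *)
Lemma short_row z : 0 < complex.Im z ->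
  exists c d : int, coprimez c d /\ nm (c%:~R * z + d%:~R) ^+ 2 <= 2 * complex.Im z.
Proof.
move=> z0; set y := complex.Im z in z0 *; pose q (v : int * int) : R := nm (v.1%:~R * z + v.2%:~R) ^+ 2.
have qE v : q v = (v.1%:~R * complex.Re z + v.2%:~R) ^+ 2 + (v.1%:~R * y) ^+ 2.
  by rewrite /q nm_sqr !intC Re_affine Im_affine.
have [v [vN0 vmin]] : exists v : int * int, v != (0, 0) /\ forall w : int * int, w != (0, 0) -> q v <= q w.
  pose C := (Num.trunc y^-1).+1; pose B := (Num.trunc (1 + C%:R * `|complex.Re z|)).+1.
  have bd v : q v <= 1 -> (`|v.1| <= C)%N /\ (`|v.2| <= B)%N.
    rewrite qE => h.
    have h1 : (v.1%:~R * y) ^+ 2 <= 1 by apply: le_trans h; rewrite lerDr sqr_ge0.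
    have h2 : (v.1%:~R * complex.Re z + v.2%:~R) ^+ 2 <= 1 by apply: le_trans h; rewrite lerDl sqr_ge0.
    have s1 (x : R) : x ^+ 2 <= 1 -> `|x| <= 1 by rewrite -(real_normK (num_real x)) expr_le1.
    have absE (x : int) : (`|x|%N%:R : R) = `|x%:~R| by rewrite -intr_norm -abszE -pmulrn.
    have c1 : (`|v.1|%N%:R : R) <= y^-1.
      by rewrite absE -[leRHS]mul1r ler_pdivlMr // -{1}(gtr0_norm z0) -normrM; exact: s1.
    have cC : (`|v.1| <= C)%N.
      by rewrite -(ler_nat R); apply: (le_trans c1); rewrite ltW // truncnS_gt.
    split=> //; rewrite -(ler_nat R) absE.
    apply: (@le_trans _ _ (1 + C%:R * `|complex.Re z|)); last by rewrite ltW // truncnS_gt.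
    have -> : (v.2%:~R : R) = (v.1%:~R * complex.Re z + v.2%:~R) - v.1%:~R * complex.Re z by ring.
    apply: (le_trans (ler_normB _ _)); apply: lerD; first exact: s1.
    by rewrite normrM ler_wpM2r // -absE ler_nat.
  pose ints n := [seq (i%:Z - n%:Z) | i <- iota 0 (n + n).+1].
  have memi n (x : int) : (`|x| <= n)%N -> x \in ints n.
    move=> h; apply/mapP; exists `|(x + n%:Z)%R|%N; first by rewrite mem_iota; lia.
    by lia.
  pose s := [seq v <- [seq (x, y) | x <- ints C, y <- ints B] | v != (0, 0)].
  have mems v : v != (0, 0) -> q v <= 1 -> v \in s.
    move=> v0 /bd [h1 h2]; rewrite mem_filter v0 andTb.
    by case: v h1 h2 {v0} => v1 v2 h1 h2; rewrite mem_dep_pairs (memi _ _ h1) (memi _ _ h2).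
  have q01 : q (0, 1) = 1 by rewrite qE /= !mul0r add0r expr1n expr0n addr0.
  have s01 : (0, 1) \in s by apply: mems => //; rewrite q01.
  have [v vs hv] := seq_min q s01; exists v; split.
    by move: vs; rewrite mem_filter => /andP[].
  move=> w w0; have [h|h] := leP (q w) 1; first by apply: hv; exact: mems.
  by apply: le_trans (ltW h); rewrite -q01; exact: hv.
case: v vN0 vmin => c d vN0 vmin.
have qpos : 0 < q (c, d).
  rewrite lt_neqAle sqr_ge0 andbT eq_sym qE /= paddr_eq0 ?sqr_ge0 // !sqrf_eq0.
  apply: contra vN0 => /andP[]; rewrite mulf_eq0 (gt_eqF z0) orbF intr_eq0 => + /eqP c0.
  by rewrite c0 mul0r add0r intr_eq0 => /eqP ->.
have cop : coprimez c d.
  set gg := gcdz c d; have g0 : gg != 0.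
    by apply: contra vN0; rewrite gcdz_eq0 => /andP[/eqP -> /eqP ->].
  have g1 : 0 < gg by rewrite lt_neqAle eq_sym g0 /gg /gcdz.
  have cE : c = (c %/ gg)%Z * gg by rewrite divzK // dvdz_gcdl.
  have dE : d = (d %/ gg)%Z * gg by rewrite divzK // dvdz_gcdr.
  have := vmin ((c %/ gg)%Z, (d %/ gg)%Z); set c' := (c %/ gg)%Z in cE *; set d' := (d %/ gg)%Z in dE *.
  have qg : q (c, d) = gg%:~R ^+ 2 * q (c', d') by rewrite !qE /= cE dE !intrM; ring.
  have n0 : (c', d') != (0, 0).
    by apply: contra vN0 => /eqP[e1 e2]; rewrite cE dE e1 e2 !mul0r.
  move=> /(_ n0); rewrite qg => hq.
  have q'0 : 0 < q (c', d') by move: qpos; rewrite qg pmulr_rgt0 // exprn_gt0 // ltr0z.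
  have : (gg%:~R : R) <= 1.
    move: hq; rewrite ger_pMl // -[X in _ <= X](expr1n _ 2) ler_pXn2r ?nnegrE ?ler0z ?ler01 //.
  have aux (x : int) : 0 < x -> x <= 1 -> x == 1 by lia.
  by rewrite lerz1; exact: aux.
exists c, d; split=> //; rewrite -[nm _ ^+ 2]/(q (c, d)).
have [u [v uv]] : exists u v : int, u * c + v * d = 1.
  by have := Bezoutz c d; rewrite (eqP cop) => -[u [v]]; exists u, v.
(* w = (v z - u) / (c z + d) and its translates have modulus at least 1, while
   some translate has real part at most 1/2 in absolute value. *)
pose W := (v%:~R * complex.Re z - u%:~R) * (c%:~R * complex.Re z + d%:~R) + v%:~R * c%:~R * y ^+ 2 : R.
pose k := Num.floor (- (W / q (c, d)) + 1 / 2).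
have /andP[k1 k2] := floor_itv (- (W / q (c, d)) + 1 / 2); rewrite -/k rmorphD /= in k1 k2.
have nN0 : (v + k * c, - u + k * d) != (0, 0).
  apply/negP => /eqP[e1 e2].
  have : (v + k * c) * d - (- u + k * d) * c = 1 by rewrite -uv; ring.
  by rewrite e1 e2 !mul0r subrr.
have := vmin _ nN0.
have key : q (v + k * c, - u + k * d) * q (c, d) = y ^+ 2 + (W + k%:~R * q (c, d)) ^+ 2.
  have uvR : u%:~R * c%:~R + v%:~R * d%:~R = 1 :> R by rewrite -!intrM -intrD uv.
  have -> : y ^+ 2 = ((u%:~R * c%:~R + v%:~R * d%:~R) * y) ^+ 2 by rewrite uvR mul1r.
  by rewrite /W !qE /= !(intrD, intrM) rmorphN /=; ring.
set Q := q (c, d) in qpos key k1 k2 *; set Q' := q _ in key *.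
move=> hQ; set t := W / Q in k1 k2.
have WE : W = t * Q by rewrite /t divfK // gt_eqF.
have tb : (t + k%:~R) ^+ 2 <= 1 / 4.
  have h1 : -(1/2) <= t + k%:~R by lra.
  have h2 : t + k%:~R <= 1 / 2 by lra.
  by nra.
have h : Q * Q <= y ^+ 2 + 1 / 4 * (Q * Q).
  apply: (@le_trans _ _ (Q' * Q)); first by rewrite ler_pM2r.
  rewrite key lerD2l WE -mulrDl exprMn [Q ^+ 2]expr2; apply: ler_wpM2r => //.
  by rewrite mulr_ge0 // ltW.
rewrite leNgt; apply/negP => hlt.
have h1 : 2 * y * Q < Q * Q by rewrite ltr_pM2r.
have h2 : 2 * y * (2 * y) < 2 * y * Q by rewrite ltr_pM2l // mulr_gt0.
by have := sqr_ge0 y; move: h; rewrite expr2 => *; lra.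
Qed.

(** A short row (c, d) can be completed to a group element because lam d is prime to c. Then lam <=
    p and |c z + d|^2 <= 2 Im z bound the new height from below. *)
Lemma reduction z : 0 < complex.Im z ->
  exists2 g : 'M[R]_2, Gamma0star p g & (2 * p%:R)^-1 <= complex.Im (mobius g z).
Proof.
move=> z0; have [c [d [cop hq]]] := short_row z0.
have cop' : coprimez ((row_scale p `|c|)%:Z * d) c.
  rewrite coprimezMl [coprimez d c]coprimez_sym cop andbT /coprimez /gcdz /= eqz_nat.
  exact: row_scale_coprime.
have [a [b ab]] : exists a b : int, gm_cond p a b c d.
  have := Bezoutz ((row_scale p `|c|)%:Z * d) c; rewrite (eqP cop') => -[u [v E]].
  by exists u, (- v); rewrite /gm_cond -E; ring.
exists (gm R p a b c d); first by apply/(Gamma0starP pp); exists a, b, c, d.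
have dt := det_gm R pp ab; rewrite Im_mobius //.
have jE : nm (jm (gm R p a b c d) z) ^+ 2 = (row_scale p `|c|)%:R * nm (c%:~R * z + d%:~R) ^+ 2.
  rewrite /jm /gm; set l : R := Num.sqrt _.
  case: (mx2E (l * a%:~R) (b%:~R / l) (l * c%:~R) (l * d%:~R)) => _ _ -> ->.
  have -> : (l * c%:~R)%:C * z + (l * d%:~R)%:C = l%:C * (c%:~R * z + d%:~R) :> R[i].
    by rewrite !(rmorphM (real_complex R)) !intC; ring.
  by rewrite nmM nm_real exprMn real_normK ?num_real // sqr_sqrtr.
have j0 : 0 < nm (jm (gm R p a b c d) z) ^+ 2 by rewrite exprn_gt0 // nm_gt0 // jm_neq0.
have pR : (0 : R) < p%:R by rewrite ltr0n.
rewrite ler_pdivlMr // mulrC ler_pdivrMr ?mulr_gt0 // jE.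
have hl : (row_scale p `|c|)%:R <= p%:R :> R by rewrite ler_nat /row_scale; case: ifP.
apply: (@le_trans _ _ (p%:R * (2 * complex.Im z))); last by rewrite (_ : p%:R * _ = complex.Im z * (2 * p%:R)) //; ring.
by apply: ler_pM; rewrite ?ler0n ?sqr_ge0.
Qed.

End Rows.

(** * Quadratic forms and unfolding *)

Section Forms.
Variables (R : realType) (p D : nat).
Hypotheses (pp : prime p) (D0 : (0 < D)%N).
Implicit Types (Q : bqf int) (g : 'M[R]_2) (z w : R[i]) (m n : nat).

Let p0 : (0 < p)%N. Proof. exact: prime_gt0. Qed.
Let sD : R := Num.sqrt D%:R.
Let sD0 : 0 < sD. Proof. by rewrite sqrtr_gt0 ltr0n. Qed.
Let sD2 : sD ^+ 2 = D%:R. Proof. by rewrite sqr_sqrtr. Qed.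

(* The real form of discriminant -D whose CM point is z. *)
Definition form_of z : bqf R :=
  let x := complex.Re z in let y := complex.Im z in
  (sD / (2 * y), - (sD * x / y), sD * (x ^+ 2 + y ^+ 2) / (2 * y)).

Lemma forms_gt0 (a b c : int) : forms D (a, b, c) -> 0 < a.
Proof. by move=> [/(_ 1 0 isT) + _]; rewrite /qeval expr1n expr0n /= !mulr0 !mulr1 !addr0. Qed.

Lemma pos_disc_forms (a b c : int) : 0 < a -> b ^+ 2 - 4 * a * c = - D%:Z -> forms D (a, b, c).
Proof.
move=> a0 hd; split=> // x y xy; rewrite /qeval.
have a4 : 0 < 4 * a by rewrite mulr_gt0.
rewrite -(pmulr_rgt0 _ a4).
have -> : 4 * a * (a * x ^+ 2 + b * x * y + c * y ^+ 2) = (2 * a * x + b * y) ^+ 2 + D%:Z * y ^+ 2.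
  by have -> : D%:Z = 4 * a * c - b ^+ 2 by [rewrite -[LHS]opprK -hd; ring]; ring.
have DZ : 0 < D%:Z by rewrite ltz_nat.
have [y0|y0] := eqVneq y 0.
  move: xy; rewrite y0 xpair_eqE eqxx andbT mulr0 addr0 expr0n mulr0 addr0 => x0.
  by rewrite exprn_even_gt0 //= !mulf_neq0 // gt_eqF.
by rewrite ltr_wpDl ?sqr_ge0 // mulr_gt0 // exprn_even_gt0.
Qed.

Lemma cm_parts (a b c : int) : 0 < a ->
  complex.Re (cm_point R D (a, b, c)) = - (b%:~R / (2 * a%:~R)) /\
  complex.Im (cm_point R D (a, b, c)) = sD / (2 * a%:~R).
Proof.
move=> a0; rewrite /cm_point -/sD.
have -> : ((2 * a)%:~R : R[i])^-1 = ((2 * a%:~R)^-1 : R)%:C.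
  by rewrite (fmorphV (real_complex R)) /= intC intrM.
rewrite mulrC ReZ ImZ /= rmorphN /= mulrN ![_^-1 * _]mulrC //.
Qed.

Lemma cm_gt0 Q : forms D Q -> 0 < complex.Im (cm_point R D Q).
Proof.
case: Q => [[a b] c] hQ; have a0 := forms_gt0 hQ; have [_ ->] := cm_parts b c a0.
by rewrite divr_gt0 // mulr_gt0 // ltr0z.
Qed.

Lemma form_cm Q : forms D Q -> qmap intr Q = form_of (cm_point R D Q).
Proof.
case: Q => [[a b] c] hQ; have a0 := forms_gt0 hQ; have [_ hd] := hQ.
have aN : (a%:~R : R) != 0 by rewrite intr_eq0 gt_eqF.
have sN : sD != 0 by rewrite gt_eqF.
rewrite /form_of /qmap; have [-> ->] := cm_parts b c a0.
have cE : (c%:~R : R) = (b%:~R ^+ 2 + sD ^+ 2) / (4 * a%:~R).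
  have h : b%:~R ^+ 2 + sD ^+ 2 = 4 * a%:~R * c%:~R :> R.
    have := congr1 (fun x : int => x%:~R : R) hd.
    rewrite rmorphB rmorphN rmorphXn /= !intrM -pmulrn sD2 => h.
    by apply/eqP; rewrite -subr_eq0; apply/eqP; move: h => /eqP; rewrite -subr_eq0 opprK => /eqP <-; ring.
  by rewrite h; field.
by rewrite cE; congr (_, _, _); field; rewrite ?aN ?sN.
Qed.

Lemma form_of_inj z w : 0 < complex.Im z -> 0 < complex.Im w -> form_of z = form_of w -> z = w.
Proof.
move=> z0 w0 [h1 h2 _].
have sN : sD != 0 by rewrite gt_eqF.
have zN : complex.Im z != 0 by rewrite gt_eqF.
have wN : complex.Im w != 0 by rewrite gt_eqF.
have e1 : complex.Im z = complex.Im w.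
  have := congr1 (fun x => sD / (2 * x)) h1 => h.
  have aux (y : R) : y != 0 -> sD / (2 * (sD / (2 * y))) = y by move=> yN; field; rewrite yN sN.
  by move: h; rewrite !aux.
apply: complex_eq => //; move: h2; rewrite e1 => /oppr_inj /(mulIf (invr_neq0 wN)).
by move/(mulfI sN).
Qed.

(** The bridge between forms and points: through [form_of] the action on forms becomes the action on
    CM points, and only the latter is used for the orbits. *)
Lemma form_of_mobius g z : \det g = 1 -> 0 < complex.Im z ->
  qcomp (form_of (mobius g z)) g = form_of z.
Proof.
move=> hg z0; have j0 : 0 < nm (jm g z) ^+ 2 by rewrite exprn_gt0 // nm_gt0 // jm_neq0.
rewrite /form_of; have [-> ->] := mobius_parts hg z0.
have nE : nm (jm g z) ^+ 2 = (g 1 0 * complex.Re z + g 1 1) ^+ 2 + (g 1 0 * complex.Im z) ^+ 2.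
  by rewrite /jm nm_sqr Re_affine Im_affine.
move: hg j0; rewrite det2 nE /qcomp.
move: (g 0 0) (g 0 1) (g 1 0) (g 1 1) (complex.Re z) (complex.Im z) z0 => A B C E x y y0 hd.
set n := _ + _ => n0.
have yN : y != 0 by rewrite gt_eqF.
have nN : n != 0 by rewrite gt_eqF.
set t := (A * x + B) * (C * x + E) + A * C * y ^+ 2.
(* With z = x + i y, the number t + i y is (A z + B) conj(C z + E); this is its squared modulus. *)
have tE : t ^+ 2 + y ^+ 2 = n * ((A * x + B) ^+ 2 + (A * y) ^+ 2).
  by rewrite -[y ^+ 2]mul1r -[1](expr1n _ 2) -hd /t /n; ring.
have -> : sD * ((t / n) ^+ 2 + (y / n) ^+ 2) / (2 * (y / n)) =
   sD * ((A * x + B) ^+ 2 + (A * y) ^+ 2) / (2 * y).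
  have -> : (t / n) ^+ 2 + (y / n) ^+ 2 = (t ^+ 2 + y ^+ 2) / n ^+ 2 by field.
  by rewrite tE; field; rewrite yN nN.
have -> : sD * (t / n) / (y / n) = sD * t / y by field; rewrite yN nN.
have -> : sD / (2 * (y / n)) = sD * n / (2 * y) by field; rewrite yN nN.
have key (u v : R) : u = v * (A * E - B * C) ^+ 2 -> u = v by rewrite hd expr1n mulr1.
by congr (_, _, _); apply: key; rewrite /t /n; field.
Qed.

Lemma qmap_inj Q Q' : qmap (intr : int -> R) Q = qmap intr Q' -> Q = Q'.
Proof. by case: Q Q' => [[a b] c] [[a' b'] c'] [/intr_inj -> /intr_inj -> /intr_inj ->]. Qed.

Lemma cm_inj Q Q' : forms D Q -> forms D Q' -> cm_point R D Q = cm_point R D Q' -> Q = Q'.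
Proof. by move=> h h' e; apply: qmap_inj; rewrite !form_cm // e. Qed.

Lemma sends_form_of g Q Q' : \det g = 1 -> forms D Q -> sends g Q Q' ->
  forms D Q' /\ cm_point R D Q = mobius g (cm_point R D Q').
Proof.
move=> hg hQ; set w := mobius (invmx g) (cm_point R D Q).
have w0 : 0 < complex.Im w by rewrite Im_mobius_gt0 ?detV1 ?cm_gt0.
have wE : cm_point R D Q = mobius g w by rewrite mobiusKV ?cm_gt0.
rewrite /sends (form_cm hQ) wE form_of_mobius // => hQ'.
have fQ' : forms D Q'.
  case: Q' hQ' => [[a b] c] [ea eb ec]; apply: pos_disc_forms.
    by rewrite -(ltr0z R) ea divr_gt0 // mulr_gt0.
  apply: (@intr_inj R); rewrite rmorphB rmorphN rmorphXn /= !intrM ea eb ec -pmulrn -sD2.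
  by field; rewrite gt_eqF.
split=> //; congr mobius; apply: form_of_inj => //; first exact: cm_gt0.
by rewrite -hQ' form_cm.
Qed.

Lemma sends_cm g Q Q' : \det g = 1 -> forms D Q -> forms D Q' ->
  cm_point R D Q = mobius g (cm_point R D Q') -> sends g Q Q'.
Proof.
by move=> hg hQ hQ' e; rewrite /sends !form_cm // e form_of_mobius // cm_gt0.
Qed.

(** Integrality and p | a are checked on each coset of Gamma_0(p); positivity and the discriminant
    come from [sends_form_of]. *)
Lemma act_exists g Q : Gamma0star p g -> forms_level D p Q ->
  exists2 Q', forms_level D p Q' & sends g Q Q'.
Proof.
move=> hg; have dg := det_Gstar pp hg; case: Q => [[a b] c] [fQ /= /dvdzP [a1 aE]].
suff [Q' hs hl] : exists2 Q', sends g (a, b, c) Q' & (p%:Z %| Q'.1.1)%Z.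
  by exists Q' => //; split=> //; have [] := sends_form_of dg fQ hs.
rewrite {fQ}aE.
set s : R := Num.sqrt p%:R.
have s0 : s != 0 by rewrite sqrtr_eq0 -ltNge ltr0n.
have s2 : (p%:R : R) = s ^+ 2 by rewrite sqr_sqrtr.
case: (Gamma0star_split pp hg) => -[A [B [C [E [_ ->]]]]]; rewrite /sends /qmap /qcomp.
- exists (a1 * p%:Z * A ^+ 2 + b * A * (p%:Z * C) + c * (p%:Z * C) ^+ 2,
    2 * (a1 * p%:Z) * A * B + b * (A * E + B * (p%:Z * C)) + 2 * c * (p%:Z * C) * E,
    a1 * p%:Z * B ^+ 2 + b * B * E + c * E ^+ 2).
    have [-> -> -> ->] := mx2E (A%:~R : R) B%:~R (p%:R * C%:~R) E%:~R.
    by rewrite !(intrD, intrM, rmorphXn) /= -!pmulrn; congr (_, _, _); ring.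
  rewrite /= (_ : _ + _ = p%:Z * (a1 * A ^+ 2 + b * A * C + c * p%:Z * C ^+ 2)); last by ring.
  exact: dvdz_mulr.
exists (p%:Z * (a1 * p%:Z * A ^+ 2 + b * A * C + c * C ^+ 2),
    2 * (a1 * p%:Z) * A * B + b * (p%:Z * A * E + B * C) + 2 * c * p%:Z * C * E,
    a1 * B ^+ 2 + b * B * E + c * p%:Z * E ^+ 2); last exact: dvdz_mulr.
rewrite -/s; have [-> -> -> ->] := mx2E (s * A%:~R : R) (B%:~R / s) (s * C%:~R) (s * E%:~R).
by rewrite !(intrD, intrM, rmorphXn) /= -!pmulrn s2; congr (_, _, _); field; rewrite ?s0.
Qed.

Lemma sends_uniq g Q Q1 Q2 : sends g Q Q1 -> sends g Q Q2 -> Q1 = Q2.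
Proof. by rewrite /sends => h1 h2; apply: qmap_inj; rewrite h1 h2. Qed.

Lemma orbit_of_level Q Q' : forms_level D p Q -> orbit_of R p Q Q' -> forms_level D p Q'.
Proof.
by move=> hQ [g hg hs]; have [Q1 h1 hs1] := act_exists hg hQ; rewrite (sends_uniq hs hs1).
Qed.

Lemma orbitP Q Q' : forms_level D p Q -> forms_level D p Q' ->
  orbit_of R p Q Q' <-> exists2 g, Gamma0star p g & cm_point R D Q' = mobius g (cm_point R D Q).
Proof.
move=> [hQ _] [hQ' _]; split=> [[g hg hs]|[g hg e]].
  have dg := det_Gstar pp hg; have [_ e] := sends_form_of dg hQ hs.
  exists (invmx g); first exact: Gamma0star_inv.
  by rewrite e mobiusVK // cm_gt0.
have dg := det_Gstar pp hg.
exists (invmx g); first exact: Gamma0star_inv.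
by apply: sends_cm; rewrite ?detV1 // e mobiusVK // cm_gt0.
Qed.

Lemma orbit_refl Q : forms_level D p Q -> orbit_of R p Q Q.
Proof. by move=> hQ; apply/orbitP => //; exists 1%:M; [exact: Gstar1 | rewrite mobius1]. Qed.

Lemma orbit_eq Q Q' : forms_level D p Q -> orbit_of R p Q Q' -> orbit_of R p Q' = orbit_of R p Q.
Proof.
move=> hQ hO; have hQ' := orbit_of_level hQ hO.
have [g hg e] := (orbitP hQ hQ').1 hO; have dg := det_Gstar pp hg.
apply/seteqP; split=> Q2 h2.
  have hQ2 := orbit_of_level hQ' h2; have [k hk ek] := (orbitP hQ' hQ2).1 h2.
  apply/orbitP => //; exists (k *m g); first exact: Gamma0star_mul.
  by rewrite ek e mobiusM ?(det_Gstar pp hk) // cm_gt0 //; case: hQ.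
have hQ2 := orbit_of_level hQ h2; have [k hk ek] := (orbitP hQ hQ2).1 h2.
have hi : Gamma0star p (invmx g) by exact: Gamma0star_inv.
apply/orbitP => //; exists (k *m invmx g); first exact: Gamma0star_mul.
have z0 : 0 < complex.Im (cm_point R D Q) by apply: cm_gt0; case: hQ.
by rewrite ek e mobiusM ?(det_Gstar pp hk) ?(det_Gstar pp hi) ?Im_mobius_gt0 // mobiusVK.
Qed.

Lemma orbit_reprP O : orbits R D p O ->
  forms_level D p (orbit_repr O) /\ orbit_of R p (orbit_repr O) = O.
Proof.
move=> [Q hQ <-]; have h : orbit_of R p Q (orbit_repr (orbit_of R p Q)).
  by apply: xgetPex; exists Q; exact: orbit_refl.
by split; [exact: orbit_of_level h | exact: orbit_eq].
Qed.

Definition strip_forms (e : R) : set (bqf int) :=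
  [set Q | forms_level D p Q /\ in_strip e (cm_point R D Q)].

Lemma cm_lift Q g : forms_level D p Q -> Gamma0star p g ->
  exists2 Q', orbit_of R p Q Q' & cm_point R D Q' = mobius g (cm_point R D Q).
Proof.
move=> hQ hg; have hi : Gamma0star p (invmx g) by exact: Gamma0star_inv.
have [Q' hQ' hs] := act_exists hi hQ; have dg := det_Gstar pp hg.
have [fQ' e] := sends_form_of (detV1 dg) (proj1 hQ) hs.
exists Q'; first by exists (invmx g).
by rewrite e mobiusKV // cm_gt0.
Qed.

Lemma trans_strip z (e : R) : e < complex.Im z ->
  in_strip e (mobius (trans R (strip_shift (complex.Re z))) z).
Proof.
move=> h; rewrite /in_strip mobius_trans ImD ReD intC /= addr0.
by have /andP[h1 h2] := strip_shift_itv (complex.Re z); rewrite h h1 h2.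
Qed.

(** [reduction] lifts a member of each orbit above the cut, and a translation brings it into the
    strip. *)
Lemma orbits_finite (e : R) : e < (2 * p%:R)^-1 -> finite_set (strip_forms e) ->
  finite_set (orbits R D p).
Proof.
move=> he hf; apply: (sub_finite_set _ (finite_image (orbit_of R p) hf)).
move=> _ [Q hQ <-]; have z0 : 0 < complex.Im (cm_point R D Q) by apply: cm_gt0; case: hQ.
have [g hg hI] := reduction pp z0; have dg := det_Gstar pp hg.
set w := mobius g (cm_point R D Q) in hI; pose k := strip_shift (complex.Re w).
have hk := Gstar_trans R p k; have [Q' hO hc] := cm_lift hQ (Gamma0star_mul hk hg).
exists Q'; last exact: orbit_eq.
split; first exact: orbit_of_level hO.
rewrite hc mobiusM ?det_trans //; apply: trans_strip; exact: lt_le_trans hI.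
Qed.

Definition stab_mx Q : set 'M[R]_2 := [set g | Gamma0star p g /\ sends g Q Q].

Lemma stab_mxP Q g : forms_level D p Q -> stab_mx Q g <->
  Gamma0star p g /\ mobius g (cm_point R D Q) = cm_point R D Q.
Proof.
move=> [hQ _]; split=> -[hg hs]; split=> //; have dg := det_Gstar pp hg.
  by have [_ <-] := sends_form_of dg hQ hs.
exact: sends_cm.
Qed.

(** Followed by the translation that brings z into the strip, a stabilising matrix is one of the
    finitely many [strip_elts]. *)
Lemma stab_mx_finite Q : forms_level D p Q -> finite_set (stab_mx Q).
Proof.
move=> hQ; set z := cm_point R D Q; have z0 : 0 < complex.Im z by apply: cm_gt0; case: hQ.
have hf := strip_elts_finite pp z0 (divr_gt0 z0 (ltr0n R 2)).
pose k := strip_shift (complex.Re z).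
apply: (sub_finite_set _ (finite_image (fun g => invmx (trans R k) *m g) hf)).
move=> g /(stab_mxP _ hQ) [hg hz]; exists (trans R k *m g); last first.
  by rewrite mulKmx // unit_det1 // det_trans.
split; first by apply: Gamma0star_mul => //; exact: Gstar_trans.
rewrite mobiusM ?det_trans ?(det_Gstar pp hg) // hz; apply: trans_strip; lra.
Qed.

Lemma stabilizer_finite Q : forms_level D p Q -> finite_set (@stabilizer R p Q).
Proof. by move=> hQ; apply: finite_image; exact: stab_mx_finite. Qed.

Lemma stab_card_neq0 Q : forms_level D p Q -> (stab_card R p Q)%:R != 0 :> R[i].
Proof.
move=> hQ; rewrite pnatr_eq0 /stab_card cardfs_eq0; apply/negP => /eqP h.
have : @stabilizer R p Q (fun u => mobius 1%:M (set_val u)).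
  by exists 1%:M => //; apply/(stab_mxP _ hQ); rewrite mobius1; split=> //; exact: Gstar1.
by move/mem_set; rewrite -in_fset_set ?h ?inE //; exact: stabilizer_finite.
Qed.

Definition orbit_strip (e : R) Q : set (bqf int) :=
  [set Q' | orbit_of R p Q Q' /\ in_strip e (cm_point R D Q')].

(** One chosen element for each form of the orbit; there, by [moverP], the default 0 is never
    taken. *)
Definition mover Q Q' : 'M[R]_2 :=
  xget 0 [set g | Gamma0star p g /\ mobius g (cm_point R D Q) = cm_point R D Q'].

Definition stab_lift Q (F : @upper_half_plane R -> R[i]) : 'M[R]_2 :=
  xget 0 [set g | stab_mx Q g /\ (fun u => mobius g (set_val u)) = F].

Lemma moverP Q Q' : forms_level D p Q -> orbit_of R p Q Q' ->
  Gamma0star p (mover Q Q') /\ mobius (mover Q Q') (cm_point R D Q) = cm_point R D Q'.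
Proof.
move=> hQ hO; have [g hg e] := (orbitP hQ (orbit_of_level hQ hO)).1 hO.
have : exists g, [set g | Gamma0star p g /\ mobius g (cm_point R D Q) = cm_point R D Q'] g.
  by exists g.
exact: xgetPex.
Qed.

Lemma stab_liftP Q F : @stabilizer R p Q F ->
  stab_mx Q (stab_lift Q F) /\ (fun u => mobius (stab_lift Q F) (set_val u)) = F.
Proof.
move=> [g hg hF].
have : exists g, [set g | stab_mx Q g /\ (fun u => mobius g (set_val u)) = F] g by exists g.
exact: xgetPex.
Qed.

Definition pm (b : bool) g : 'M[R]_2 := if b then - g else g.

Lemma mobius_pm b g z : mobius (pm b g) z = mobius g z.
Proof. by case: b => //=; rewrite mobiusN. Qed.

Lemma mulmx_pm b g h : g *m pm b h = pm b (g *m h).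
Proof. by case: b => //=; rewrite mulmxN. Qed.

(** A group element g that brings z_Q into the strip is, in a unique way, the chosen mover to z_Q' =
    g z_Q, times the chosen lift of a transformation fixing z_Q, times a sign. The point determines
    Q' by [cm_inj], and matrices with the same action differ by a sign. *)
Lemma unfold_bij (e : R) Q : forms_level D p Q ->
  set_bij (orbit_strip e Q `*` (@stabilizer R p Q `*` [set: bool])) (strip_elts p e (cm_point R D Q))
    (fun t => mover Q t.1 *m pm t.2.2 (stab_lift Q t.2.1)).
Proof.
move=> hQ; set z := cm_point R D Q; have z0 : 0 < complex.Im z by apply: cm_gt0; case: hQ.
have act (Q' : bqf int) F b : orbit_of R p Q Q' -> @stabilizer R p Q F ->
    Gamma0star p (mover Q Q' *m pm b (stab_lift Q F)) /\
    mobius (mover Q Q' *m pm b (stab_lift Q F)) z = cm_point R D Q'.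
  move=> hO hF; have [hm em] := moverP hQ hO; have [/(stab_mxP _ hQ) [hs es] _] := stab_liftP hF.
  split.
    by apply: Gamma0star_mul => //; case: b => //=; exact: GstarN.
  by rewrite mulmx_pm mobius_pm mobiusM ?(det_Gstar pp hm) ?(det_Gstar pp hs) // es.
split.
- move=> [Q' [F b]] [[/= hO hs] [hF _]]; have [h1 h2] := act Q' F b hO hF.
  by split=> //; rewrite h2.
- move=> [Q1 [F1 b1]] [Q2 [F2 b2]]; rewrite !inE => -[[/= hO1 _] [hF1 _]] [[/= hO2 _] [hF2 _]] E.
  have [_ e1] := act Q1 F1 b1 hO1 hF1; have [_ e2] := act Q2 F2 b2 hO2 hF2.
  have QE : Q1 = Q2.
    apply: cm_inj; [by case: (orbit_of_level hQ hO1) | by case: (orbit_of_level hQ hO2) |].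
    by rewrite -e1 -e2 E.
  have [hm _] := moverP hQ hO2; have um := unit_det1 (det_Gstar pp hm).
  move: E; rewrite QE => /(can_inj (mulKmx um)) E.
  have [hs1 f1] := stab_liftP hF1; have [hs2 f2] := stab_liftP hF2.
  have FE : F1 = F2.
    by rewrite -f1 -f2; apply/funext => u; rewrite -(mobius_pm b1) E mobius_pm.
  rewrite FE; suff -> : b1 = b2 by [].
  move: E; rewrite FE; have dt := det_Gstar pp (proj1 hs2); move: dt; set k := stab_lift _ _ => dt.
  have kN : k <> - k.
    move=> hk; have k0 : k = 0.
      apply/matrixP => i j; have := congr1 (fun M : 'M[R]_2 => M i j) hk; rewrite !mxE => h; lra.
    by move: dt; rewrite k0 det0 => /eqP; rewrite eq_sym oner_eq0.
  by case: b1 b2 {e1 e2} => -[] //= /esym; rewrite ?opprK // => h; case: kN.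
move=> g [hg hs]; have dg := det_Gstar pp hg.
have [Q' hO hc] := cm_lift hQ hg; have [hm em] := moverP hQ hO; have dm := det_Gstar pp hm.
have hi : Gamma0star p (invmx (mover Q Q')) by exact: Gamma0star_inv.
pose s := invmx (mover Q Q') *m g; have hsG : Gamma0star p s by exact: Gamma0star_mul.
have sz : mobius s z = z.
  by rewrite mobiusM ?detV1 // -hc -em mobiusVK.
have hst : stab_mx Q s by apply/(stab_mxP _ hQ).
pose F : @upper_half_plane R -> R[i] := fun u => mobius s (set_val u).
have hF : @stabilizer R p Q F by exists s.
have [hl fl] := stab_liftP hF.
have gE : g = mover Q Q' *m s by rewrite mulKVmx // unit_det1.
have : s = stab_lift Q F \/ s = - stab_lift Q F.
  apply: mobius_inj_pm; [exact: det_Gstar hsG | exact: det_Gstar (proj1 hl) |].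
  move=> u u0; pose v : @upper_half_plane R := exist _ u (mem_set u0).
  by have := congr1 (fun G => G v) fl; rewrite /F /= => ->.
have hB : orbit_strip e Q Q' by split=> //; rewrite hc.
case=> sE; [exists (Q', (F, false)) | exists (Q', (F, true))] => //=.
  by rewrite -sE -gE.
by rewrite -sE -gE.
Qed.

Lemma fsum_const (T : choiceType) (S : set T) (x : R[i]) : finite_set S ->
  \sum_(i \in S) x = #|` fset_set S|%fset%:R * x.
Proof.
move=> hS; rewrite fsbig_finite // big_const_seq count_predT iter_addr_0 mulr_natl.
by congr (_ *+ _).
Qed.

(** The sign cancels the factor 1/2, and the stabilizer contributes its order, which the weight in
    the trace will cancel. *)
Lemma poincare_cut_cm m (e : R) Q : finite_set (strip_forms e) -> forms_level D p Q ->
  poincare_cut p m e (cm_point R D Q) =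
  (stab_card R p Q)%:R * \sum_(Q' \in orbit_strip e Q) phi m (cm_point R D Q').
Proof.
move=> hf hQ; have hB : finite_set (orbit_strip e Q).
  by apply: (sub_finite_set _ hf) => Q' [h1 h2]; split=> //; exact: orbit_of_level h1.
have hS := stabilizer_finite hQ; have hb : finite_set [set: bool] by exact: finite_finset.
rewrite /poincare_cut (reindex_fsbig _ _ _ _ (unfold_bij e hQ)).
have z0 : 0 < complex.Im (cm_point R D Q) by apply: cm_gt0; case: hQ.
rewrite (eq_fsbigr (fun t => phi m (cm_point R D t.1))); last first.
  move=> [Q' [F b]]; rewrite inE => -[[/= hO hs] [hF _]].
  have [hm em] := moverP hQ hO; have [/(stab_mxP _ hQ) [hs' es] _] := stab_liftP hF.
  by rewrite mulmx_pm mobius_pm mobiusM ?(det_Gstar pp hm) ?(det_Gstar pp hs') // es em.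
rewrite -(pair_fsbig _ (fun Q' _ => phi m (cm_point R D Q'))) //; last exact: finite_setX.
rewrite [in RHS]fsbig_distrr // [in LHS]fsbig_distrr //; apply: eq_fsbigr => Q' _ /=.
rewrite -(pair_fsbig _ (fun _ _ => phi m (cm_point R D Q'))) // fsum_const //.
have -> : \sum_(j \in [set: bool]) phi m (cm_point R D Q') = 2 * phi m (cm_point R D Q').
  by rewrite (fsbigTE [fset true; false]%fset) => [|[]]; rewrite ?inE // big_fsetU1 ?inE // big_seq_fset1 /=; ring.
rewrite mulrCA [RHS]/= /stab_card; congr (_ * _); by field.
Qed.

Lemma sum_orbits m (e : R) : finite_set (orbits R D p) -> finite_set (strip_forms e) ->
  \sum_(O \in orbits R D p) (stab_card R p (orbit_repr O))%:R^-1 *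
     poincare_cut p m e (cm_point R D (orbit_repr O)) =
  \sum_(Q \in strip_forms e) phi m (cm_point R D Q).
Proof.
move=> hO hf.
transitivity (\sum_(O \in orbits R D p) \sum_(Q \in strip_forms e)
   (if Q \in O then phi m (cm_point R D Q) else 0)).
  apply: eq_fsbigr => O; rewrite inE => hOO; have [hQ OE] := orbit_reprP hOO.
  rewrite poincare_cut_cm // mulKf ?stab_card_neq0 // -fsbig_mkcondr; apply: eq_fsbigl.
  rewrite /orbit_strip OE; apply/seteqP; split=> Q [h1 h2]; split=> //; last by case: h1.
  split=> //; apply: (orbit_of_level hQ); by rewrite OE.
(* Each form of the strip lies in exactly one orbit, its own. *)
rewrite exchange_fsbig //; apply: eq_fsbigr => Q; rewrite inE => -[hQ _].
rewrite (fsbigD1 (orbit_of R p Q)) //=; last by exists Q.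
rewrite ifT; last by rewrite inE; exact: orbit_refl.
rewrite fsbig1 ?addr0 // => O [[Q1 hQ1 <-] hne]; case: ifP => //; rewrite inE => h.
by case: hne => /=; rewrite (orbit_eq hQ1 h).
Qed.

Section Count.
Variable n : nat.
Hypothesis n0 : (0 < n)%N.
Let e : R := 2 * sD / n%:R.

Definition strip_list : seq (nat * nat) :=
  [seq (c, x) | c <- [seq c <- index_iota 1 n | (4 * p %| c)%N],
     x <- [seq x <- index_iota 0 (c %/ 2) | ((x%:Z ^+ 2)%R == - D%:Z %[mod c%:Z])%Z]].

Lemma strip_list_uniq : uniq strip_list.
Proof. by apply: uniq_dep_pairs => [|c _]; rewrite filter_uniq // iota_uniq. Qed.

Lemma mem_strip_list c x : ((c, x) \in strip_list) =
  [&& (0 < c < n)%N, (4 * p %| c)%N, (x < c %/ 2)%N & ((x%:Z ^+ 2)%R == - D%:Z %[mod c%:Z])%Z].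
Proof.
by rewrite mem_dep_pairs !mem_filter !mem_index_iota; case: (_ %| _)%N => /=; rewrite ?andbF // ![_ && (x < _)%N]andbC.
Qed.

(** The pair (c, x) encodes the form with 4 a = c and b = x; the division in the third coefficient
    is exact because x^2 = -D modulo c. *)
Definition form_cx (t : nat * nat) : bqf int :=
  ((t.1 %/ 4)%N%:Z, t.2%:Z, ((t.2%:Z ^+ 2 + D%:Z) %/ t.1%:Z)%Z).

Lemma in_strip_cm (a b c : int) : 0 < a -> in_strip e (cm_point R D (a, b, c)) <->
  [/\ 4 * a < n%:Z, 0 <= b & b < 2 * a].
Proof.
move=> a0; rewrite /in_strip; have [-> ->] := cm_parts b c a0.
have aR : (0 : R) < a%:~R by rewrite ltr0z.
have nR : (0 : R) < n%:R by rewrite ltr0n.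
have a2 : (0 : R) < 2 * a%:~R by rewrite mulr_gt0.
have -> : (e < sD / (2 * a%:~R)) = (4 * a < n%:Z).
  rewrite /e ltr_pdivlMr // mulrAC ltr_pdivrMr //.
  have -> : 2 * sD * (2 * a%:~R) = sD * (4 * a%:~R) :> R by ring.
  by rewrite ltr_pM2l // -(ltr_int R) intrM -pmulrn.
have -> : (- 1 < - (b%:~R / (2 * a%:~R)) :> R) = (b < 2 * a).
  by rewrite ltrN2 ltr_pdivrMr // mul1r -(ltr_int R) intrM.
have -> : (- (b%:~R / (2 * a%:~R)) <= 0 :> R) = (0 <= b).
  by rewrite oppr_le0 pmulr_lge0 ?invr_gt0 // ler0z.
by split=> -[].
Qed.

Lemma form_cx_bij : set_bij [set` strip_list] (strip_forms e) form_cx.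
Proof.
have div4 c : (4 * p %| c)%N -> c = (4 * (c %/ 4))%N.
  by move=> h; rewrite mulnC divnK //; apply: dvdn_trans h; exact: dvdn_mulr.
split.
- move=> [c x] /=; rewrite mem_strip_list => /and4P[/andP[c0 cn] pc xc hx].
  have cE := div4 _ pc; set k := (c %/ 4)%N in cE *.
  have k0 : (0 < k)%N by lia.
  have x2 : (x < 2 * k)%N by move: xc; rewrite cE (_ : 4 * k = 2 * k * 2)%N ?mulnK //; lia.
  have dv : (c%:Z %| x%:Z ^+ 2 + D%:Z)%Z by move: hx; rewrite eqz_mod_dvd opprK.
  have a0 : 0 < k%:Z by rewrite ltz_nat.
  rewrite /form_cx /= -/k; split; first split.
  + apply: pos_disc_forms => //.
    have -> : 4 * k%:Z * ((x%:Z ^+ 2 + D%:Z) %/ c%:Z)%Z = x%:Z ^+ 2 + D%:Z.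
      by rewrite -[RHS](divzK dv) mulrC; congr (_ * _); rewrite [in RHS]cE PoszM.
    by ring.
  + by rewrite /= dvdzE /= -(@dvdn_pmul2l 4) // -cE.
  apply/in_strip_cm => //; split=> //; by move: x2; lia.
- move=> [c x] [c' x']; rewrite !inE /= !mem_strip_list => /and4P[_ pc _ _] /and4P[_ pc' _ _].
  move=> [h1 h2 _]; rewrite h2; congr (_, _).
  by rewrite (div4 _ pc) (div4 _ pc') h1.
move=> [[a b] c] [[fQ /= pa] hs]; have a0 := forms_gt0 fQ; have [_ hd] := fQ.
move/(in_strip_cm b c a0): hs => [an b0 b2].
case: a a0 fQ pa hd an b2 => // a a0 fQ pa hd an b2; case: b b0 fQ hd b2 => // b b0 fQ hd b2.
rewrite ltz_nat in a0.
have e4 : 4 * a%:Z = (4 * a)%N%:Z by rewrite PoszM.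
have hE : b%:Z ^+ 2 + D%:Z = c * (4 * a)%N%:Z.
  by rewrite -e4; move: hd; set X := b%:Z ^+ 2; move=> h; rewrite -[D%:Z]opprK -h; ring.
have a4 : (0 < 4 * a)%N by rewrite muln_gt0.
exists ((4 * a)%N, b); last first.
  rewrite /form_cx /= hE mulzK ?eqz_nat -?lt0n // mulKn //.
rewrite /= mem_strip_list a4 /=; apply/and4P; split.
- by rewrite -ltz_nat -e4.
- by rewrite dvdn_pmul2l // -dvdzE.
- by rewrite (_ : 4 * a = 2 * a * 2)%N ?mulnK -?ltz_nat ?PoszM //; lia.
by rewrite eqz_mod_dvd opprK hE dvdz_mull.
Qed.

Lemma strip_forms_finite : finite_set (strip_forms e).
Proof.
have [_ _ hs] := form_cx_bij; apply: (sub_finite_set hs); apply: finite_image; exact: finite_seq.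
Qed.

Lemma phi_cm m (a b c : int) : 0 < a -> phi m (cm_point R D (a, b, c)) =
  2 * ee (m%:R * b%:~R / (2 * a%:~R)) * (sinh (pi * m%:R * sD / a%:~R))%:C.
Proof.
move=> a0; have [hR hI] := cm_parts b c a0.
have aN : (a%:~R : R) != 0 by rewrite intr_eq0 gt_eqF.
rewrite /phi !e2pi_polar; set z := cm_point _ _ _ in hR hI *.
have RE : complex.Re (- (m%:R * z)) = m%:R * b%:~R / (2 * a%:~R).
  by rewrite ReN natC ReZ hR; field.
have IE : complex.Im (- (m%:R * z)) = - (m%:R * sD / (2 * a%:~R)).
  by rewrite ImN natC ImZ hI; field.
have RE' : complex.Re (- (m%:R * conjc z)) = m%:R * b%:~R / (2 * a%:~R).
  by rewrite -RE !ReN !natC !ReZ; case: (z).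
have IE' : complex.Im (- (m%:R * conjc z)) = m%:R * sD / (2 * a%:~R).
  by rewrite -[RHS]opprK -IE !ImN !natC !ImZ; case: (z) => u v /=; ring.
rewrite RE IE RE' IE' /sinh.
have -> : - (2 * pi * - (m%:R * sD / (2 * a%:~R))) = pi * m%:R * sD / a%:~R :> R by field.
have -> : - (2 * pi * (m%:R * sD / (2 * a%:~R))) = - (pi * m%:R * sD / a%:~R) :> R by field.
set u := expR _; set v := expR _; set w := ee _.
have -> : ((u - v) / 2)%:C = (u%:C - v%:C) / 2 :> R[i].
  have -> : (2 : R[i])^-1 = ((2 : R)^-1)%:C by rewrite (fmorphV (real_complex R)) rmorph_nat.
  by apply: complex_eq => /=; ring.
by field.
Qed.

(** The shift x -> x + c/2 changes neither x^2 modulo c, as 4 | c, nor e(2 m x / c). The resulting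
    factor 2 is the one that appears in [phi_cm]. *)
Lemma expsum_half m c : (0 < c)%N -> (4 %| c)%N ->
  expsum R D m c = 2 * \sum_(0 <= x < c %/ 2 | ((x%:Z ^+ 2)%R == - D%:Z %[mod c%:Z])%Z)
     ee (m%:R * x%:R / (c %/ 2)%N%:R).
Proof.
move=> c0 c4; set h := (c %/ 2)%N.
have c2 : c = (h + h)%N by rewrite addnn -muln2 divnK //; apply: dvdn_trans c4.
have h0 : (0 < h)%N by lia.
have h2 : (2 %| h)%N by move: c4; rewrite c2; lia.
have hR : (h%:R : R) != 0 by rewrite pnatr_eq0 -lt0n.
have cR : (c%:R : R) = 2 * h%:R by rewrite {1}c2 natrD; ring.
have eE x : e2pi (2 * m%:R * x%:R / c%:R) = ee (m%:R * x%:R / h%:R) :> R[i].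
  rewrite /ee; congr e2pi; rewrite !natC -(fmorphV (real_complex R)) -!(rmorphM (real_complex R)).
  by congr (_%:C); rewrite cR; field.
rewrite /expsum -(big_mkord (fun x => ((x%:Z ^+ 2)%R == - D%:Z %[mod c%:Z])%Z)
   (fun x => e2pi (2 * m%:R * x%:R / c%:R : R[i]))) {1}c2.
rewrite (big_cat_nat _ (n := h)) ?leq_addr //= -{2}[h]add0n big_addn addnK.
have -> (x : R[i]) : 2 * x = x + x by ring.
congr (_ + _); first by apply: eq_bigr => x _; rewrite eE.
apply: eq_big => [x|x _].
  rewrite !eqz_mod_dvd !opprK; congr (_ : bool).
  have -> : ((x + h)%N%:Z ^+ 2 + D%:Z) = (x%:Z ^+ 2 + D%:Z) + (x%:Z + (h %/ 2)%N%:Z) * c%:Z.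
    have hE : h%:Z = (h %/ 2)%N%:Z * 2 by rewrite -[2]/(2%:Z) -PoszM divnK.
    by rewrite [in RHS]c2 !PoszD hE; ring.
  by rewrite rpredDr // dvdz_mull.
rewrite eE (_ : m%:R * (x + h)%N%:R / h%:R = m%:R * x%:R / h%:R + m%:Z%:~R :> R) ?eeDint //.
by rewrite natrD -pmulrn; field.
Qed.

Lemma sum_strip_forms m : \sum_(Q \in strip_forms e) phi m (cm_point R D Q) = sinh_series R p D m n.
Proof.
rewrite (reindex_fsbig _ _ _ _ form_cx_bij) -fsbig_seq ?strip_list_uniq //.
rewrite /strip_list big_allpairs_dep big_filter /sinh_series.
rewrite big_nat_cond [RHS]big_nat_cond; apply: eq_bigr => c /andP[/andP[c0 cn] pc].
have c4 : (4 %| c)%N by apply: dvdn_trans pc; exact: dvdn_mulr.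
have cE : c = (4 * (c %/ 4))%N by rewrite mulnC divnK.
set k := (c %/ 4)%N in cE; have k0 : (0 < k)%N by lia.
have kR : (k%:R : R) != 0 by rewrite pnatr_eq0 -lt0n.
have hE : (c %/ 2 = 2 * k)%N by rewrite {1}cE (_ : 4 * k = 2 * k * 2)%N ?mulnK //; lia.
rewrite expsum_half // mulrAC mulr_sumr big_filter; apply: eq_bigr => x _.
rewrite /form_cx /fst /snd -/k phi_cm ?ltz_nat // -!pmulrn hE natrM -/sD.
have -> : 4 * pi * m%:R * sD / c%:R = pi * m%:R * sD / k%:R :> R.
  by rewrite cE natrM; field.
by ring.
Qed.

End Count.

Lemma orbits_fin : finite_set (orbits R D p).
Proof.
(* Large enough for the cut 2 sqrt D / n to lie below the reduction height 1 / (2 p). *)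
pose n := (Num.trunc (2 * sD * (2 * p%:R))).+1.
apply: (@orbits_finite (2 * sD / n%:R)); last exact: strip_forms_finite.
rewrite ltr_pdivrMr ?ltr0n // [_^-1 * _]mulrC ltr_pdivlMr ?mulr_gt0 ?ltr0n //.
exact: truncnS_gt.
Qed.

End Forms.

(** A limit over finitely many orbits: the n-th partial sum is the trace of the series truncated at
    height 2 sqrt D / n. The convergence of the conditionally convergent series is thereby inherited
    from that of the truncations. *)
Lemma sinh_series_cvg (R : realType) (p D m : nat) : prime p -> (0 < D)%N -> (0 < m)%N ->
  ccvg (sinh_series R p D m)
    (\sum_(O \in orbits R D p) (stab_card R p (orbit_repr O))%:R^-1 *
       poincare p m (cm_point R D (orbit_repr O))).
Proof.
move=> pp D0 m0; have hO := orbits_fin R pp D0.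
rewrite fsbig_finite // big_seq.
have h : ccvg (fun n => \sum_(O <- fset_set (orbits R D p) | O \in fset_set (orbits R D p)) (stab_card R p (orbit_repr O))%:R^-1 *
     poincare_cut p m (2 * Num.sqrt D%:R / n%:R) (cm_point R D (orbit_repr O)))
   (\sum_(O <- fset_set (orbits R D p) | O \in fset_set (orbits R D p)) (stab_card R p (orbit_repr O))%:R^-1 *
       poincare p m (cm_point R D (orbit_repr O))).
  apply: ccvg_sum => O; rewrite in_fset_set // inE => OO.
  have [[hQ _] _] := orbit_reprP pp D0 OO; apply: ccvgZ => del del0.
  have [e1 e10 he1] := poincare_cut_cvg pp m0 (cm_gt0 R D0 hQ) del0.
  have s0 : 0 < 2 * Num.sqrt D%:R :> R by rewrite mulr_gt0 // sqrtr_gt0 ltr0n.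
  exists (Num.trunc (2 * Num.sqrt D%:R / e1)).+1 => n hn.
  have n0 : (0 < n)%N by apply: leq_trans hn.
  have nR : (0 : R) < n%:R by rewrite ltr0n.
  apply: he1; first by rewrite divr_gt0.
  rewrite ler_pdivrMr // [e1 * _]mulrC -ler_pdivrMr //; apply: (@le_trans _ _ (Num.trunc (2 * Num.sqrt D%:R / e1)).+1%:R).
    by rewrite ltW // truncnS_gt.
  by rewrite ler_nat.
move=> del del0; have [N hN] := h del del0; exists N.+1 => n Nn.
have n0 : (0 < n)%N by apply: leq_trans Nn.
rewrite -sum_strip_forms // -sum_orbits //; last exact: strip_forms_finite.
by rewrite fsbig_finite // big_seq; apply: hN; exact: ltnW.
Qed.

Unset Implicit Arguments.

Theorem theorem1 (R : realType) (p D N : nat) (f : R[i] -> R[i])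
    (a b : nat -> R[i]) :
  prime p -> (0 < D)%N ->
  (exists x : int, (x ^+ 2 = - D%:Z %[mod (4 * p)%:Z])%Z) ->
  modular_function p f ->
  (forall z, upper_half_plane z ->
     (fun k => \sum_(1 <= m < N.+1) a m * e2pi (- (m%:R * z))
               + \sum_(1 <= n < k) b n * e2pi (n%:R * z) : R[i]^o) @ \oo
       --> (f z : R[i]^o)) ->
  (forall m : nat, (1 <= m <= N)%N -> cvgn (sinh_series R p D m)) /\
  trace_star p f D =
    \sum_(1 <= m < N.+1)
      a m * ((cconst R p m)%:C * (Hstar R p D)%:C
             + limn (sinh_series R p D m)).
Proof.
move=> pp D0 _ [_ finv _] hf.
split=> [m /andP[m0 _]|]; first by have [] := ccvg_lim (@sinh_series_cvg R p D m pp D0 m0).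
have pR : (0 : R) < (2 * p%:R)^-1 by rewrite invr_gt0 mulr_gt0 // ltr0n prime_gt0.
(* The constant - [cusp_const] supplied by [f_expand] is [cconst]. *)
have fE (z : R[i]) : 0 < complex.Im z ->
    f z = \sum_(1 <= m < N.+1) a m * (poincare p m z + (cconst R p m)%:C).
  move=> z0; rewrite (@f_expand R p N f a b (prime_gt0 pp) _ _ pR) //.
  - by apply: eq_big_nat => m /andP[m0 _]; rewrite cusp_const_value // opprK.
  - by move=> w w0; apply/ccvgP; exact: hf.
  move=> w w0; have [g hg hI] := reduction pp w0; exists (mobius g w).
  by split; [exact: hI | exact: finv | move=> m m0; exact: poincare_inv].
have hO := orbits_fin R pp D0; rewrite /trace_star /Hstar !fsbig_finite //.
rewrite (rmorph_sum (real_complex R)) big_seq /=.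
set r := fset_set _; pose s O : R[i] := (stab_card R p (orbit_repr O))%:R^-1.
rewrite (eq_bigr (fun O => \sum_(1 <= m < N.+1) a m *
   (s O * poincare p m (cm_point R D (orbit_repr O)) + (cconst R p m)%:C * s O))); last first.
  move=> O; rewrite in_fset_set // inE => /(orbit_reprP pp D0) [[hQ _] _].
  rewrite fE ?cm_gt0 // mulr_sumr; apply: eq_bigr => m _.
  by rewrite -/(s O); move: (poincare _ _ _) => F; ring.
(* For each m the series contribute the limit above, and the constant multiplies the sum of the
   weights, which is [Hstar]. *)
rewrite -big_seq exchange_big /=; apply: eq_big_nat => m /andP[m0 _].
have [_ ->] := ccvg_lim (@sinh_series_cvg R p D m pp D0 m0).
rewrite -mulr_sumr big_split /= -mulr_sumr fsbig_finite // addrC; congr (_ * (_ * _ + _)).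
by apply: eq_bigr => O _; rewrite (fmorphV (real_complex R)) rmorph_nat.
Qed.
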